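(* Let $k,n\in\mathbb{N}=\{1,2,\ldots\}$ and let $\mathcal{C}=(\mathcal{O},\mathcal{M})$ be a small weak $(kn,k)$-form category. Then every subset of $\mathcal{C}ap(\mathcal{C})$ that finitely differentiably generates (at least) $\mathcal{C}ap(\mathcal{C})$ is uncountable, provided that there exist an interval $A$ of positive length and a map $M:A\to\mathcal{O}$ such that (1) $M_a:=M(a)$ is maxipotent for every $a\in A$, (2) $\operatorname{Vol}\circ M$ is continuous and strictly increasing, (3) $c_{M_a}(M_{a'})=1$ for all $a,a'\in A$ with $a\leq a'$.
   Context: Manifolds are smooth, real, finite-dimensional, Hausdorff and second countable; they may be disconnected and may have boundary. An embedding is an injective smooth immersion with continuous inverse (no condition involving the boundaries). $\Omega^{m,k}$ is the category whose objects are pairs $(M,\omega)$ with $M$ an $m$-dimensional manifold and $\omega$ a differential $k$-form on $M$, and whose morphisms are embeddings that intertwine the differential forms. A weak $(m,k)$-form category is a subcategory $\mathcal{C}=(\mathcal{O},\mathcal{M})$ of $\Omega^{m,k}$ ($\mathcal{O}$ objects, $\mathcal{M}$ morphisms) such that $(M,a\omega)\in\mathcal{O}$ for all $(M,\omega)\in\mathcal{O}$ and $a\in(0,\infty)$. It is small if its objects and its morphisms form sets. A generalized capacity on a small weak form category $\mathcal{C}$ is a function $c:\mathcal{O}\to[0,\infty]$ such that $c(M,\omega)\leq c(M',\omega')$ whenever there is a $\mathcal{C}$-morphism from $(M,\omega)$ to $(M',\omega')$, and $c(M,a\omega)=a\,c(M,\omega)$ for all $(M,\omega)\in\mathcal{O}$,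 $a\in(0,\infty)$. $\mathcal{C}ap(\mathcal{C})$ is the set of these. An object $(M,\omega)$ of $\Omega^{kn,k}$ is maxipotent if $\omega^{\wedge n}$ vanishes nowhere on $M$. In that case $M$ is oriented by $\omega^{\wedge n}$ and $\operatorname{Vol}(M,\omega):=\frac1{n!}\int_M\omega^{\wedge n}$. For an object $X=(M,\omega)$ of $\Omega^{kn,k}$ the domain-embedding capacity is $c_X(M',\omega'):=\sup\{c\in(0,\infty)\mid\exists\,\Omega^{kn,k}\text{-morphism }(M,c\omega)\to(M',\omega')\}$ (with $\sup\emptyset=0$). For a set $S$ and $\mathcal{F},\mathcal{G}\subseteq[0,\infty]^S$, $\mathcal{G}$ finitely differentiably generates at least $\mathcal{F}$ if for every $F\in\mathcal{F}$ there exist a finite subset $\mathcal{G}_0\subseteq\mathcal{G}$ and a differentiable function $f:[0,\infty]^{\mathcal{G}_0}\to[0,\infty]$ such that $F=f\circ\operatorname{ev}_{\mathcal{G}_0}$, where $\operatorname{ev}_{\mathcal{G}_0}:S\to[0,\infty]^{\mathcal{G}_0}$, $\operatorname{ev}_{\mathcal{G}_0}(s)(u):=u(s)$. Here $[0,\infty]$ is viewed as a compact $1$-dimensional manifold with boundary, $[0,\infty]^{\mathcal{G}_0}$ as a manifold with boundary and corners, and $f$ is only assumed to be differentiable once, with possibly discontinuous derivative. Countable means finite or countably infinite. *)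

(* Defs.v *)
From mathcomp Require Import all_boot all_order all_algebra all_fingroup.
From mathcomp Require Import all_classical all_reals all_analysis.

Set Implicit Arguments.
Unset Strict Implicit.
Unset Printing Implicit Defensive.

Import Order.TTheory GRing.Theory Num.Theory.
Import numFieldNormedType.Exports.

Local Open Scope classical_set_scope.
Local Open Scope ring_scope.

Section Smooth.
Context {R : realType}.

Fixpoint Cn {p} {V : normedModType R} (n : nat) (W : set 'rV[R]_p)
    (f : 'rV[R]_p -> V) : Prop :=
  if n is n'.+1 then
    exists df : 'rV[R]_p -> 'rV[R]_p -> V,
      (forall x, W x -> is_diff x f (df x)) /\
      (forall v, Cn n' W (fun x => df x v))
  else forall x, W x -> {for x, continuous f}.

(* D is arbitrary: f is smooth on D if near each point of D it extends to a
   C^oo function on an open set.  For D relatively open in the half-space this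
   is the usual notion of smoothness up to the boundary. *)
Definition smooth_on {p} {V : normedModType R} (D : set 'rV[R]_p)
    (f : 'rV[R]_p -> V) : Prop :=
  forall x, D x -> exists (W : set 'rV[R]_p) (g : 'rV[R]_p -> V),
    [/\ open W, W x, (forall n, Cn n W g)
      & forall y, W y -> D y -> f y = g y].

Definition has_diff_within {p} {V : normedModType R} (D : set 'rV[R]_p)
    (f : 'rV[R]_p -> V) (x : 'rV[R]_p) (L : 'rV[R]_p -> V) : Prop :=
  forall e : R, 0 < e ->
    \forall y \near x, D y -> `|f y - f x - L (y - x)| <= e * `|y - x|.

(* The derivative of f relative to D as a Jacobian matrix acting on row vectors
   from the right.  It is unique when D is relatively open in the half-space,
   the only case in which it is used below. *)
Definition jac_within {p q} (D : set 'rV[R]_p) (f : 'rV[R]_p -> 'rV[R]_q)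
    (x : 'rV[R]_p) : 'M[R]_(p, q) :=
  xget 0 [set A | has_diff_within D f x (mulmxr A)].

(* The half-space {x | 0 <= x_0} (a point if p = 0). *)
Definition half_space (p : nat) : set 'rV[R]_p :=
  [set x | forall i : 'I_p, val i = 0%N -> 0 <= x 0 i].

End Smooth.

Arguments half_space {R} p.

(* cmap is meaningful on cdom only, and cinv on the image of cdom only. *)
Record chart (R : realType) (T : topologicalType) (m : nat) := Chart {
  cdom : set T;
  cmap : T -> 'rV[R]_m;
  cinv : 'rV[R]_m -> T }.

Section Charts.
Context {R : realType} {T : topologicalType} {m : nat}.
Implicit Types c : chart R T m.

Definition cimg c : set 'rV[R]_m := cmap c @` cdom c.

Definition is_chart c : Prop :=
  [/\ open (cdom c),
      (exists2 W : set 'rV[R]_m, open W & cimg c = W `&` half_space m),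
      (forall p, cdom c p -> cinv c (cmap c p) = p),
      {within cdom c, continuous (cmap c)}
    & {within cimg c, continuous (cinv c)}].

Definition overlap c1 c2 : set 'rV[R]_m := cmap c1 @` (cdom c1 `&` cdom c2).

Definition transition c1 c2 : 'rV[R]_m -> 'rV[R]_m := cmap c2 \o cinv c1.

Definition compatible c1 c2 : Prop :=
  smooth_on (overlap c1 c2) (transition c1 c2) /\
  smooth_on (overlap c2 c1) (transition c2 c1).

End Charts.

Record manifold (R : realType) (m : nat) := Manifold {
  msort :> topologicalType;
  atlas : set (chart R msort m);
  mfd_hausdorff : hausdorff_space msort;
  mfd_second_countable : @second_countable msort;
  mfd_chart : forall c, atlas c -> is_chart c;
  mfd_cover : forall p : msort, exists2 c, atlas c & cdom c p;
  mfd_compat : forall c1 c2, atlas c1 -> atlas c2 -> compatible c1 c2;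
  mfd_maximal : forall c, is_chart c ->
    (forall c', atlas c' -> compatible c c') -> atlas c }.

Section Multilinear.
Context {R : realType} {m : nat}.

Definition is_multilinear k (w : ('I_k -> 'rV[R]_m) -> R) : Prop :=
  forall v (i : 'I_k) (a : R) (x y : 'rV[R]_m),
    w [eta v with i |-> a *: x + y] =
    a * w [eta v with i |-> x] + w [eta v with i |-> y].

Definition is_alternating k (w : ('I_k -> 'rV[R]_m) -> R) : Prop :=
  forall v (i j : 'I_k), i != j -> v i = v j -> w v = 0.

(* Normalized so that (dx_1 /\ ... /\ dx_p)(e_1, ..., e_p) = 1. *)
Definition wedge k l (w : ('I_k -> 'rV[R]_m) -> R)
    (w' : ('I_l -> 'rV[R]_m) -> R) (v : 'I_(k + l) -> 'rV[R]_m) : R :=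
  (k`!%:R * l`!%:R)^-1 *
  \sum_(s : 'S_(k + l)) (-1) ^+ s *
    w (fun i => v (s (lshift l i))) * w' (fun j => v (s (rshift k j))).

(* (n.+1 * k)%N is convertible to (k + n * k)%N. *)
Fixpoint wedge_pow k (w : ('I_k -> 'rV[R]_m) -> R) (n : nat) :
    ('I_(n * k) -> 'rV[R]_m) -> R :=
  match n return ('I_(n * k) -> 'rV[R]_m) -> R with
  | 0%N => fun=> 1
  | n'.+1 => wedge w (@wedge_pow k w n')
  end.

End Multilinear.

Arguments wedge_pow {R m k} w n v.

(* A k-form is given by its representatives in all charts of the maximal atlas,
   related by pullback along the transition maps.  [form_junk] makes the
   representation unique. *)
Record form (R : realType) (m k : nat) (M : manifold R m) := Form {
  form_rep :> chart R M m -> 'rV[R]_m -> ('I_k -> 'rV[R]_m) -> R;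
  form_multilinear : forall c x, is_multilinear (form_rep c x);
  form_alternating : forall c x, is_alternating (form_rep c x);
  form_smooth : forall c v, atlas c ->
    smooth_on (cimg c) (fun x => form_rep c x v : R^o);
  form_compat : forall c1 c2 x v, atlas c1 -> atlas c2 -> overlap c1 c2 x ->
    form_rep c1 x v =
    form_rep c2 (transition c1 c2 x)
      (fun i => v i *m jac_within (overlap c1 c2) (transition c1 c2) x);
  form_junk : forall c x v, ~ (atlas c /\ cimg c x) -> form_rep c x v = 0 }.

Section ScaleForm.
Context {R : realType}.

Lemma CnZ p (V : normedModType R) n (W : set 'rV[R]_p) (a : R)
    (f : 'rV[R]_p -> V) : Cn n W f -> Cn n W (fun x => a *: f x).
Proof.
elim: n f => [|n IHn] f /=.
  by move=> cf x Wx; apply: continuousZl_tmp; exact: (cf x Wx).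
case=> df [fdf cf]; exists (fun x v => a *: df x v); split=> [x Wx|v].
  by have ? := fdf x Wx; exact: is_diffZ.
exact/IHn/cf.
Qed.

Lemma smooth_onZ p (V : normedModType R) (D : set 'rV[R]_p) (a : R)
    (f : 'rV[R]_p -> V) : smooth_on D f -> smooth_on D (fun x => a *: f x).
Proof.
move=> sf x /sf[W [g [oW Wx Cg fg]]]; exists W, (fun x => a *: g x).
by split=> // [n|y Wy Dy]; [exact: CnZ|rewrite fg].
Qed.

Context {m k : nat} {M : manifold R m}.
Variables (a : R) (w : form k M).

Let aw : chart R M m -> 'rV[R]_m -> ('I_k -> 'rV[R]_m) -> R :=
  fun c x v => a * w c x v.

Let aw_multilinear c x : is_multilinear (aw c x).
Proof.
by move=> v i b y z; rewrite /aw form_multilinear mulrDr mulrCA.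
Qed.

Let aw_alternating c x : is_alternating (aw c x).
Proof.
by move=> v i j ij vij; rewrite /aw (form_alternating w c x ij vij) mulr0.
Qed.

Let aw_smooth c v : atlas c -> smooth_on (cimg c) (fun x => aw c x v : R^o).
Proof. by move=> ac; apply: smooth_onZ; exact: form_smooth. Qed.

Let aw_compat c1 c2 x v : atlas c1 -> atlas c2 -> overlap c1 c2 x ->
  aw c1 x v = aw c2 (transition c1 c2 x)
    (fun i => v i *m jac_within (overlap c1 c2) (transition c1 c2) x).
Proof. by move=> a1 a2 ox; rewrite /aw (form_compat w v a1 a2 ox). Qed.

Let aw_junk c x v : ~ (atlas c /\ cimg c x) -> aw c x v = 0.
Proof. by move=> nx; rewrite /aw form_junk ?mulr0. Qed.

Definition scale_form : form k M :=
  Form aw_multilinear aw_alternating aw_smooth aw_compat aw_junk.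

End ScaleForm.

Record mfd_form (R : realType) (m k : nat) := MfdForm {
  mf_mfd :> manifold R m;
  mf_form : form k mf_mfd }.

Definition scale {R : realType} {m k} (a : R) (X : mfd_form R m k) :
    mfd_form R m k :=
  MfdForm (scale_form a (mf_form X)).

Section Morphisms.
Context {R : realType} {m k : nat}.

Section Embedding.
Context {M N : manifold R m} (phi : M -> N).

(* The domain and the formula of phi read in the charts c and c'. *)
Definition loc_dom (c : chart R M m) (c' : chart R N m) : set 'rV[R]_m :=
  cmap c @` (cdom c `&` phi @^-1` cdom c').

Definition loc_map (c : chart R M m) (c' : chart R N m) :
    'rV[R]_m -> 'rV[R]_m :=
  cmap c' \o phi \o cinv c.

Definition loc_jac c c' : 'rV[R]_m -> 'M[R]_m :=
  jac_within (loc_dom c c') (loc_map c c').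

Definition is_smooth : Prop :=
  continuous phi /\
  forall c c', atlas c -> atlas c' -> smooth_on (loc_dom c c') (loc_map c c').

Definition is_immersion : Prop :=
  forall c c' x, atlas c -> atlas c' -> loc_dom c c' x ->
    injective (fun v : 'rV[R]_m => v *m loc_jac c c' x).

(* The last clause says that the inverse, defined on the image of phi with the
   subspace topology, is continuous. *)
Definition is_embedding : Prop :=
  [/\ injective phi, is_smooth, is_immersion
    & forall U : set M, open U -> exists2 V : set N, open V & U = phi @^-1` V].

Definition intertwines (w : form k M) (w' : form k N) : Prop :=
  forall c c' x v, atlas c -> atlas c' -> loc_dom c c' x ->
    w' c' (loc_map c c' x) (fun i => v i *m loc_jac c c' x) = w c x v.

End Embedding.

Definition is_morphism (X Y : mfd_form R m k) (phi : X -> Y) : Prop :=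
  is_embedding phi /\ intertwines phi (mf_form X) (mf_form Y).

End Morphisms.

(* Smallness is built in: the objects are indexed by a type ob of the universe
   of sets (the type of all manifolds is too large for this).  The indexing is
   injective, so ob amounts to a set of objects of the ambient category. *)
Record small_weak_form_category (R : realType) (m k : nat) := WeakFormCategory {
  ob : Type;
  ob_val :> ob -> mfd_form R m k;
  ob_val_inj : forall X Y, ob_val X = ob_val Y -> X = Y;
  hom : forall X Y : ob, set (ob_val X -> ob_val Y);
  hom_morphism : forall X Y phi, @hom X Y phi -> is_morphism phi;
  hom_id : forall X, @hom X X id;
  hom_comp : forall X Y Z (phi : ob_val X -> ob_val Y)
      (psi : ob_val Y -> ob_val Z),
    @hom X Y phi -> @hom Y Z psi -> @hom X Z (psi \o phi);
  ob_scale : forall X (a : R), 0 < a ->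
    exists aX, ob_val aX = scale a (ob_val X) }.

Arguments hom {R m k} C X Y phi : rename.

Section Capacities.
Context {R : realType}.
Local Open Scope ereal_scope.

Definition Cap {m k} (C : small_weak_form_category R m k) :
    set (ob C -> \bar R) :=
  [set c | [/\ forall X, 0 <= c X,
      forall X Y, hom C X Y !=set0 -> c X <= c Y
    & forall X aX (a : R), (0 < a)%R -> C aX = scale a (C X) ->
        c aX = a%:E * c X]].

(* 0 is thrown in so that the supremum of the empty set is 0. *)
Definition domain_capacity {m k} (X Y : mfd_form R m k) : \bar R :=
  ereal_sup [set r%:E | r in [set r : R | r = 0%R \/
    (0 < r)%R /\ exists phi : scale r X -> Y, is_morphism phi]].

(* Lebesgue integral over R^m of a nonnegative Borel function, as an iterated
   one-dimensional integral (Tonelli). *)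
Fixpoint integral_rV (m : nat) : ('rV[R]_m -> \bar R) -> \bar R :=
  match m return ('rV[R]_m -> \bar R) -> \bar R with
  | 0%N => fun f => f 0%R
  | m'.+1 => fun f => \int[lebesgue_measure]_(t in [set: R])
      integral_rV (fun y : 'rV[R]_m' => f (row_mx (t%:M : 'rV[R]_1) y))
  end.

Definition borel_rV (m : nat) : set (set 'rV[R]_m) := <<s open >>.

Section Volume.
Context {n k : nat}.
Implicit Type X : mfd_form R (n * k) k.

Definition maxipotent X : Prop :=
  forall c x, atlas c -> cimg c x ->
    exists v, wedge_pow (mf_form X c x) n v != 0%R.

(* The absolute value of the coefficient of the n-th exterior power in the
   chart c.  The manifold being oriented by this power, an orientation
   preserving chart has a positive coefficient, and in an orientation reversing
   one the integral of the form is minus that of its negative coefficient. *)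
Definition vol_density X (c : chart R X (n * k)) (x : 'rV[R]_(n * k)) : R :=
  `| wedge_pow (mf_form X c x) n (fun i => delta_mx 0 i) |%R.

(* The integral of the n-th power is that of a density, hence a countably
   additive function of Borel sets: it is the supremum, over all finite families
   of disjoint Borel pieces each contained in a chart domain, of the total
   integral over the pieces, computed in these charts.  A piece is given by its
   image in the chart. *)
Definition vol X : \bar R :=
  (n`!%:R^-1)%:E *
  ereal_sup [set s | exists (N : nat) (c : 'I_N -> chart R X (n * k))
      (B : 'I_N -> set 'rV[R]_(n * k)),
    [/\ forall i, atlas (c i),
        forall i, borel_rV (B i) /\ B i `<=` cimg (c i),
        trivIset [set: 'I_N] (fun i => cinv (c i) @` B i)
      & s = \sum_(i < N)
          integral_rV (fun x => (\1_(B i) x * vol_density (c i) x)%:E)]].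

End Volume.

(* [0, oo] is given the smooth structure of [0, 1] via the library's
   contract : x |-> x / (1 + x), oo |-> 1, with inverse expand; its charts are
   x near the finite points and 1 / x near oo, up to diffeomorphism.  Functions
   on [0, oo]^N thus become functions on the cube [0, 1]^N. *)
Definition cube (N : nat) : set 'rV[R]_N :=
  [set x | forall i, (0 <= x 0%R i <= 1)%R].

Arguments cube N _ : clear implicits.

Definition ediff {N : nat} (f : ('I_N -> \bar R) -> \bar R) : Prop :=
  forall x, cube N x -> exists L : {linear 'rV[R]_N -> R^o},
    has_diff_within (cube N)
      (fun y => contract (f (fun i => expand (y 0%R i))) : R^o) x L.

(* The functions in F and G are assumed to be nonnegative.  The finite subset of
   G is given by an enumeration g without repetition. *)
Definition fin_diff_generates {S : Type} (G F : set (S -> \bar R)) : Prop :=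
  forall u, F u -> exists (N : nat) (g : 'I_N -> S -> \bar R)
      (f : ('I_N -> \bar R) -> \bar R),
    [/\ injective g, forall i, G (g i),
        forall y, (forall i, 0 <= y i) -> 0 <= f y,
        ediff f
      & forall s, u s = f (fun i => g i s)].

End Capacities.

Arguments Cap {R m k} C _.
Arguments cube {R} N _.

(* Main.v *)
Require Import Defs.
From HB Require Import structures.
From mathcomp Require Import all_boot all_order all_algebra all_fingroup.
From mathcomp Require Import all_classical all_reals all_analysis.
From mathcomp Require Import measurable_realfun ring lra.

Import Order.TTheory GRing.Theory Num.Theory.
Import numFieldNormedType.Exports.

Local Open Scope classical_set_scope.
Local Open Scope ring_scope.

Set Implicit Arguments.
Unset Strict Implicit.
Unset Printing Implicit Defensive.

(* For an object X let d_X be the smallest capacity with d_X(X) >= 1 and e_X the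
   largest one with e_X(X) <= 1.  Comparison with the domain-embedding capacities
   of the given family M gives d_X(Y) <= 1 <= e_X(Y) for X = M_s and Y = M_b, and
   one inequality is strict if b <> s: an embedding (M_b, r w) -> (M_s, w') forces
   r^n Vol M_b <= Vol M_s, so that c_{M_b}(M_s) < 1 when s < b.  After the
   identification of [0, oo] with [0, 1], homogeneity bounds the variation of every
   capacity between X and Y by twice the gap e_X(Y) - d_X(Y).  Hence the gap, as a
   function of the increments of any finite family of capacities, has a strict kink
   at s.  If it is moreover a differentiable function of finitely many generators,
   some linear combination of their increments is positive at all b <> s at which
   these increments are small, and its coefficients can be taken rational.  So s is
   determined by the names of the generators and finitely many rational numbers,
   and a countable set of generators would make the interval countable.

   The volume estimate reduces to the inequality between the integral of h over B
   and that of h' over f(B), if h <= |det Df| (h' o f) and f is injective on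
   D = W `&` half_space and differentiable relative to D at each point.  B is cut
   into countably many pieces on which f, followed by a rational matrix S, is
   nearly an isometry. *)

(** * Lebesgue measure on R^m *)

(** Both extremal capacities are needed because each may be flat on one side of s: the family gives
    a strict drop of d_X for b < s and a strict rise of e_X for b > s, while the final argument
    compares two parameters with the same data in both directions. No capacity is known to be
    continuous along M, so b being close to s says nothing about the increments; closeness is
    measured by the generators themselves, and parameters that they separate are told apart by
    rational approximations of their values. Embeddings satisfy no condition at the boundary:
    boundary points may go to interior points, and images in charts need not be relatively open.
    Hence the volume estimate is an inequality for differentials relative to D, proved without local
    inverses. The sup norm on row vectors makes balls cubes, so that the diameter bounds the measure
    with constant 1 and nearly isometric pieces lose only a factor close to 1. *)

Section MatrixNorm.
Context {R : realType} {m n : nat}.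
Implicit Types (x y : 'M[R]_(m, n)) (e : R).

Lemma mx_norm_leP x e : 0 <= e -> (forall i j, `|x i j| <= e) <-> `|x| <= e.
Proof.
move=> e0; rewrite [`|x|]mx_normrE; split=> [xe|/bigmax_leP[_ xe] i j].
  by apply/bigmax_leP; split => // -[].
exact: (xe (i, j)).
Qed.

Lemma mx_norm_ltP x e : 0 < e -> (forall i j, `|x i j| < e) <-> `|x| < e.
Proof.
move=> e0; rewrite [`|x|]mx_normrE; split=> [xe|/bigmax_ltP[_ xe] i j].
  by apply/bigmax_ltP; split => // -[].
exact: (xe (i, j)).
Qed.

Lemma ler_mx_entry x i j : `|x i j| <= `|x|.
Proof. by have [_] := mx_norm_leP x (normr_ge0 x); apply. Qed.

Lemma mx_ballE x e y : ball x e y <-> `|x - y| < e.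
Proof. by rewrite -ball_normE. Qed.

Lemma rat_mx_dense x e : 0 < e ->
  exists q : 'M[rat]_(m, n), `|x - map_mx ratr q| < e.
Proof.
move=> e0.
have /= dq i j : exists q : rat, `|x i j - ratr q| < e.
  have [|q] := @rat_in_itvoo R (x i j) (x i j + e); first by rewrite ltrDl.
  rewrite in_itv /= => /andP[q1 q2]; exists q.
  by rewrite distrC gtr0_norm ?subr_gt0// ltrBlDl.
exists (\matrix_(i, j) sval (cid (dq i j))).
by apply/mx_norm_ltP => // i j; rewrite !mxE; case: cid.
Qed.

End MatrixNorm.

Section OpenCover.
Context {R : realType} {m n : nat}.

(** Reduces measurability of maps into R^m to preimages of balls. The rational balls inside U are
    enumerated by [unpickle]; every other code gets radius 0, hence the empty ball. *)
Lemma open_bigcup_ball (U : set 'M[R]_(m, n)) : open U ->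
  exists (x : nat -> 'M[R]_(m, n)) (r : nat -> R),
    U = \bigcup_k ball (x k) (r k).
Proof.
move=> oU.
pose F (k : nat) : 'M[R]_(m, n) * R :=
  if unpickle k is Some (q, r) then
    (if `[< ball (map_mx ratr q : 'M[R]__) (ratr r : R) `<=` U >]
     then (map_mx ratr (q : 'M[rat]_(m, n)), ratr (r : rat)) else (0, 0))
  else (0, 0).
exists (fst \o F), (snd \o F); rewrite eqEsubset; split=> [x Ux|x [k _]]; last first.
  rewrite /F /=; case: unpickle => [[q r]|] /=; last first.
    by move=> /mx_ballE; rewrite normr_lt0.
  by case: asboolP => [+ /= b|_ /mx_ballE]; [exact|rewrite normr_lt0].
have /nbhs_ballP[e /= e0 eU] := open_nbhs_nbhs (conj oU Ux).
(* The rational centre will be within e / 4 of x: r > e / 4 puts x into the ball, and r < e / 2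
   keeps the ball inside [ball x e]. *)
have [|r] := @rat_in_itvoo R (e / 4) (e / 2).
  by rewrite ltr_pM2l// ltf_pV2 ?posrE// ltr_nat.
rewrite in_itv /= => /andP[r1 r2].
have [|q xq] := @rat_mx_dense R m n x (e / 4); first by rewrite divr_gt0.
exists (pickle (q, r)) => //=; rewrite /F pickleK.
case: asboolP => [_|] /=.
  by apply/mx_ballE; rewrite distrC; apply: lt_trans r1.
case=> y /mx_ballE yq; apply: eU; apply/mx_ballE.
rewrite -(subrK (map_mx ratr q) x) -addrA; apply: le_lt_trans (ler_normD _ _) _.
have -> : e = e / 2 + e / 2 by rewrite -splitr.
apply: ltrD; last exact: lt_trans r2.
by apply: lt_trans xq (lt_trans r1 r2).
Qed.

End OpenCover.

(** A copy of the row vectors that carries the sigma-algebra [borel_rV], so that the Borel pieces in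
    [vol] are measurable by conversion. *)
Definition borel (R : realType) (m : nat) :=
  g_sigma_algebraType (@open 'rV[R]_m).

Section Borel.
Context {R : realType}.

Lemma open_borel m (U : set 'rV[R]_m) : open U ->
  measurable (U : set (borel R m)).
Proof. exact: sub_sigma_algebra. Qed.

Lemma closed_borel m (U : set 'rV[R]_m) : closed U ->
  measurable (U : set (borel R m)).
Proof.
move=> cU; rewrite -(setCK U); apply: measurableC; apply: open_borel.
exact: closed_openC.
Qed.

Lemma measurable_fun_borel d (T : measurableType d) m (D : set T)
    (f : T -> 'rV[R]_m) : measurable D ->
  (forall x r, measurable (D `&` f @^-1` ball x r)) ->
  measurable_fun D (f : T -> borel R m).
Proof.
move=> mD mf; apply: (@measurability _ _ T (borel R m) D f (@open 'rV[R]_m) erefl).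
move=> _ [U oU <-].
have [x [r ->]] := open_bigcup_ball oU.
by rewrite preimage_bigcup setI_bigcupr; apply: bigcupT_measurable.
Qed.

Lemma continuous_within_borel m (V : normedModType R) (D : set 'rV[R]_m)
    (f : 'rV[R]_m -> V) (U : set V) :
  {within D, continuous f} -> open U -> measurable (D : set (borel R m)) ->
  measurable (D `&` f @^-1` U : set (borel R m)).
Proof.
move=> /continuousP cf oU; have /open_subspaceP[W oW] := cf _ oU.
rewrite [RHS]setIC => WE mD; have -> : D `&` f @^-1` U = W `&` D by exact: esym.
by apply: measurableI => //; exact: open_borel.
Qed.

Lemma within_measurable_rV m p (D : set 'rV[R]_m)
    (f : 'rV[R]_m -> 'rV[R]_p) :
  {within D, continuous f} -> measurable (D : set (borel R m)) ->
  measurable_fun (D : set (borel R m)) (f : _ -> borel R p).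
Proof.
move=> cf mD; apply: measurable_fun_borel => // x r.
by apply: continuous_within_borel => //; exact: ball_open.
Qed.

Lemma within_measurable_fun m (D : set 'rV[R]_m) (f : 'rV[R]_m -> R) :
  {within D, continuous (f : _ -> R^o)} -> measurable (D : set (borel R m)) ->
  measurable_fun (D : set (borel R m)) f.
Proof.
move=> cf mD; apply: (measurability _ (RGenOpens.measurableE R)) => //.
move=> _ [_ [x [y ->] <-]].
by apply: (@continuous_within_borel m R^o) => //; exact: interval_open.
Qed.

Definition rV_cons m (z : R * 'rV[R]_m) : 'rV[R]_m.+1 :=
  row_mx (z.1%:M : 'rV[R]_1) z.2.

Lemma rV_cons0 m (z : R * 'rV[R]_m) : rV_cons z 0 ord0 = z.1.
Proof.
rewrite /rV_cons (_ : ord0 = lshift m (ord0 : 'I_1)); last exact: val_inj.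
by apply: etrans (row_mxEl _ _ _ _) _; rewrite mxE eqxx mulr1n.
Qed.

Lemma rV_consS m (z : R * 'rV[R]_m) j : rV_cons z 0 (lift ord0 j) = z.2 0 j.
Proof.
rewrite /rV_cons (_ : lift ord0 j = rshift 1 j); last exact: val_inj.
exact: row_mxEr.
Qed.

Definition rV_uncons m (x : 'rV[R]_m.+1) : R * 'rV[R]_m :=
  (x 0 ord0, \row_j x 0 (lift ord0 j)).

Lemma rV_consK m : cancel (@rV_cons m) (@rV_uncons m).
Proof.
move=> [t y]; rewrite /rV_uncons rV_cons0; congr pair.
by apply/rowP => j; rewrite mxE rV_consS.
Qed.

Lemma rV_unconsK m : cancel (@rV_uncons m) (@rV_cons m).
Proof.
move=> x; apply/rowP => j; case: (unliftP ord0 j) => [k ->|->].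
  by rewrite rV_consS mxE.
by rewrite rV_cons0.
Qed.

Lemma forall_ord_recl m (P : 'I_m.+1 -> Prop) :
  (forall i, P i) <-> P ord0 /\ forall i, P (lift ord0 i).
Proof.
split=> [H|[P0 P1] i]; first by split.
by case: (unliftP ord0 i) => [k ->|->].
Qed.

(** In the sup norm a ball is a product of balls; this makes [rV_cons] measurable for the product
    sigma-algebra. *)
Lemma preimage_rV_cons_ball m (x : 'rV[R]_m.+1) r : 0 < r ->
  @rV_cons m @^-1` ball x r =
  ball (x 0 ord0) r `*` ball (\row_j x 0 (lift ord0 j) : 'rV[R]_m) r.
Proof.
move=> r0; apply/seteqP; split=> [z /=|z /= []].
  move=> [_ /(_ 0)/forall_ord_recl[]]; rewrite rV_cons0 => ? b; split=> //.
  by split=> // i j; rewrite ord1 mxE; have := b j; rewrite rV_consS.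
move=> b0 [_ b]; split=> // i; rewrite ord1; apply/forall_ord_recl.
rewrite rV_cons0; split=> // j; have := b 0 j.
by rewrite mxE rV_consS.
Qed.

Lemma measurable_rV_cons m :
  measurable_fun setT (@rV_cons m : R * borel R m -> borel R m.+1).
Proof.
apply: measurable_fun_borel => // x r; rewrite setTI.
have [r0|r0] := ltP 0 r; last first.
  rewrite (_ : _ @^-1` _ = set0)//; apply/seteqP; split=> // z /= [].
  by move=> /lt_le_trans/(_ r0); rewrite ltxx.
rewrite preimage_rV_cons_ball//; apply: measurableX.
  by apply: open_measurable; exact: ball_open.
by apply: open_borel; exact: ball_open.
Qed.

Lemma measurable_coord m (i : 'I_m) :
  measurable_fun setT ((fun x => x 0 i) : borel R m -> R).
Proof.
apply: within_measurable_fun => //.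
by apply: continuous_subspaceT; exact: coord_continuous.
Qed.

Lemma measurable_rV_uncons m :
  measurable_fun setT (@rV_uncons m : borel R m.+1 -> R * borel R m).
Proof.
apply/measurable_fun_pairP; split; first exact: measurable_coord.
apply: measurable_fun_borel => // x r; rewrite setTI.
have [r0|r0] := ltP 0 r; last first.
  rewrite (_ : _ @^-1` _ = set0)//; apply/seteqP; split=> // z /= [].
  by move=> /lt_le_trans/(_ r0); rewrite ltxx.
rewrite (_ : _ @^-1` _ = \bigcap_(i : 'I_m)
    ((fun z : borel R m.+1 => z 0 (lift ord0 i)) @^-1` ball (x 0 i) r)).
  apply: fin_bigcap_measurable => // i _; rewrite -[X in measurable X]setTI.
  by apply: measurable_coord => //; by apply: open_measurable; exact: ball_open.
apply/seteqP; split=> [z /= [_ b] i _|z /= b] /=.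
  by have := b 0 i; rewrite mxE.
by split=> // i j; rewrite ord1 mxE; exact: b.
Qed.

End Borel.

Section ConsMeasure.
Context {R : realType}.
Local Open Scope ereal_scope.
Variables (m : nat) (mu : {sigma_finite_measure set (borel R m) -> \bar R}).

Definition lebesgue_sigma_finite :
  {sigma_finite_measure set (measurableTypeR R) -> \bar R} := lebesgue_measure.

Let cons : measurableTypeR R * borel R m -> borel R m.+1 := @rV_cons R m.

Let mcons : measurable_fun setT cons.
Proof. exact: measurable_rV_cons. Qed.

Let nu : set (borel R m.+1) -> \bar R :=
  pushforward (lebesgue_sigma_finite \x mu) cons.

Let nu0 : nu set0 = 0.
Proof. exact: measure0. Qed.

Let nu_ge0 A : 0 <= nu A.
Proof. exact: measure_ge0. Qed.

Let nu_sigma_additive : semi_sigma_additive nu.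
Proof. exact: measure_semi_sigma_additive. Qed.

HB.instance Definition _ := isMeasure.Build _ _ _ nu nu0 nu_ge0 nu_sigma_additive.

Let nu_sigma_finite : sigma_finite setT nu.
Proof.
have /sigma_finiteP[F [TF ndF Foo]] := sigma_finiteT lebesgue_sigma_finite.
have /sigma_finiteP[G [TG ndG Goo]] := sigma_finiteT mu.
(* Since F and G increase, the diagonal products already cover: a point of F i times G j lies in the
   one of index max(i, j). *)
exists (fun i => @rV_uncons R m @^-1` (F i `*` G i)) => [|i].
  rewrite -preimage_bigcup -(preimage_setT (@rV_uncons R m)); congr (_ @^-1` _).
  apply/seteqP; split=> // -[t y] _.
  have [i _ Fi] : (\bigcup_i F i) t by rewrite -TF.
  have [j _ Gj] : (\bigcup_i G i) y by rewrite -TG.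
  exists (maxn i j) => //; split=> /=.
    by move: t Fi; exact/subsetPset/ndF/leq_maxl.
  by move: y Gj; exact/subsetPset/ndG/leq_maxr.
have [mF Fi] := Foo i; have [mG Gi] := Goo i; split.
  rewrite -[X in measurable X]setTI; apply: measurable_rV_uncons => //.
  exact: measurableX.
rewrite /nu /pushforward (_ : _ @^-1` _ = F i `*` G i).
  by rewrite product_measure1E// lte_mul_pinfty// ge0_fin_numE.
by apply/seteqP; split=> z; rewrite /preimage /mkset /cons rV_consK.
Qed.

HB.instance Definition _ :=
  Measure_isSigmaFinite.Build _ _ _ nu nu_sigma_finite.

Definition cons_measure : {sigma_finite_measure set (borel R m.+1) -> \bar R} :=
  nu.

Lemma integral_cons_measure (f : borel R m.+1 -> \bar R) :
  measurable_fun setT f -> (forall x, 0 <= f x) ->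
  \int[cons_measure]_x f x =
  \int[lebesgue_measure]_(t in [set: R]) \int[mu]_y f (rV_cons (t, y)).
Proof.
move=> mf f0.
rewrite [LHS]ge0_integral_pushforward//= preimage_setT.
rewrite (@fubini_tonelli1 _ _ _ _ _ lebesgue_sigma_finite mu)//.
exact: measurableT_comp.
Qed.

End ConsMeasure.

Section LebesgueRV.
Context {R : realType}.
Local Open Scope ereal_scope.

(** Follows the recursion of [integral_rV], so that the iterated integral defining [vol] is an
    integral for one sigma-finite measure. *)
Fixpoint lebesgue_rV (m : nat) :
    {sigma_finite_measure set (borel R m) -> \bar R} :=
  match m with
  | 0 => @dirac _ (borel R 0) (0%R : 'rV[R]_0) R
  | m'.+1 => cons_measure (lebesgue_rV m')
  end.

Lemma measurable_fun_rV_cons m (f : borel R m.+1 -> \bar R) t :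
  measurable_fun setT f ->
  measurable_fun setT (fun y : borel R m => f (rV_cons (t, y))).
Proof.
move=> mf; apply: (measurableT_comp mf).
by apply: (measurableT_comp (@measurable_rV_cons R m)).
Qed.

Lemma integral_rVE m (f : borel R m -> \bar R) :
  measurable_fun setT f -> (forall x, 0 <= f x) ->
  integral_rV f = \int[lebesgue_rV m]_x f x.
Proof.
elim: m f => [|m IH] f mf f0 /=.
  by rewrite integral_dirac// diracT mul1e.
rewrite integral_cons_measure//; apply: eq_integral => t _.
by rewrite IH//; exact: measurable_fun_rV_cons.
Qed.

End LebesgueRV.

(** * Linear changes of variables *)

Section Affine1D.
Context {R : realType}.
Local Open Scope ereal_scope.
Local Notation mu := (@lebesgue_measure R).

Lemma measurable_affine (a b : R) :
  measurable_fun setT ((fun t => a * t + b)%R : measurableTypeR R -> measurableTypeR R).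
Proof.
apply: (@measurable_funD _ (measurableTypeR R) _ setT (fun t => a * t)%R (cst b)).
  by apply: (@measurable_funM _ (measurableTypeR R) _ setT (cst a) id).
exact: measurable_cst.
Qed.

(** The push-forward of Lebesgue measure under t -> a t + b, multiplied by a, takes the right values
    on half-open intervals, so it is Lebesgue measure by uniqueness. *)
Lemma integral_affine_pos (a b : R) (f : R -> \bar R) : (0 < a)%R ->
  measurable_fun setT f -> (forall x, 0 <= f x) ->
  \int[mu]_(t in [set: R]) f (a * t + b)%R = (a^-1)%:E * \int[mu]_(t in [set: R]) f t.
Proof.
move=> a0 mf f0.
pose phi : measurableTypeR R -> measurableTypeR R := fun t => (a * t + b)%R.
have mphi : measurable_fun setT phi := measurable_affine a b.
have a0' : (0 <= a)%R by exact: ltW.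
have a0i : (0 <= a^-1)%R by rewrite invr_ge0.
pose nu : {measure set (measurableTypeR R) -> \bar R} :=
  measure_function_pushforward__canonical__measure_function_Measure mu mphi.
have E A : measurable A -> pushforward mu phi A = (a^-1)%:E * mu A.
  move=> mA; rewrite (@lebesgue_measure_unique _
    (mscale (NngNum a0') nu))//=.
    by rewrite /mscale /= muleA -EFinM mulVf ?gt_eqF// mul1e.
  move=> _ [[x y]] _ <-; rewrite /mscale/= /pushforward.
  rewrite (_ : _ @^-1` _ = `](x - b) / a, (y - b) / a]%classic)%R; last first.
    apply/seteqP; split=> t /=; rewrite !in_itv/= /phi;
      by rewrite ltr_pdivrMr// ler_pdivlMr// mulrC ltrBlDr lerBrDr.
  rewrite !lebesgue_measure_itv/= !lte_fin ltr_pM2r ?invr_gt0// ltrD2r.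
  case: ifPn => _; last by rewrite mule0.
  by rewrite -EFinD -EFinM; congr EFin; field; rewrite gt_eqF.
transitivity (\int[nu]_y f y).
  by rewrite ge0_integral_pushforward// preimage_setT.
transitivity (\int[mscale (NngNum a0i) mu]_y f y).
  apply: (@eq_measure_integral _ (measurableTypeR R) R setT
    (mscale (NngNum a0i) mu) nu) => A mA _; rewrite /= E//.
by rewrite ge0_integral_mscale.
Qed.

Lemma integral_affine (a b : R) (f : R -> \bar R) : (a != 0)%R ->
  measurable_fun setT f -> (forall x, 0 <= f x) ->
  \int[mu]_(t in [set: R]) f (a * t + b)%R =
  (`|a|^-1)%:E * \int[mu]_(t in [set: R]) f t.
Proof.
move=> a0 mf f0; have [a_gt0|a_lt0|/eqP] := ltgtP 0%R a;
  last by rewrite eq_sym (negPf a0).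
  by rewrite gtr0_norm// integral_affine_pos.
rewrite ltr0_norm//.
(* A negative factor is a positive one composed with the reflection, which preserves Lebesgue
   measure. *)
rewrite -(@integral_affine_pos (- a) b) ?oppr_gt0//.
pose g (t : R) := f (- a * t + b)%R.
have mg : measurable_fun setT g.
  exact: (measurableT_comp mf (measurable_affine (- a) b)).
have mN : measurable_fun setT (-%R : measurableTypeR R -> measurableTypeR R) by [].
pose nu : {measure set (measurableTypeR R) -> \bar R} :=
  measure_function_pushforward__canonical__measure_function_Measure mu mN.
transitivity (\int[nu]_y g y).
  rewrite ge0_integral_pushforward//; last by move=> y _; exact: f0.
  by apply: eq_integral => t _; rewrite /g /= mulrNN.
apply: (@eq_measure_integral _ (measurableTypeR R) R setT mu nu) => A mA _.
exact: lebesgue_measureN.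
Qed.

End Affine1D.

Section AffineRV.
Context {R : realType}.
Local Open Scope ereal_scope.

Lemma measurable_fun_rV d (T : measurableType d) m (D : set T)
    (f : T -> 'rV[R]_m) : measurable D ->
  (forall i, measurable_fun D (fun x => f x 0%R i)) ->
  measurable_fun D (f : T -> borel R m).
Proof.
move=> mD mf; apply: measurable_fun_borel => // x r.
have [r0|r0] := ltP 0%R r; last first.
  rewrite (_ : _ `&` _ = set0)//; apply/seteqP; split=> // z /= [_ []].
  by move=> /lt_le_trans/(_ r0); rewrite ltxx.
case: m => [|m] in f mf x *.
  rewrite (_ : _ `&` _ = D)//; apply/seteqP; split=> [z []//|z Dz]; split=> //.
  by split=> // i [].
rewrite (_ : _ `&` _ = \bigcap_(i : 'I_m.+1)
    (D `&` (fun z => f z 0%R i) @^-1` ball (x 0%R i) r)).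
  apply: fin_bigcap_measurable => // i _; apply: mf => //.
  by apply: open_measurable; exact: ball_open.
apply/seteqP; split=> [z /= [Dz [_ b]] i _|z /= b] /=; first by split.
split; first by have [] := b ord0 I.
by split=> // i j; rewrite ord1; exact: (b j I).2.
Qed.

Lemma measurable_affine_rV m p (S : 'M[R]_(m, p)) c :
  measurable_fun setT ((fun x => x *m S + c)%R : borel R m -> borel R p).
Proof.
apply: measurable_fun_rV => // i.
rewrite (_ : (fun _ => _) = (fun x : borel R m => \sum_j x 0 j * S j i + c 0 i)%R).
  apply: measurable_funD; last exact: measurable_cst.
  apply: measurable_sum => j; apply: measurable_funM; last exact: measurable_cst.
  exact: measurable_coord.
by apply/funext => x; rewrite !mxE.
Qed.

Lemma rV_consD m (s t : R) (x y : 'rV[R]_m) :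
  (rV_cons (s, x) + rV_cons (t, y) = rV_cons (s + t, x + y))%R.
Proof.
apply/rowP => j; rewrite [LHS]mxE; case: (unliftP ord0 j) => [k ->|->].
  by rewrite !rV_consS /= mxE.
by rewrite !rV_cons0.
Qed.

Lemma integral_rV_consE m (f : borel R m.+1 -> \bar R) :
  measurable_fun setT f -> (forall x, 0 <= f x) ->
  \int[lebesgue_rV m.+1]_x f x = \int[lebesgue_measure]_(t in [set: R])
    \int[lebesgue_rV m]_y f (rV_cons (t, y)).
Proof. exact: integral_cons_measure. Qed.

Lemma integral_rV_cons_swap m (f : borel R m.+1 -> \bar R) :
  measurable_fun setT f -> (forall x, 0 <= f x) ->
  \int[lebesgue_rV m.+1]_x f x = \int[lebesgue_rV m]_y
    \int[lebesgue_measure]_(t in [set: R]) f (rV_cons (t, y)).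
Proof.
move=> mf f0; rewrite integral_rV_consE//.
rewrite (@fubini_tonelli _ _ _ _ _ lebesgue_sigma_finite (lebesgue_rV m)
  (f \o @rV_cons R m))//; last by move=> z; exact: f0.
by apply: measurableT_comp => //; exact: measurable_rV_cons.
Qed.

Lemma measurable_integral_rV_cons m (f : borel R m.+1 -> \bar R) :
  measurable_fun setT f -> (forall x, 0 <= f x) ->
  measurable_fun [set: R] (fun t => \int[lebesgue_rV m]_y f (rV_cons (t, y))).
Proof.
move=> mf f0.
apply: (@measurable_fun_fubini_tonelli_F _ _ (measurableTypeR R) (borel R m) R
  (lebesgue_rV m) (f \o @rV_cons R m)) => //; last by move=> z; exact: f0.
by apply: measurableT_comp => //; exact: measurable_rV_cons.
Qed.

Lemma integral_shift_rV m (c : 'rV[R]_m) (f : borel R m -> \bar R) :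
  measurable_fun setT f -> (forall x, 0 <= f x) ->
  \int[lebesgue_rV m]_x f (x + c)%R = \int[lebesgue_rV m]_x f x.
Proof.
elim: m => [|m IH] in c f * => mf f0.
  by apply: eq_integral => x _; rewrite thinmx0 [x in RHS]thinmx0.
have mg : measurable_fun setT (fun x : borel R m.+1 => f ((x : 'rV[R]_m.+1) + c)%R).
  rewrite (_ : (fun _ => _) = f \o (fun x : 'rV[R]_m.+1 => x *m 1%:M + c)%R).
    by apply: measurableT_comp => //; exact: measurable_affine_rV.
  by apply/funext => x /=; rewrite mulmx1.
rewrite [LHS](integral_rV_consE mg) => [|x]; last exact: f0.
rewrite [RHS](integral_rV_consE mf f0).
pose g t := \int[lebesgue_rV m]_y f (rV_cons (t, y)).
transitivity (\int[lebesgue_measure]_(t in [set: R]) g (1 * t + c 0 ord0)%R).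
  apply: eq_integral => t _; rewrite /g mul1r.
  pose h (y : borel R m) := f (rV_cons ((t + c 0 ord0)%R, y)).
  rewrite -[RHS](IH (rV_uncons c).2 h); last by move=> y; exact: f0.
    apply: eq_integral => y _; rewrite /h -[in LHS](rV_unconsK c).
    by rewrite rV_consD.
  exact: (measurable_fun_rV_cons (t + c 0 ord0)%R mf).
rewrite integral_affine ?oner_neq0 ?normr1 ?invr1 ?mul1e//.
  exact: (measurable_integral_rV_cons mf f0).
by move=> t; apply: integral_ge0.
Qed.

End AffineRV.

Section LinearRV.
Context {R : realType}.
Local Open Scope ereal_scope.

Lemma measurable_mulmx m p (S : 'M[R]_(m, p)) :
  measurable_fun setT (mulmxr S : borel R m -> borel R p).
Proof.
rewrite (_ : mulmxr S = (fun x => x *m S + 0)%R); first exact: measurable_affine_rV.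
by apply/funext => x /=; rewrite addr0.
Qed.

Lemma measurable_comp_mulmx m p (S : 'M[R]_(m, p)) (f : borel R p -> \bar R) :
  measurable_fun setT f ->
  measurable_fun setT (fun x : borel R m => f ((x : 'rV[R]_m) *m S)%R).
Proof. by move=> mf; exact: (measurableT_comp mf (measurable_mulmx S)). Qed.

Lemma rV_cons_mul m (t : R) (y : 'rV[R]_m) (a : 'M[R]_1) (u : 'rV[R]_m)
    (l : 'M[R]_(m, 1)) (S : 'M[R]_m) :
  (rV_cons (t, y) *m (block_mx a u l S : 'M[R]_m.+1) =
   rV_cons (a 0 0 * t + (y *m l) 0 0, y *m S + t *: u))%R.
Proof.
have E := mul_row_block (t%:M : 'M[R]_1)%R y a u l S.
transitivity (row_mx (t%:M *m a + y *m l) (t%:M *m u + y *m S))%R.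
  by rewrite -E.
have -> : (t%:M *m a + y *m l = (a 0 0 * t + (y *m l) 0 0)%:M :> 'M[R]_1)%R.
  rewrite raddfD /= -mx11_scalar mul_scalar_mx; congr (_ + _)%R.
  by rewrite [in LHS](mx11_scalar a) scale_scalar_mx mulrC.
by rewrite mul_scalar_mx [(t *: u + _)%R]addrC.
Qed.

(** The change of variables formula as a predicate on S: it is stable under products and can
    therefore be carried through a factorization of S. *)
Definition linear_change m (S : 'M[R]_m) :=
  forall f : borel R m -> \bar R, measurable_fun setT f -> (forall x, 0 <= f x) ->
  \int[lebesgue_rV m]_x f (x *m S)%R =
  (`|\det S|^-1)%:E * \int[lebesgue_rV m]_x f x.

Lemma linear_change_mul m (S T : 'M[R]_m) :
  linear_change S -> linear_change T -> linear_change (S *m T).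
Proof.
move=> cS cT f mf f0.
transitivity (\int[lebesgue_rV m]_x (f \o mulmxr T) (x *m S)%R).
  by apply: eq_integral => x _ /=; rewrite mulmxA.
rewrite (cS (f \o mulmxr T)); last by move=> x; exact: f0.
  by rewrite det_mulmx normrM invfM EFinM -muleA cT.
exact: measurable_comp_mulmx.
Qed.

(** The map sends (t, y) to (a t, y S + t u). For fixed t the integral over y uses the formula for S
    and translation invariance; then t is rescaled. *)
Lemma linear_change_ublock m (a : R) (u : 'rV[R]_m) (S : 'M[R]_m) : (a != 0)%R ->
  linear_change S -> linear_change (block_mx a%:M u 0 S : 'M[R]_m.+1).
Proof.
move=> a0 cS; pose T : 'M[R]_(1 + m) := block_mx a%:M u 0 S.
have detT : \det T = (a * \det S)%R by rewrite det_ublock det_scalar1.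
rewrite -[X in linear_change X]/(T : 'M[R]_m.+1) => f mf f0.
have mg := @measurable_comp_mulmx m.+1 m.+1 T f mf.
rewrite [LHS](integral_rV_consE mg) => [|x]; last exact: f0.
rewrite [in RHS](integral_rV_consE mf f0).
pose g t := \int[lebesgue_rV m]_y f (rV_cons (t, y)).
have g0 t : 0 <= g t by exact: integral_ge0.
have mgg : measurable_fun setT g := measurable_integral_rV_cons mf f0.
transitivity (\int[lebesgue_measure]_(t in [set: R])
    ((`|\det S|^-1)%:E * g (a * t + 0)%R)).
  apply: eq_integral => t _; rewrite /g addr0.
  have mh := measurable_fun_rV_cons (a * t)%R mf.
  rewrite -(integral_shift_rV (t *: u) mh) => [|y]; last exact: f0.
  rewrite -cS => [||y]; last exact: f0.
    apply: eq_integral => y _ /=; rewrite rV_cons_mul mulmx0 !mxE addr0.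
    by rewrite eqxx mulr1n.
  have := measurableT_comp mh (measurable_affine_rV 1%:M (t *: u)%R).
  by apply: eq_measurable_fun => y _ /=; rewrite mulmx1.
have mga := measurableT_comp mgg (measurable_affine a 0).
rewrite [LHS](ge0_integralZl _ _ mga) => [||t _|].
- rewrite [in LHS]integral_affine// muleA -EFinM; congr (_%:E * _).
  by rewrite detT normrM invfM mulrC.
- by [].
- exact: g0.
- by rewrite lee_fin invr_ge0.
Qed.

(** The map sends (t, y) to (t + y l, y), a translation in t for fixed y; hence the order of
    integration is exchanged. *)
Lemma linear_change_lblock m (l : 'M[R]_(m, 1)) :
  linear_change (block_mx 1%:M 0 l 1%:M : 'M[R]_m.+1).
Proof.
pose T : 'M[R]_(1 + m) := block_mx 1%:M 0 l 1%:M.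
have detT : \det T = 1%R by rewrite det_lblock !det1 mulr1.
rewrite -[X in linear_change X]/(T : 'M[R]_m.+1) => f mf f0.
have mg := @measurable_comp_mulmx m.+1 m.+1 T f mf.
rewrite [LHS](integral_rV_cons_swap mg) => [|x]; last exact: f0.
rewrite [in RHS](integral_rV_cons_swap mf f0).
rewrite detT normr1 invr1 mul1e; apply: eq_integral => y _.
have mh : measurable_fun setT (fun t : R => f (rV_cons (t, y))).
  exact: (measurable_fun_pair1 y (measurableT_comp mf (@measurable_rV_cons R m))).
transitivity (\int[lebesgue_measure]_(t in [set: R])
    f (rV_cons ((1 * t + (y *m l) 0 0)%R, y))).
  apply: eq_integral => t _ /=; rewrite rV_cons_mul scaler0 addr0 mulmx1.
  by rewrite !mxE eqxx.
rewrite (@integral_affine _ 1%R ((y *m l) 0 0)%R (fun t => f (rV_cons (t, y))))//.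
by rewrite normr1 invr1 mul1e.
Qed.

(** If the corner of A vanishes, some other entry of its first column does not, since otherwise the
    determinant would be 0; that row is added to the first. *)
Lemma unitmx_pivot m (A : 'M[R]_(1 + m)) : A \in unitmx ->
  exists u : 'rV[R]_m, ((block_mx 1%:M u 0 1%:M *m A) 0 0 != 0)%R.
Proof.
move=> uA; have l0 : (0 : 'I_(1 + m))%R = lshift m 0%R by exact: val_inj.
have [A0|A0] := eqVneq (A 0 0)%R 0%R; last first.
  by exists 0%R; rewrite -scalar_mx_block mul1mx.
have [i Ai] : exists i, (A (rshift 1 i) 0 != 0)%R.
  apply/existsP; apply: contraLR uA => /existsPn Ai.
  rewrite unitmxE unitfE negbK; apply/eqP.
  rewrite (expand_det_col _ 0)%R big1// => i _.
  have [j ->|j ->] := split_ordP (i : 'I_(1 + m)).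
    by rewrite ord1 -l0 A0 mul0r.
  by have /negPn/eqP -> := Ai j; rewrite mul0r.
exists (delta_mx 0 i)%R.
rewrite -[A in _ *m A]submxK mulmx_block !mul1mx l0 block_mxEul mxE -rowE !mxE -l0.
by rewrite A0 add0r.
Qed.

(* Gaussian elimination without row exchanges: a nonzero pivot is created by adding
   a combination of the other rows to the first one. *)
Lemma unitmx_block_ind (P : forall m, 'M[R]_m -> Prop) :
  (forall m, P m 1%:M) ->
  (forall m (S T : 'M[R]_m), P m S -> P m T -> P m (S *m T)%R) ->
  (forall m (a : R) (u : 'rV[R]_m) (S : 'M[R]_m), (a != 0)%R -> P m S ->
    P m.+1 (block_mx a%:M u 0 S)) ->
  (forall m (l : 'M[R]_(m, 1)), P m.+1 (block_mx 1%:M 0 l 1%:M)) ->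
  forall m (S : 'M[R]_m), S \in unitmx -> P m S.
Proof.
move=> P1 PM PU PL; elim=> [S _|m IH A uA].
  by rewrite (_ : S = 1%:M)%R; [exact: P1|rewrite [S]flatmx0 [RHS]flatmx0].
have [u Bu] := unitmx_pivot uA.
pose U : 'M[R]_(1 + m) := block_mx 1%:M u 0%R 1%:M.
pose B : 'M[R]_(1 + m) := U *m A.
pose a := (B 0 0)%R.
pose c : 'M[R]_(m, 1) := (a^-1 *: dlsubmx B)%R.
pose b : 'rV[R]_m := ursubmx B.
(* The Schur complement of the pivot, invertible because det T = a det S. *)
pose S := (drsubmx B - c *m b)%R.
pose T : 'M[R]_(1 + m) := block_mx a%:M b 0%R S.
pose L : 'M[R]_(1 + m) := block_mx 1%:M 0%R c 1%:M.
have l0 : (0 : 'I_(1 + m))%R = lshift m 0%R by exact: val_inj.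
have BE : B = L *m T.
  rewrite mulmx_block !mul1mx !mul0mx ?mulmx0 !addr0 -[LHS]submxK.
  congr block_mx.
  - by rewrite [LHS]mx11_scalar 2!mxE -l0.
  - by rewrite mul_mx_scalar scalerA mulfV// scale1r.
  - by rewrite addrC subrK.
have AE : A = block_mx 1%:M (- u)%R 0%R 1%:M *m (L *m T).
  rewrite -BE /B mulmxA mulmx_block !mul1mx !mul0mx ?mulmx1 ?mulmx0 !addr0
    ?addrN ?subrr ?add0r.
  by rewrite -scalar_mx_block mul1mx.
rewrite AE; apply: (PM m.+1).
  by apply: PU; [exact: oner_neq0|exact: P1].
apply: (PM m.+1); first exact: PL.
apply: PU => //; apply: IH.
have detT : \det T = (a * \det S)%R by rewrite det_ublock det_scalar1.
move: uA; rewrite AE !unitmx_mul => /andP[_ /andP[_]].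
by rewrite unitmxE detT unitrM => /andP[_]; rewrite unitmxE.
Qed.

Lemma linear_change1 m : linear_change (1%:M : 'M[R]_m).
Proof.
move=> f mf f0; rewrite det1 normr1 invr1 mul1e.
by apply: eq_integral => x _; rewrite mulmx1.
Qed.

Theorem integral_mulmx_rV m (S : 'M[R]_m) : S \in unitmx -> linear_change S.
Proof.
apply: (@unitmx_block_ind (@linear_change)).
- exact: linear_change1.
- exact: linear_change_mul.
- exact: linear_change_ublock.
- exact: linear_change_lblock.
Qed.

End LinearRV.

(** * The change of variables inequality *)

Section Regularity.
Context {R : realType} {m : nat}.
Local Open Scope ereal_scope.

(** C n consists of the points at distance at least 1 / (n + 1) from every point outside G. *)
Lemma open_exhaustion (G : set 'rV[R]_m) : open G ->
  exists C : (set 'rV[R]_m)^nat,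
    [/\ forall n, closed (C n), nondecreasing_seq C & G = \bigcup_n C n].
Proof.
move=> oG; pose C n := ~` \bigcup_(y in ~` G) ball y (n.+1%:R^-1 : R).
exists C; split.
- by move=> n; apply: open_closedC; apply: bigcup_open => y _; exact: ball_open.
- move=> p q pq; apply/subsetPset; apply: subsetC; apply: subset_bigcup => y _.
  by apply: le_ball; rewrite lef_pV2 ?posrE// ler_nat.
apply/seteqP; split=> [x Gx|x [n _ Cx]]; last first.
  apply: contrapT => Gx; apply: Cx; exists x => //.
  exact: ballxx.
have /nbhs_ballP[d /= d0 dG] := open_nbhs_nbhs (conj oG Gx).
have [N _ /(_ N (leqnn N))/= Nd] := near_infty_natSinv_lt (PosNum d0).
exists N => // -[y Gy xy]; apply: Gy; apply: dG.
by apply: ball_sym; apply: le_ball xy; exact: ltW.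
Qed.

Lemma nonincreasing_measure_lt d (T : measurableType d)
    (mu : {measure set T -> \bar R}) (F : (set T)^nat) (e : R) :
  mu (F 0%N) < +oo -> (forall i, measurable (F i)) -> nonincreasing_seq F ->
  mu (\bigcap_n F n) < e%:E -> exists n, mu (F n) < e%:E.
Proof.
move=> F0 mF niF Fe.
have /(_ [set x | x < e%:E]) H := nonincreasing_cvg_mu F0 mF
  (bigcapT_measurable mF) niF.
have [|n _ /(_ n (leqnn n))] := H; last by exists n.
apply: open_nbhs_nbhs; split=> //; exact: open_ereal_lt_ereal.
Qed.

(** The sets that can be approximated in this way form a sigma-algebra, which contains the open sets
    by [open_exhaustion]. *)
Lemma borel_regular (mu : {measure set (borel R m) -> \bar R}) :
  mu setT < +oo -> forall F : set (borel R m), measurable F ->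
  forall e : R, (0 < e)%R -> exists C U : set 'rV[R]_m,
    [/\ closed C, open U, C `<=` F, F `<=` U & mu (U `\` C) < e%:E].
Proof.
move=> muT.
have mufin (A : set (borel R m)) : measurable A -> mu A < +oo.
  by move=> mA; apply: le_lt_trans muT; rewrite le_measure ?inE.
pose D : set (set 'rV[R]_m) := [set F | forall e : R, (0 < e)%R ->
  exists C U : set 'rV[R]_m,
    [/\ closed C, open U, C `<=` F, F `<=` U & mu (U `\` C) < e%:E]].
suff : <<s @open 'rV[R]_m >> `<=` D by [].
apply: smallest_sub.
  split.
  - move=> e e0; exists set0, set0.
    by split; rewrite ?setD0 ?measure0 ?lte_fin//; exact: closed0.
  - move=> A DA e /DA[C [U [cC oU CA AU e']]]; exists (~` U), (~` C).
    rewrite setTD; split; [exact: open_closedC|exact: closed_openC| | |].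
    + exact: subsetC.
    + exact: subsetC.
    + by rewrite setDE setCK setIC -setDE.
  - move=> A DA e e0.
    have /choice[CU H] i : exists p : set 'rV[R]_m * set 'rV[R]_m,
        [/\ closed p.1, open p.2, p.1 `<=` A i, A i `<=` p.2
          & mu (p.2 `\` p.1) < (e / 2 / (2 ^ i.+1)%:R)%:E].
      have [|C [U ?]] := DA i (e / 2 / (2 ^ i.+1)%:R)%R; last by exists (C, U).
      by rewrite !divr_gt0// ltr0n expn_gt0.
    have cC i : closed (CU i).1 by have [] := H i.
    have oU i : open (CU i).2 by have [] := H i.
    have CA i : (CU i).1 `<=` A i by have [] := H i.
    have AU i : A i `<=` (CU i).2 by have [] := H i.
    have mC i := closed_borel (cC i).
    have mU i := open_borel (oU i).
    pose U := \bigcup_i (CU i).2.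
    (* An infinite union of closed sets need not be closed; since mu is finite, continuity from
       above shows that a finite union suffices. *)
    pose C n := \bigcup_(i in `I_n) (CU i).1.
    have mUC n : measurable (U `\` C n : set (borel R m)).
      apply: measurableD; first exact: bigcupT_measurable.
      by apply: fin_bigcup_measurable.
    have [|p q pq||n ne] := @nonincreasing_measure_lt _ (borel R m) mu
      (fun n => U `\` C n) e _ mUC.
    + exact: mufin.
    + apply/subsetPset; apply: setDS; apply: bigcup_sub => i /= ip.
      by move=> x Cx; exists i => //=; exact: leq_trans ip pq.
    + apply: (@le_lt_trans _ _ (e / 2)%:E); last first.
        by rewrite lte_fin ltr_pdivrMr// ltr_pMr// ltr1n.
      apply: (@le_trans _ _ (\sum_(i <oo) mu ((CU i).2 `\` (CU i).1))).
        apply: measure_sigma_subadditive.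
        - by move=> i; exact: measurableD.
        - exact: bigcapT_measurable.
        move=> x Fx; have [[i _ Uix] _] := Fx 0%N I; exists i => //; split=> //.
        by move=> Cix; have [_] := Fx i.+1 I; apply; exists i => /=.
      apply: le_trans; last by apply: (epsilon_trick0 xpredT);
        exact: divr_ge0 (ltW e0) _.
      by apply: lee_nneseries => // i _; apply: ltW; have [] := H i.
    + exists (C n), U; split=> //.
      * by apply: closed_bigcup.
      * exact: bigcup_open.
      * by move=> x [i _ Cx]; exists i => //; exact: CA.
      * by apply: subset_bigcup => i _; exact: AU.
move=> G oG e e0.
have [C [cC ndC CG]] := open_exhaustion oG.
have mGC n : measurable (G `\` C n : set (borel R m)).
  by apply: measurableD; [exact: open_borel|exact: closed_borel].
have [|p q pq||n ne] := @nonincreasing_measure_lt _ (borel R m) mu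
  (fun n => G `\` C n) e _ mGC.
- exact: mufin.
- by apply/subsetPset; apply: setDS; apply/subsetPset; exact: ndC.
- rewrite (_ : \bigcap_n _ = set0) ?measure0 ?lte_fin// -subset0 => x Fx.
  have [+ _] := Fx 0%N I; rewrite CG => -[i _ Cx].
  by have [_] := Fx i I.
- exists (C n), G; split=> //.
  by rewrite [X in _ `<=` X]CG; exact: bigcup_sup.
Qed.

(** Lebesgue measure is infinite, so [borel_regular] is applied to the restriction of mu to the
    ball. *)
Lemma borel_outer_regular (mu : {measure set (borel R m) -> \bar R})
    (r : R) (F : set (borel R m)) (e : R) :
  mu (ball (0%R : 'rV[R]_m) r) < +oo -> measurable F ->
  F `<=` ball (0%R : 'rV[R]_m) r -> (0 < e)%R ->
  exists2 U : set 'rV[R]_m, open U & F `<=` U /\ mu U <= mu F + e%:E.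
Proof.
move=> mur mF Fr e0.
set B := ball _ _ in mur Fr.
have oB : open B by exact: ball_open.
have mB : measurable (B : set (borel R m)) by exact: open_borel.
pose nu : {measure set (borel R m) -> \bar R} := mrestr mu mB.
have [||C [U [cC oU CF FU UC]]] := @borel_regular nu _ F mF e.
- by rewrite /nu /= /mrestr setTI.
- by [].
exists (U `&` B); first exact: openI.
split; first by move=> x Fx; split; [exact: FU|exact: Fr].
have mU := open_borel oU.
have mC := closed_borel cC.
apply: (@le_trans _ _ (mu (F `|` ((U `\` C) `&` B)))).
  apply: le_measure; rewrite ?inE.
  - exact: measurableI.
  - by apply: measurableU => //; apply: measurableI => //; exact: measurableD.
  - move=> x [Ux Bx]; have [Cx|Cx] := pselect (C x); first by left; exact: CF.
    by right.
apply: le_trans (measureU2 _ _ _) _ => //.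
  by apply: measurableI => //; exact: measurableD.
by rewrite leeD2l// ltW.
Qed.

End Regularity.

(** * Cubes, grids and the measure of sets under expanding maps *)

Section Boxes.
Context {R : realType}.
Local Open Scope ereal_scope.

Definition box m (I : 'I_m -> set R) : set 'rV[R]_m :=
  [set x | forall i, I i (x 0%R i)].

Lemma measurable_box m (I : 'I_m -> set R) : (forall i, measurable (I i)) ->
  measurable (box I : set (borel R m)).
Proof.
move=> mI; rewrite (_ : box I =
    \bigcap_i ((fun x : borel R m => x 0%R i) @^-1` I i)); last first.
  by apply/seteqP; split=> [x bx i _|x bx i]; [exact: bx|exact: bx].
apply: fin_bigcap_measurable => // i _.
by rewrite -[X in measurable X]setTI; exact: measurable_coord.
Qed.

Lemma lebesgue_rV_box m (I : 'I_m -> set R) : (forall i, measurable (I i)) ->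
  lebesgue_rV m (box I) = \prod_(i < m) lebesgue_measure (I i).
Proof.
elim: m I => [|m IH] I mI.
  by rewrite big_ord0 /= diracE mem_set// => -[].
rewrite big_ord_recl -IH//= /pushforward.
rewrite (_ : _ @^-1` _ = I ord0 `*` box (fun i => I (lift ord0 i))).
  by apply: product_measure1E; [exact: mI|exact: (measurable_box
    (fun i => mI (lift ord0 i)))].
apply/seteqP; split=> [[t y]|[t y] [/= It Iy]].
  move=> /forall_ord_recl[]; rewrite rV_cons0 => It Iy; split=> //= i.
  by have := Iy i; rewrite rV_consS.
apply/forall_ord_recl; split; first by rewrite rV_cons0.
by move=> i; rewrite rV_consS; exact: Iy.
Qed.

Lemma lebesgue_rV_cube m (I : 'I_m -> set R) (d : R) :
  (forall i, measurable (I i)) -> (forall i, lebesgue_measure (I i) = d%:E) ->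
  lebesgue_rV m (box I) = (d ^+ m)%:E.
Proof.
move=> mI dI; rewrite lebesgue_rV_box//; under eq_bigr do rewrite dI.
by rewrite prodEFin prodr_const card_ord.
Qed.

(** In the sup norm a set of diameter at most d fits into a cube of side d, whose lowest corner has
    as coordinates the infima of those of E. *)
Lemma diameter_cube m (E : set 'rV[R]_m) (d : R) : (0 <= d)%R ->
  (forall x y, E x -> E y -> `|x - y| <= d)%R ->
  exists K : set (borel R m), [/\ measurable K, E `<=` K &
    lebesgue_rV m K = (d ^+ m)%:E].
Proof.
move=> d0 Ed; pose p i := inf [set x 0%R i | x in E].
pose I i := `[p i, (p i + d)%R]%classic.
have mI i : measurable (I i) by exact: measurable_itv.
exists (box I); split; [exact: measurable_box| |]; last first.
  apply: lebesgue_rV_cube => // i; rewrite lebesgue_measure_itv/= lte_fin ltrDl.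
  have [d1|d1] := ltP 0%R d; first by rewrite -EFinB addrC addKr.
  by have -> : d = 0%R by apply/eqP; rewrite eq_le d0 d1.
move=> x Ex i; rewrite /I /= in_itv /=.
have lb y : E y -> (y 0 i - d <= x 0 i)%R /\ (x 0 i - d <= y 0 i)%R.
  move=> Ey; have := Ed _ _ Ex Ey; move=> /(le_trans (ler_mx_entry _ 0%R i)).
  by rewrite !mxE ler_norml => /andP[? ?]; split; lra.
apply/andP; split.
  apply: ge_inf; last by exists x.
  by exists (x 0 i - d)%R => _ [y Ey <-]; exact: (lb y Ey).2.
rewrite -lerBlDr; apply: lb_le_inf; first by exists (x 0%R i), x.
by move=> _ [y Ey <-]; exact: (lb y Ey).2.
Qed.

End Boxes.

Section Grid.
Context {R : realType} {m : nat}.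
Local Open Scope ereal_scope.

Definition grid (j : nat) (z : 'rV[int]_m) : set 'rV[R]_m :=
  box (fun i => `[((z 0 i)%:~R / j.+1%:R)%R, (((z 0 i) + 1)%:~R / j.+1%:R)%R[%classic).

Lemma measurable_grid j z : measurable (grid j z : set (borel R m)).
Proof. by apply: measurable_box => i; exact: measurable_itv. Qed.

Lemma lebesgue_rV_grid j z : lebesgue_rV m (grid j z) = (j.+1%:R^-1 ^+ m)%:E.
Proof.
apply: lebesgue_rV_cube => i; first exact: measurable_itv.
rewrite lebesgue_measure_itv/= lte_fin ltr_pM2r ?invr_gt0 ?ltr0n//.
rewrite ltr_int ltzD1 lexx -EFinB -mulrBl intrD addrC addKr.
by rewrite mul1r.
Qed.

Lemma mem_grid j x : exists z, grid j z x.
Proof.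
exists (\row_i Num.floor (x 0 i * j.+1%:R)%R) => i; rewrite /= in_itv/= mxE.
rewrite ler_pdivrMr ?ltr0n// ltr_pdivlMr ?ltr0n//.
exact: real_floor_itv (num_real _).
Qed.

Lemma grid_disjoint j z z' x : grid j z x -> grid j z' x -> z = z'.
Proof.
move=> gz gz'; apply/rowP => i.
have E (w : 'rV[int]_m) : grid j w x -> w 0%R i = Num.floor (x 0 i * j.+1%:R)%R.
  move=> /(_ i) /=; rewrite in_itv/= ler_pdivrMr ?ltr0n// ltr_pdivlMr ?ltr0n//.
  by move=> gw; apply/esym/floor_def.
by rewrite (E _ gz) (E _ gz').
Qed.

Lemma grid_diameter j z x y : grid j z x -> grid j z y ->
  (`|x - y| <= j.+1%:R^-1)%R.
Proof.
move=> gx gy; apply/mx_norm_leP => // i k; rewrite ord1 !mxE.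
have := gx k; have := gy k; rewrite /= !in_itv/= intrD mulrDl mul1r.
set d := (j.+1%:R^-1)%R; set a := ((z 0 k)%:~R * d)%R.
rewrite ler_norml; clearbody a; clearbody d.
by move=> /andP[? ?] /andP[? ?]; apply/andP; split; lra.
Qed.

(* The part of E sent to a cube of side d has diameter at most d / c and is thus
   contained in a cube of side d / c; sum over the grid cubes that make up U. *)
Lemma expanding_measure_le_open (E : set (borel R m)) (th : 'rV[R]_m -> 'rV[R]_m)
    (c : R) (U : set 'rV[R]_m) : (0 < c)%R ->
  measurable E -> measurable_fun E (th : borel R m -> borel R m) ->
  (forall x y, E x -> E y -> c * `|x - y| <= `|th x - th y|)%R ->
  open U -> (forall x, E x -> U (th x)) ->
  lebesgue_rV m E <= (c^-1 ^+ m)%:E * lebesgue_rV m U.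
Proof.
move=> c0 mE mth Eth oU EU.
set mu := lebesgue_rV m.
pose Q j k : set 'rV[R]_m := if @pickle_inv 'rV[int]_m k is Some z then
  (if `[< grid j z `<=` U >] then grid j z else set0) else set0.
have mQ j k : measurable (Q j k : set (borel R m)).
  rewrite /Q; case: pickle_inv => // z; case: ifPn => // _; exact: measurable_grid.
have QU j k : Q j k `<=` U.
  rewrite /Q; case: pickle_inv => [z|]; last exact: sub0set.
  by case: asboolP => // _; exact: sub0set.
have tQ j : trivIset setT (Q j).
  move=> k l _ _ [x []]; rewrite /Q.
  case Ek: (@pickle_inv 'rV[int]_m k) => [z|//]; case: ifPn => // _ xz.
  case El: (@pickle_inv 'rV[int]_m l) => [w|//]; case: ifPn => // _ xw.
  have := @pickle_invK 'rV[int]_m k; have := @pickle_invK 'rV[int]_m l.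
  by rewrite Ek El /= => <- <-; rewrite (grid_disjoint xz xw).
pose A j k := E `&` th @^-1` Q j k.
have mA j k : measurable (A j k) by exact: mth.
have AQ j k : mu (A j k) <= (c^-1 ^+ m)%:E * mu (Q j k).
  rewrite /A /Q; case: pickle_inv => [z|]; last first.
    by rewrite preimage_set0 setI0 !measure0 mule0.
  case: ifPn => _; last by rewrite preimage_set0 setI0 !measure0 mule0.
  have [|x y [Ex xz] [Ey yz]|K [mK AK muK]] :=
      @diameter_cube R m (E `&` th @^-1` grid j z) (c^-1 / j.+1%:R).
  - by rewrite divr_ge0 ?invr_ge0// ltW.
  - rewrite ler_pdivlMl//; apply: le_trans (Eth _ _ Ex Ey) _.
    exact: grid_diameter xz yz.
  rewrite lebesgue_rV_grid -EFinM -exprMn -muK.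
  apply: le_measure; rewrite ?inE//.
  by apply: mth => //; exact: measurable_grid.
pose B j := \bigcup_k A j k.
have mB j : measurable (B j) by exact: bigcupT_measurable.
have BU j : mu (B j) <= (c^-1 ^+ m)%:E * mu U.
  apply: (@le_trans _ _ (\sum_(k <oo) mu (A j k))).
    exact: measure_sigma_subadditive.
  apply: (@le_trans _ _ (\sum_(k <oo) ((c^-1 ^+ m)%:E * mu (Q j k)))).
    by apply: lee_nneseries => // k _; exact: AQ.
  rewrite nneseriesZl//.
  rewrite lee_pmul2l ?lte_fin ?exprn_gt0 ?invr_gt0//.
  rewrite -measure_semi_bigcup//; last exact: bigcupT_measurable.
  apply: le_measure; rewrite ?inE; [exact: bigcupT_measurable|exact: open_borel|].
  exact: bigcup_sub.
(* The grids of sides 1 / (j + 1) are not nested, so B need not be monotone. The intersections over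
   i >= j are, and they exhaust E because U is open. *)
pose F j := \bigcap_(i in [set i | (j <= i)%N]) B i.
have mF j : measurable (F j) by apply: bigcap_measurable => //; exists j => /=.
have EF : E = \bigcup_j F j.
  apply/seteqP; split=> [x Ex|x [j _ Fx]]; last first.
    by have [k _ []] := Fx j (leqnn j).
  have /nbhs_ballP[d /= d0 dU] := open_nbhs_nbhs (conj oU (EU x Ex)).
  have [N _ Nd] := near_infty_natSinv_lt (PosNum d0).
  exists N => // i /= Ni; have [z xz] := mem_grid i (th x).
  exists (pickle z) => //; split=> //; rewrite /Q /= pickleK_inv.
  case: asboolP => // -[] y yz; apply: dU; apply/mx_ballE.
  exact: le_lt_trans (grid_diameter xz yz) (Nd _ Ni).
have ndF : nondecreasing_seq F.
  move=> p q pq; apply/subsetPset => x Fx i /= qi; apply: Fx => /=.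
  exact: leq_trans qi.
have cF := @nondecreasing_cvg_mu _ _ _ mu F mF (bigcupT_measurable _ mF) ndF.
rewrite EF -(cvg_lim _ cF)//.
apply: lime_le; first by apply/cvg_ex; eexists; exact: cF.
near=> j; apply: le_trans (BU j); apply: le_measure; rewrite ?inE//.
by apply: bigcap_inf => /=.
Unshelve. all: by end_near. Qed.

(** Outer regularity shrinks the open set U of the preceding lemma to the image of E; the ball
    provides the finite measure that this requires. *)
Lemma expanding_measure_le (E : set (borel R m)) (th : 'rV[R]_m -> 'rV[R]_m)
    (c r : R) : (0 < c)%R ->
  measurable E -> measurable_fun E (th : borel R m -> borel R m) ->
  (forall x y, E x -> E y -> c * `|x - y| <= `|th x - th y|)%R ->
  measurable (th @` E : set (borel R m)) ->
  th @` E `<=` ball (0%R : 'rV[R]_m) r ->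
  lebesgue_rV m E <= (c^-1 ^+ m)%:E * lebesgue_rV m (th @` E).
Proof.
move=> c0 mE mth Eth mthE thEr.
have cm0 : (0 < c^-1 ^+ m)%R by rewrite exprn_gt0// invr_gt0.
apply/lee_addgt0Pr => e e0.
have [||U oU [EU Ue]] := @borel_outer_regular R m (lebesgue_rV m) r (th @` E)
    (e / c^-1 ^+ m) _ mthE thEr.
- have [r0|r0] := ltP 0%R r; last first.
    rewrite (_ : ball _ _ = set0) ?measure0// -subset0 => x [].
    by move=> /lt_le_trans/(_ r0); rewrite ltxx.
  have [|x y xr yr|K [mK rK muK]] := @diameter_cube R m
    (ball (0%R : 'rV[R]_m) r) (2 * r).
  + by rewrite mulr_ge0// ltW.
  + move: xr yr => /mx_ballE; rewrite sub0r normrN => xr /mx_ballE.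
    rewrite sub0r normrN => yr; apply: le_trans (ler_normB _ _) _.
    by rewrite mulr_natl mulr2n; apply: lerD; exact: ltW.
  apply: (@le_lt_trans _ _ (lebesgue_rV m K)); last by rewrite muK ltry.
  by apply: le_measure; rewrite ?inE//; apply: open_borel; exact: ball_open.
- by rewrite divr_gt0.
apply: le_trans (@expanding_measure_le_open E th c U c0 mE mth Eth oU _) _.
  by move=> x Ex; apply: EU; exists x.
apply: (@le_trans _ _ ((c^-1 ^+ m)%:E * (lebesgue_rV m (th @` E) +
  (e / c^-1 ^+ m)%:E))).
  by rewrite lee_pmul2l.
rewrite ge0_muleDr//; last by rewrite lee_fin divr_ge0// ltW.
by rewrite -EFinM [(_ * (e / _))%R]mulrC divfK ?gt_eqF.
Qed.

End Grid.

(** * Linear images and determinants *)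

Section LinearImages.
Context {R : realType}.

Lemma mx_norm_mulmx m p (x : 'rV[R]_m) (S : 'M[R]_(m, p)) :
  `|x *m S| <= m%:R * `|S| * `|x|.
Proof.
apply/mx_norm_leP; first by rewrite !mulr_ge0.
move=> i j; rewrite ord1 mxE; apply: le_trans (ler_norm_sum _ _ _) _.
apply: (@le_trans _ _ (\sum_(k < m) `|S| * `|x|)).
  apply: ler_sum => k _; rewrite normrM mulrC.
  by apply: ler_pM => //; exact: ler_mx_entry.
by rewrite sumr_const card_ord -mulrA mulr_natl.
Qed.

Lemma continuous_mulmxr m p (S : 'M[R]_(m, p)) :
  continuous (mulmxr S : 'rV[R]_m -> 'rV[R]_p).
Proof.
apply: (@linear_bounded_continuous R 'rV[R]_m 'rV[R]_p (mulmxr S)).1.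
apply/linear_boundedP; near=> k => x /=.
apply: le_trans (mx_norm_mulmx _ _) _; apply: ler_wpM2r => //.
Unshelve. all: by end_near. Qed.

Local Open Scope ereal_scope.

Lemma mulmxr_image m (S : 'M[R]_m) (F : set 'rV[R]_m) : S \in unitmx ->
  mulmxr S @` F = mulmxr (invmx S) @^-1` F.
Proof.
move=> uS; apply/seteqP; split=> [_ [x Fx <-]|x Fx] /=; first by rewrite mulmxK.
by exists (x *m invmx S)%R => //=; rewrite mulmxKV.
Qed.

Lemma measurable_mulmxr_image m (S : 'M[R]_m) (F : set (borel R m)) :
  S \in unitmx -> measurable F -> measurable (mulmxr S @` F : set (borel R m)).
Proof.
move=> uS mF; rewrite mulmxr_image// -[X in measurable X]setTI.
exact: measurable_mulmx.
Qed.

Lemma lebesgue_rV_mulmxr m (S : 'M[R]_m) (F : set (borel R m)) :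
  S \in unitmx -> measurable F ->
  lebesgue_rV m (mulmxr S @` F) = `|\det S|%:E * lebesgue_rV m F.
Proof.
move=> uS mF; have mSF := measurable_mulmxr_image uS mF.
have detS : (\det S != 0)%R by rewrite -unitfE -unitmxE.
have mI (A : set (borel R m)) : measurable A ->
    measurable_fun setT (fun x => (\1_A x)%:E : \bar R).
  by move=> mA; apply/measurable_EFinP; exact: measurable_indic.
have i0 (x : borel R m) : 0 <= (\1_(mulmxr S @` F) x)%:E :> \bar R by rewrite lee_fin.
have := integral_mulmx_rV uS (mI _ mSF) i0; rewrite [in RHS]integral_indic// setIT.
move=> /(congr1 (fun x => `|\det S|%:E * x)).
rewrite [in RHS]muleA -EFinM mulfV ?normr_eq0// mul1e => <-.
congr (_ * _); rewrite -[in RHS](setIT F) -integral_indic//.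
apply: eq_integral => x _; rewrite !indicE; congr ((nat_of_bool _)%:R%:E).
apply/idP/idP => /set_mem; last by move=> Fx; apply/mem_set; exists x.
by move=> [y Fy /(can_inj (mulmxK uS)) <-]; exact/mem_set.
Qed.

(** M is injective because e < 1. The image of the unit cube has measure |det M| and diameter at
    most 1 + e. *)
Lemma det_near_id m (M : 'M[R]_m) (e : R) : (0 <= e < 1)%R ->
  (forall x : 'rV[R]_m, `|x *m M - x| <= e * `|x|)%R ->
  M \in unitmx /\ (`|\det M| <= (1 + e) ^+ m)%R.
Proof.
move=> /andP[e0 e1] Me.
have uM : M \in unitmx.
  rewrite -row_free_unit; apply: inj_row_free => x xM.
  have := Me x; rewrite xM sub0r normrN -subr_ge0 -[X in (_ - X)%R]mul1r -mulrBl.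
  rewrite nmulr_rge0 ?subr_lt0// => /(conj (normr_ge0 x))/andP.
  by rewrite -eq_le eq_sym normr_eq0 => /eqP.
split=> //.
pose Q : set 'rV[R]_m := grid 0 0.
have mQ : measurable (Q : set (borel R m)) by exact: measurable_grid.
have [|x' y' [x Qx <-] [y Qy <-]|K [mK QK muK]] :=
    @diameter_cube R m (mulmxr M @` Q) (1 + e).
- by rewrite addr_ge0.
- rewrite /= -mulmxBl; have := grid_diameter Qx Qy; rewrite invr1 => xy.
  rewrite -(subrK (x - y) ((x - y) *m M))%R; apply: le_trans (ler_normD _ _) _.
  rewrite addrC; apply: lerD => //; apply: le_trans (Me _) _.
  by rewrite ler_piMr.
have : lebesgue_rV m (mulmxr M @` Q) <= lebesgue_rV m K.
  by apply: le_measure; rewrite ?inE//; exact: measurable_mulmxr_image.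
rewrite muK lebesgue_rV_mulmxr// lebesgue_rV_grid invr1 expr1n mule1.
by rewrite lee_fin.
Qed.

End LinearImages.

(** * Borel images under injective maps *)

Section InjectiveImages.
Context {R : realType} {m : nat}.
Implicit Types (D : set 'rV[R]_m) (f : 'rV[R]_m -> 'rV[R]_m).

Definition sigma_compact (T : topologicalType) (D : set T) :=
  exists K : (set T)^nat, (forall n, compact (K n)) /\ D = \bigcup_n K n.

Lemma closed_half_space : closed (@half_space R m).
Proof.
rewrite (_ : half_space m = \bigcap_(i in [set i : 'I_m | val i = 0%N])
  ((fun x : 'rV[R]_m => x 0 i) @^-1` [set t : R | 0 <= t])).
  apply: closed_bigI => i _; apply: closed_comp; last exact: closed_ge.
  by move=> x _; exact: coord_continuous.
by apply/seteqP; split=> [x Hx i i0|x Hx i i0]; exact: Hx.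
Qed.

Lemma sigma_compact_half_space (W : set 'rV[R]_m) : open W ->
  sigma_compact (W `&` half_space m).
Proof.
move=> /open_exhaustion[C [cC ndC WC]].
exists (fun n => C n `&` half_space m `&` closed_ball (0 : 'rV[R]_m) n.+1%:R).
split=> [n|].
  apply: bounded_closed_compact; last first.
    by apply: closedI; [apply: closedI => //;
      exact: closed_half_space|exact: closed_ball_closed].
  exists n.+1%:R; split=> // M nM x [_].
  by rewrite closed_ballE// /closed_ball_ /= sub0r normrN => /le_trans -> //;
    exact: ltW.
apply/seteqP; split=> [x [Wx Hx]|x [n _ [[Cx Hx] _]]]; last first.
  by split=> //; rewrite WC; exists n.
move: Wx; rewrite WC => -[n _ Cx].
have [p xp] : exists p : nat, `|x| <= p%:R.
  by exists (Num.truncn `|x|).+1; apply: ltW; rewrite truncnS_gt.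
exists (maxn n p) => //; split; first split=> //.
  by move: x Cx {Hx xp}; apply/subsetPset; apply: ndC; exact: leq_maxl.
rewrite closed_ballE// /closed_ball_ /= sub0r normrN.
by rewrite (le_trans xp)// ler_nat leqW// leq_maxr.
Qed.

(** A case of the Lusin-Souslin theorem that avoids descriptive set theory: as D is sigma-compact,
    relatively closed subsets have images that are countable unions of compact sets. *)
Lemma injective_image_borel D f (B : set 'rV[R]_m) :
  sigma_compact D -> {within D, continuous f} ->
  (forall x y, D x -> D y -> f x = f y -> x = y) ->
  measurable (B : set (borel R m)) -> B `<=` D ->
  measurable (f @` B : set (borel R m)).
Proof.
move=> [K [cK DK]] cf finj mB BD.
have KD n : K n `<=` D by rewrite DK; exact: bigcup_sup.
have mC (C : set 'rV[R]_m) : closed C ->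
    measurable (f @` (D `&` C) : set (borel R m)).
  move=> cC; rewrite DK setI_bigcupl image_bigcup.
  apply: bigcupT_measurable => n; apply: closed_borel.
  apply: compact_closed; first exact: norm_hausdorff.
  apply: continuous_compact; last exact: compact_closedI.
  by apply: continuous_subspaceW cf => x [/KD].
(* By injectivity the sets whose image is Borel form a sigma-algebra. *)
pose G : set (set 'rV[R]_m) :=
  [set A | measurable (f @` (D `&` A) : set (borel R m))].
have GC A : G A -> G (~` A).
  rewrite /G /= => mA; rewrite (_ : f @` _ = f @` (D `&` setT) `\` f @` (D `&` A)).
    by apply: measurableD => //; apply: mC; exact: closedT.
  apply/seteqP; split=> [_ [x [Dx Ax] <-]|_ [[x [Dx _] <-]] Ax].
    split; first by exists x.
    by move=> [y [Dy Ay] /(finj _ _ Dy Dx) yx]; apply: Ax; rewrite -yx.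
  by exists x => //; split=> // ?; apply: Ax; exists x.
suff : <<s @open 'rV[R]_m >> `<=` G.
  by move=> /(_ B mB); rewrite /G /= setIidr.
apply: smallest_sub => [|U oU]; last first.
  by rewrite -(setCK U); apply: GC; apply: mC; exact: open_closedC.
split.
- by rewrite /G /= setI0 image_set0.
- by move=> A GA; rewrite setTD; exact: GC.
- move=> A GA; rewrite /G /= setI_bigcupr image_bigcup.
  exact: bigcupT_measurable.
Qed.

End InjectiveImages.

(** * Pieces on which the map is linear up to a small relative error *)

Section ChangeOfVariables.
Context {R : realType} {m : nat}.
Implicit Types (D E : set 'rV[R]_m) (f : 'rV[R]_m -> 'rV[R]_m).

Lemma bernoulli (x : R) n : 0 <= x <= 1 -> 1 - n%:R * x <= (1 - x) ^+ n.
Proof.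
move=> /andP[x0 x1]; elim: n => [|n IH]; first by rewrite mul0r subr0 expr0.
rewrite exprS; apply: le_trans (ler_wpM2l _ IH); last by rewrite subr_ge0.
rewrite -natr1; set k := n%:R; have k0 : 0 <= k by rewrite /k.
clearbody k; nra.
Qed.

(** The estimate on a piece loses the factor (1 + e)^(m+1) / (1 - e)^m, which is to be at most 1 /
    r. Bernoulli gives r <= (1 - e)^(2m+1), and (1 - e)(1 + e) <= 1 absorbs m + 1 of these
    factors. *)
Lemma distortion_near1 (r : R) : 0 < r < 1 -> exists e : R,
  0 < e < 1 /\ r * (1 + e) ^+ m.+1 <= (1 - e) ^+ m.
Proof.
move=> /andP[r0 r1]; exists ((1 - r) / (m + m.+1).+1%:R).
set N := (m + m.+1)%N; set e := _ / _.
have eN : e * N.+1%:R = 1 - r by rewrite divfK ?pnatr_eq0.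
have e0 : 0 < e by rewrite divr_gt0 ?ltr0n ?subr_gt0.
have e1 : e < 1.
  rewrite ltr_pdivrMr ?ltr0n// mul1r (lt_le_trans (_ : _ < 1)) ?ler1n//; lra.
split; first by rewrite e0.
apply: (@le_trans _ _ ((1 - e) ^+ N * (1 + e) ^+ m.+1)).
  rewrite ler_wpM2r ?exprn_ge0//; first by lra.
  apply: le_trans (bernoulli N _); last by rewrite !ltW.
  move: eN; rewrite -natr1; set k := N%:R => eN; lra.
rewrite /N exprD -mulrA -exprMn ler_piMr ?exprn_ge0//; first by lra.
rewrite exprn_ile1//; nra.
Qed.

Local Open Scope ereal_scope.

(** The map x -> f x S shrinks distances at most by the factor 1 - e, and S multiplies the measure
    of f(E) by |det S|. *)
Lemma near_id_measure_le E f (S : 'M[R]_m) (e : R) (q : 'rV[R]_m) (d : R) :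
  (0 <= e < 1)%R -> S \in unitmx ->
  measurable (E : set (borel R m)) ->
  measurable_fun (E : set (borel R m)) (f : borel R m -> borel R m) ->
  measurable (f @` E : set (borel R m)) -> E `<=` ball q d ->
  (forall x y, E x -> E y ->
    `|(f y - f x) *m S - (y - x)| <= e * `|y - x|)%R ->
  ((1 - e) ^+ m)%:E * lebesgue_rV m E <=
  `|\det S|%:E * lebesgue_rV m (f @` E).
Proof.
move=> /andP[e0 e1] uS mE mf mfE Eqd fS.
pose th x := (f x *m S)%R.
have thE : th @` E = mulmxr S @` (f @` E) by rewrite image_comp.
have e1' : (0 < 1 - e)%R by rewrite subr_gt0.
have thlow x y : E x -> E y -> ((1 - e) * `|x - y| <= `|th x - th y|)%R.
  move=> Ex Ey; have := fS _ _ Ey Ex; rewrite mulmxBl -/(th x) -/(th y).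
  move=> H; rewrite mulrBl mul1r lerBlDl -lerBlDr.
  by apply: le_trans H; rewrite [leRHS]distrC; exact: lerB_dist.
have [E0|/set0P[x0 Ex0]] := eqVneq E set0.
  by rewrite E0 image_set0 !measure0 !mule0.
rewrite -lebesgue_rV_mulmxr// -thE.
have thb : th @` E `<=` ball (0%R : 'rV[R]_m) (`|th x0| + (1 + e) * (d + d) + 1)%R.
  move=> _ [x Ex <-]; apply/mx_ballE; rewrite sub0r normrN.
  have := Eqd _ Ex; have := Eqd _ Ex0 => /mx_ballE qx0 /mx_ballE qx.
  have xx0 : (`|x - x0| <= d + d)%R.
    rewrite -(subrKA q) (le_trans (ler_normD _ _))// lerD// ltW//.
    by rewrite distrC.
  have := fS _ _ Ex0 Ex; rewrite mulmxBl -/(th x) -/(th x0) => H.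
  have : (`|th x - th x0| <= (1 + e) * `|x - x0|)%R.
    rewrite -(subrK (x - x0) (th x - th x0))%R (le_trans (ler_normD _ _))//.
    by rewrite mulrDl mul1r addrC lerD2l.
  have : (`|th x| <= `|th x0| + `|th x - th x0|)%R.
    by rewrite -{1}(subrK (th x0) (th x)) addrC ler_normD.
  have := normr_ge0 (x - x0)%R; nra.
have mth : measurable_fun (E : set (borel R m)) (th : _ -> borel R m).
  exact: (measurableT_comp (measurable_mulmx S) mf).
have mthE : measurable (th @` E : set (borel R m)).
  by rewrite thE; exact: measurable_mulmxr_image.
have := expanding_measure_le e1' mE mth thlow mthE thb.
have em0 : (0 < (1 - e) ^+ m)%R by rewrite exprn_gt0.
move=> H; apply: le_trans (lee_wpmul2l _ H) _; first by rewrite lee_fin ltW.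
by rewrite muleA -EFinM exprVn mulfV ?gt_eqF// mul1e.
Qed.

(** The constant r, inserted between h and a multiple of h' o f, reduces the claim to the measures
    of E and f(E). *)
Lemma near_id_integral_le E f (h h' : 'rV[R]_m -> R) (S : 'M[R]_m) (e r c : R)
    (q : 'rV[R]_m) (d : R) :
  (0 <= e < 1)%R -> S \in unitmx ->
  measurable (E : set (borel R m)) ->
  measurable_fun (E : set (borel R m)) (f : borel R m -> borel R m) ->
  measurable (f @` E : set (borel R m)) -> E `<=` ball q d ->
  measurable_fun (E : set (borel R m)) (h : borel R m -> R) ->
  measurable_fun (f @` E : set (borel R m)) (h' : borel R m -> R) ->
  (forall x y, E x -> E y ->
    `|(f y - f x) *m S - (y - x)| <= e * `|y - x|)%R ->
  (forall x, 0 <= h x)%R -> (forall x, 0 <= h' x)%R -> (0 <= c)%R -> (0 <= r)%R ->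
  (forall x, E x -> h x <= r /\ r * `|\det S| <= c * h' (f x))%R ->
  ((1 - e) ^+ m)%:E * \int[lebesgue_rV m]_(x in E) (h x)%:E <=
  c%:E * \int[lebesgue_rV m]_(y in f @` E) (h' y)%:E.
Proof.
move=> e01 uS mE mf mfE Eqd mh mh' fS h0 h'0 c0 r0 hr.
have H := near_id_measure_le e01 uS mE mf mfE Eqd fS.
have mhE : measurable_fun (E : set (borel R m)) (fun x => (h x)%:E).
  by apply/measurable_EFinP; exact: mh.
have mhE' : measurable_fun (f @` E : set (borel R m)) (fun x => (h' x)%:E).
  by apply/measurable_EFinP; exact: mh'.
have e1 : (0 <= (1 - e) ^+ m)%R.
  by case/andP: e01 => _ /ltW e1; rewrite exprn_ge0// subr_ge0.
apply: (@le_trans _ _ (((1 - e) ^+ m)%:E * (r%:E * lebesgue_rV m E))).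
  apply: lee_wpmul2l; first by rewrite lee_fin.
  rewrite -integral_cst//; apply: ge0_le_integral => //.
  - by move=> x _; rewrite lee_fin.
  - by move=> x Ex; rewrite lee_fin; exact: (hr x Ex).1.
apply: (@le_trans _ _ (r%:E * (`|\det S|%:E * lebesgue_rV m (f @` E)))).
  by rewrite muleCA; apply: lee_wpmul2l; rewrite ?lee_fin.
rewrite muleA -EFinM -integral_cst// -ge0_integralZl_EFin//;
  last by move=> x _; rewrite lee_fin.
apply: ge0_le_integral => //.
- by move=> x _; rewrite lee_fin mulr_ge0.
- by apply: measurable_funeM; exact: mhE'.
- by move=> _ [x Ex <-]; rewrite -EFinM lee_fin; exact: (hr x Ex).2.
Qed.

End ChangeOfVariables.

Section Pieces.
Context {R : realType} {m : nat}.
Variables (D : set 'rV[R]_m) (f : 'rV[R]_m -> 'rV[R]_m) (h h' : 'rV[R]_m -> R).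
Variables (e c : R).

(* On a piece, f followed by S is a perturbation of the identity of relative size e,
   and h, h' o f are compared with the constants r, r |det S| / c.  The parameters
   S, q, r will be rational, so that countably many pieces suffice. *)
Definition piece (S : 'M[R]_m) (j : nat) (q : 'rV[R]_m) (r : R) : set 'rV[R]_m :=
  [set x | [/\ D x, ball q (2 * j.+1%:R)^-1 x,
    (forall y, D y -> `|y - x| < j.+1%:R^-1 ->
      `|(f y - f x) *m S - (y - x)| <= e * `|y - x|),
    h x <= r & r * `|\det S| <= c * h' (f x)]].

Hypothesis cf : {within D, continuous f}.
Hypothesis mD : measurable (D : set (borel R m)).
Hypothesis mh : measurable_fun (D : set (borel R m)) (h : borel R m -> R).
Hypothesis mh' : measurable_fun (f @` D : set (borel R m)) (h' : borel R m -> R).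
Hypothesis mfD : measurable (f @` D : set (borel R m)).

Let mf : measurable_fun (D : set (borel R m)) (f : borel R m -> borel R m).
Proof. exact: within_measurable_rV. Qed.

(** For each y the points x that violate the distortion bound form a relatively open subset [G y] of
    D. Their union over the uncountably many y is still relatively open, hence Borel. *)
Lemma measurable_piece S j q r : measurable (piece S j q r : set (borel R m)).
Proof.
pose G y : set 'rV[R]_m := [set x | D x /\ `|y - x| < j.+1%:R^-1 /\
  e * `|y - x| < `|(f y - f x) *m S - (y - x)|].
have oG y : exists V : set 'rV[R]_m, open V /\ G y = D `&` V.
  pose u x := `|(f y - f x) *m S - (y - x)| - e * `|y - x|.
  have cu : {within D, continuous (u : _ -> R^o)}.
    have c1 : continuous ((fun x => f y - f x) : subspace D -> 'rV[R]_m).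
      by move=> x; apply: cvgB; [exact: cvg_cst|exact: cf].
    have c2 : continuous ((fun x => y - x) : subspace D -> 'rV[R]_m).
      apply: continuous_subspaceT => x.
      by apply: (@continuousB _ 'rV[R]_m 'rV[R]_m (cst y) id x);
        [exact: cst_continuous|].
    have c3 : continuous ((fun x => (f y - f x) *m S) : subspace D -> 'rV[R]_m).
      by move=> x; exact: (continuous_comp (c1 x) (@continuous_mulmxr R m m S _)).
    move=> x; apply: cvgB.
      by apply: cvg_norm; apply: cvgB; [exact: c3|exact: c2].
    by apply: cvgM; [exact: cvg_cst|apply: cvg_norm; exact: c2].
  have /continuousP/(_ _ (@open_gt R 0))/open_subspaceP[V oV VE] := cu.
  exists (V `&` ball y j.+1%:R^-1); split; first by apply: openI => //;
    exact: ball_open.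
  apply/seteqP; split=> [x [Dx [xy Gx]]|x [Dx [Vx /mx_ballE xy]]].
    split=> //; split; last exact/mx_ballE.
    have : (V `&` D) x by rewrite VE; split=> //=; rewrite /from_subspace /u subr_gt0.
    by case.
  split=> //; split=> //.
  have : (V `&` D) x by split.
  by rewrite VE => -[/=]; rewrite /u subr_gt0.
have /choice[V VG] := oG.
have -> : piece S j q r = ((D `&` ball q (2 * j.+1%:R)^-1) `\` (\bigcup_(y in D) V y))
    `&` (D `&` h @^-1` [set t | t <= r])
    `&` (D `&` (h' \o f) @^-1` [set t | r * `|\det S| <= c * t]).
  apply/seteqP; split=> x.
    case=> Dx qx Hx hx h'x; split; last by split.
    split; last by split.
    split; first by split.
    move=> [y Dy Vx]; have : G y x by rewrite (VG y).2.
    by move=> [_ [yx]]; rewrite ltNge Hx.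
  case=> -[[[Dx qx] nV] [_ hx]] [_ h'x]; split=> // y Dy yx.
  rewrite leNgt; apply/negP => ?; apply: nV; exists y => //.
  by have : G y x by []; rewrite (VG y).2 => -[].
apply: measurableI; first apply: measurableI.
- apply: measurableD.
    by apply: measurableI => //; apply: open_borel; exact: ball_open.
  by apply: open_borel; apply: bigcup_open => y _; exact: (VG y).1.
- apply: mh => //; rewrite (_ : [set t | t <= r] = `]-oo, r]%classic).
    exact: measurable_itv.
  by apply/seteqP; split=> t /=; rewrite in_itv.
- have mhf : measurable_fun (D : set (borel R m)) (h' \o f : borel R m -> R).
    by apply: (measurable_comp mfD _ mh' mf) => // _ [x Dx <-]; exists x.
  apply: mhf => //.
  rewrite (_ : mkset _ = ( *%R c) @^-1` `[r * `|\det S|, +oo[%classic); last first.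
    by apply/seteqP; split=> t /=; rewrite in_itv/= andbT.
  rewrite -[X in measurable X]setTI.
  by apply: (measurable_funM (@measurable_cst _ _ _ _ setT c)
    (@measurable_id _ _ setT)).
Qed.

Hypothesis e01 : 0 < e < 1.
Hypothesis ce : c = (1 + e) ^+ m.+1.
Hypothesis h0 : forall x, 0 <= h x.
Hypothesis h'0 : forall x, 0 <= h' x.

Lemma piece_cover x (A : 'M[R]_m) : D x -> A \in unitmx ->
  has_diff_within D f x (mulmxr A) -> h x <= `|\det A| * h' (f x) ->
  exists (S : 'M[rat]_m) (j : nat) (q : 'rV[rat]_m) (r : rat),
    [/\ (map_mx ratr S : 'M[R]_m) \in unitmx, 0 <= r &
        piece (map_mx ratr S) j (map_mx ratr q) (ratr r) x].
Proof.
move=> Dx uA fA hA; have /andP[e0 e1] := e01.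
have N0 (M : 'M[R]_m) : 0 < m%:R * `|M| + 1 by rewrite ltr_wpDl// mulr_ge0.
(* S approximates the inverse of A. One half of e is spent on this approximation, the other on the
   remainder of the differential; the added ones keep the denominators positive. *)
have [|S SA] := @rat_mx_dense R m m (invmx A)
  (e / 2 / (m%:R * (m%:R * `|A| + 1) + 1)).
  by rewrite !divr_gt0// ltr_wpDl// mulr_ge0// ltW// N0.
set T : 'M[R]_m := map_mx ratr S in SA *.
have AT (v : 'rV[R]_m) : `|v *m (A *m T) - v| <= e / 2 * `|v|.
  have -> : v *m (A *m T) - v = (v *m A) *m (T - invmx A).
    by rewrite mulmxBr mulmxK// mulmxA.
  apply: le_trans (mx_norm_mulmx _ _) _; rewrite distrC.
  have := mx_norm_mulmx v A.
  have K0 : 0 < m%:R * (m%:R * `|A| + 1) + 1 by rewrite ltr_wpDl// mulr_ge0// ltW// N0.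
  have : `|invmx A - T| * (m%:R * (m%:R * `|A| + 1) + 1) < e / 2.
    by rewrite -ltr_pdivlMr.
  have := normr_ge0 (invmx A - T); have := normr_ge0 v; have := normr_ge0 (v *m A).
  have := normr_ge0 A; have : (0 <= m%:R :> R) by [].
  move: `|invmx A - T| `|v *m A| `|v| `|A| (m%:R : R) => s w v' a k k0 a0 w0 v0 s0.
  move=> sk wk.
  have : k * s * w <= k * s * ((k * a + 1) * v').
    apply: ler_wpM2l; first by rewrite mulr_ge0.
    by rewrite mulrDl mul1r; apply: le_trans wk _; rewrite lerDl.
  have : k * s * (k * a + 1) * v' <= e / 2 * v'.
    by apply: ler_wpM2r => //; lra.
  lra.
have [|uAT dAT] := det_near_id (M := A *m T) (e := e / 2) _ AT.
  by rewrite divr_ge0 ?ltW//= ltr_pdivrMr//; lra.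
have uT : T \in unitmx by move: uAT; rewrite unitmx_mul => /andP[].
have dT0 : 0 < `|\det T| by rewrite normr_gt0 -unitfE -unitmxE.
(* The exponent m + 1 in c, instead of m, leaves room for a rational r even if m = 0. Where h' o f
   vanishes, so does h, and r = 0 serves. *)
have [r [r0 hr rh]] : exists r : rat,
    [/\ 0 <= r, h x <= ratr r & ratr r * `|\det T| <= c * h' (f x)].
  have hdT : h x * `|\det T| <= (1 + e / 2) ^+ m * h' (f x).
    apply: le_trans (ler_wpM2r (normr_ge0 _) hA) _.
    rewrite mulrAC -normrM -det_mulmx.
    exact: ler_wpM2r.
  have [h'x|h'x] := ltP 0 (h' (f x)); last first.
    have h'x0 : h' (f x) = 0 by apply/eqP; rewrite eq_le h'x h'0.
    exists 0; rewrite lexx rmorph0 mul0r h'x0 mulr0; split=> //.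
    by move: hA; rewrite h'x0 mulr0.
  have : h x < c * h' (f x) / `|\det T|.
    rewrite ltr_pdivlMr//; apply: le_lt_trans hdT _; rewrite ltr_pM2r// ce.
    apply: (@le_lt_trans _ _ ((1 + e) ^+ m)).
      by apply: lerXn2r; rewrite ?nnegrE; lra.
    by rewrite exprS ltr_pMl ?exprn_gt0; lra.
  move=> /rat_in_itvoo[r]; rewrite in_itv/= => /andP[r1 r2].
  exists r; split; last by rewrite -ler_pdivlMr// ltW.
    by rewrite -(@ler0q R) (le_trans (h0 x))// ltW.
  exact: ltW.
have e3 : 0 < e / 2 / (m%:R * `|T| + 1) by rewrite !divr_gt0.
have /nbhs_ballP[d /= d0 dH] := fA _ e3.
have [j _ /(_ j (leqnn j)) /= jd] := near_infty_natSinv_lt (PosNum d0).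
have [|q qx] := @rat_mx_dense R 1 m x (2 * j.+1%:R)^-1.
  by rewrite invr_gt0 mulr_gt0// ltr0n.
exists S, j, q, r; split=> //; split=> //.
  by apply/mx_ballE; rewrite distrC.
move=> y Dy yx.
have yA : `|f y - f x - (y - x) *m A| <= e / 2 / (m%:R * `|T| + 1) * `|y - x|.
  by apply: (dH y _ Dy); apply/mx_ballE; rewrite distrC; exact: lt_trans jd.
have -> : (f y - f x) *m T - (y - x) =
    (f y - f x - (y - x) *m A) *m T + ((y - x) *m (A *m T) - (y - x)).
  by rewrite [(f y - f x - (y - x) *m A) *m T]mulmxBl mulmxA addrA subrK.
apply: le_trans (ler_normD _ _) _.
have := AT (y - x); have := mx_norm_mulmx (f y - f x - (y - x) *m A) T.
have : m%:R * `|T| * `|f y - f x - (y - x) *m A| <= e / 2 * `|y - x|.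
  apply: (@le_trans _ _ ((m%:R * `|T| + 1) * `|f y - f x - (y - x) *m A|)).
    by rewrite ler_wpM2r// lerDl.
  rewrite mulrC -ler_pdivlMr ?N0//.
  by rewrite mulrAC.
have := normr_ge0 (y - x); lra.
Qed.

End Pieces.

Section ChangeOfVariablesLe.
Context {R : realType} {m : nat}.

Lemma sigma_compact_borel (D : set 'rV[R]_m) : sigma_compact D ->
  measurable (D : set (borel R m)).
Proof.
move=> [K [cK ->]]; apply: bigcupT_measurable => n; apply: closed_borel.
by apply: compact_closed => //; exact: norm_hausdorff.
Qed.

Local Open Scope ereal_scope.

Theorem change_of_variables_le (D : set 'rV[R]_m) (f : 'rV[R]_m -> 'rV[R]_m)
    (h h' : 'rV[R]_m -> R) (B : set (borel R m)) :
  sigma_compact D -> {within D, continuous f} ->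
  (forall x y, D x -> D y -> f x = f y -> x = y) ->
  measurable_fun (D : set (borel R m)) (h : borel R m -> R) ->
  measurable_fun (f @` D : set (borel R m)) (h' : borel R m -> R) ->
  (forall x, 0 <= h x)%R -> (forall x, 0 <= h' x)%R ->
  (forall x, D x -> exists A : 'M[R]_m, [/\ A \in unitmx,
    has_diff_within D f x (mulmxr A) & (h x <= `|\det A| * h' (f x))%R]) ->
  measurable B -> B `<=` D ->
  \int[lebesgue_rV m]_(x in B) (h x)%:E <=
  \int[lebesgue_rV m]_(y in f @` B) (h' y)%:E.
Proof.
move=> sD cf finj mh mh' h0 h'0 fA mB BD.
have mD := sigma_compact_borel sD.
have mim (F : set (borel R m)) : measurable F -> F `<=` D ->
    measurable (f @` F : set (borel R m)).
  exact: injective_image_borel.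
have mfD := mim D mD (fun x => id).
have mf : measurable_fun (D : set (borel R m)) (f : borel R m -> borel R m).
  exact: within_measurable_rV.
(* The loss on the pieces is absorbed by proving the inequality up to every factor r < 1. *)
apply/lee_mul01Pr; first by apply: integral_ge0 => x _; rewrite lee_fin.
move=> r r01; have [e [e01 re]] := @distortion_near1 R m r r01.
have r0 : (0 <= r)%R by case/andP: r01 => /ltW.
have /andP[e0 e1] := e01.
pose c := ((1 + e) ^+ m.+1)%R.
have c0 : (0 < c)%R by rewrite exprn_gt0// addr_gt0.
pose I := ('M[rat]_m * nat * 'rV[rat]_m * rat)%type.
pose F (i : option I) : set (borel R m) :=
  if i is Some (T, j, q, t)
  then if ((map_mx ratr T : 'M[R]_m) \in unitmx) && (0 <= t)%R
       then piece D f h h' e c (map_mx ratr T) j (map_mx ratr q) (ratr t)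
       else set0
  else set0.
have mF i : measurable (F i).
  case: i => [[[[T j] q] t]|] /=; last exact: measurable0.
  by case: ifP => _; [exact: measurable_piece|exact: measurable0].
have [E FE] : exists E : nat -> set (borel R m),
    (forall k, exists i, E k = F i) /\ (forall i : I, exists k, E k = F (Some i)).
  exists (F \o unpickle); split=> [k|i]; first by exists (unpickle k).
  by exists (pickle i); exact: (congr1 F (pickleK i)).
have mE k : measurable (E k).
  by have [i Ei] := FE.1 k; rewrite Ei; exact: mF.
(* Once the pieces are disjoint, so are their images, by injectivity; both integrals then become
   sums over the pieces. *)
pose P := seqDU (fun k => B `&` E k).
have mP k : measurable (P k).
  apply: measurableD; first exact: measurableI.
  by apply: bigsetU_measurable => i _; exact: measurableI.
have PBE k : P k `<=` B `&` E k by move=> x [].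
have PD k : P k `<=` D by move=> x /PBE[/BD].
have BE : B = \bigcup_k P k.
  rewrite -seqDU_bigcup_eq -setI_bigcupr; apply/esym/setIidPl => x /BD Dx.
  have [A [uA dA hA]] := fA _ Dx.
  have [S [j [q [t [uS t0 Px]]]]] := piece_cover e01 (erefl c) h0 h'0 Dx uA dA hA.
  have [k Ek] := FE.2 (S, j, q, t); exists k => //.
  by rewrite Ek /F uS t0.
have tP : trivIset setT P by exact: trivIset_seqDU.
have tfP : trivIset setT (fun k => f @` P k).
  move=> i j _ _ [_ [[x Px <-] [y Py /esym fxy]]].
  apply: tP => //; exists x; split=> //.
  by rewrite (finj _ _ (PD _ _ Px) (PD _ _ Py) fxy).
have mhE (Q : set (borel R m)) : Q `<=` D -> measurable Q ->
    measurable_fun Q (fun x => (h x)%:E).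
  by move=> QD mQ; apply/measurable_EFinP; exact: measurable_funS mh.
have mh'E (Q : set (borel R m)) : Q `<=` D -> measurable Q ->
    measurable_fun (f @` Q : set (borel R m)) (fun x => (h' x)%:E).
  move=> QD mQ; apply/measurable_EFinP; apply: measurable_funS mh' => //.
  exact: image_subset.
rewrite BE image_bigcup ge0_integral_bigcup//; last 2 first.
- by rewrite -BE; exact: mhE.
- by move=> x _; rewrite lee_fin.
rewrite ge0_integral_bigcup//; last 3 first.
- by move=> k; exact: mim.
- by rewrite -image_bigcup -BE; exact: mh'E.
- by move=> x _; rewrite lee_fin.
rewrite -nneseriesZl; last by move=> k _; apply: integral_ge0 => x _; rewrite lee_fin.
apply: lee_nneseries => [k _ _|k _].
  by rewrite mule_ge0 ?lee_fin//; apply: integral_ge0 => x _; rewrite lee_fin.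
set I1 := \int[_]_(x in P k) _.
set J := \int[lebesgue_rV m]_(x in f @` P k) (h' x)%:E.
have I0 : 0 <= I1 by apply: integral_ge0 => x _; rewrite lee_fin.
suff H : ((1 - e) ^+ m)%:E * I1 <= c%:E * J.
  rewrite -(@lee_pmul2l _ c%:E)// ?lte_fin//.
  apply: le_trans H; rewrite muleA -EFinM lee_wpmul2r// lee_fin.
  by rewrite mulrC.
have := PBE k; have [[[[[T j] q] t]|] ->] := FE.1 k; rewrite /F; last first.
  rewrite setI0 subset0 => Pk0.
  by rewrite /I1 /J Pk0 image_set0 !integral_set0 !mule0.
case: ifP => [/andP[uS t0]|_]; last first.
  rewrite setI0 subset0 => Pk0.
  by rewrite /I1 /J Pk0 image_set0 !integral_set0 !mule0.
move=> PkE; have Pp x : P k x -> piece D f h h' e c (map_mx ratr T) j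
  (map_mx ratr q) (ratr t) x.
  by move=> /PkE[].
apply: (@near_id_integral_le _ _ (P k) f h h' (map_mx ratr T) e (ratr t) c
  (map_mx ratr q) (2 * j.+1%:R)^-1).
- by rewrite ltW.
- by [].
- exact: mP.
- by apply: measurable_funS mf => //; exact: PD.
- exact: mim.
- by move=> x /Pp[].
- by apply: measurable_funS mh => //; exact: PD.
- by apply: measurable_funS mh' => //; apply: image_subset; exact: PD.
- move=> x y Px Py; have [Dx qx H _ _] := Pp x Px; have [Dy qy _ _ _] := Pp y Py.
  apply: H => //; rewrite -(subrKA (map_mx ratr q)) (le_lt_trans (ler_normD _ _))//.
  move: qx qy => /mx_ballE qx /mx_ballE; rewrite distrC => qy.
  apply: lt_le_trans (ltrD qy qx) _.
  by rewrite -mulr2n -[(_^-1 *+ 2)%R]mulr_natl invfM mulrA mulfV ?mul1r ?pnatr_eq0.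
- exact: h0.
- exact: h'0.
- exact: ltW.
- by rewrite ler0q.
- by move=> x /Pp[].
Qed.

End ChangeOfVariablesLe.

(** * Exterior powers *)

Section Antisymmetric.
Context {R : realType} {m : nat}.

Definition antisymmetric_form k (F : ('I_k -> 'rV[R]_m) -> R) :=
  forall v (t : 'S_k), F (fun i => v (t i)) = (-1) ^+ t * F v.

Lemma antisymmetric_alternating k (F : ('I_k -> 'rV[R]_m) -> R) :
  antisymmetric_form F -> is_alternating F.
Proof.
move=> aF v i j ij vij.
have := aF v (tperm i j); rewrite odd_tperm ij expr1 mulN1r.
have -> : (fun l => v (tperm i j l)) = v.
  by apply/funext => l; case: tpermP => [->|->|].
by move/eqP; rewrite -subr_eq0 opprK -mulr2n mulrn_eq0 => /eqP.
Qed.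

Lemma multilinear_slot0 k (F : ('I_k -> 'rV[R]_m) -> R) v i :
  is_multilinear F -> F [eta v with i |-> 0] = 0.
Proof.
move=> mF; have := mF v i 1 0 0; rewrite scaler0 addr0 mul1r => /eqP.
by rewrite -subr_eq0 opprD addNKr oppr_eq0 => /eqP.
Qed.

(** Expansion in the standard basis, one slot at a time; the induction is on the number r of slots
    that need not be basis vectors yet. *)
Lemma multilinear_eq0 (F : ('I_m -> 'rV[R]_m) -> R) : is_multilinear F ->
  (forall f : 'I_m -> 'I_m, F (fun i => delta_mx 0 (f i)) = 0) ->
  forall v, F v = 0.
Proof.
move=> mF F0 v.
suff H (r : nat) : (r <= m)%N -> forall u, (exists f : 'I_m -> 'I_m,
    forall i : 'I_m, (r <= i)%N -> u i = delta_mx 0 (f i)) -> F u = 0.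
  by apply: (H m) => //; exists id => i; rewrite leqNgt ltn_ord.
elim: r => [|r IH] rk u [f uf].
  rewrite -(F0 f); congr F; apply/funext => i; exact: uf.
pose i := Ordinal rk.
have -> : u = [eta u with i |-> \sum_(j < m) u i 0 j *: delta_mx 0 j].
  apply/funext => l /=; case: eqP => // ->; exact: row_sum_delta.
elim/big_rec: _ => [|j x _ IHx]; first exact: multilinear_slot0.
rewrite mF IHx addr0; apply/eqP; rewrite mulf_eq0; apply/orP; right; apply/eqP.
apply: IH; first exact: ltnW.
exists [eta f with i |-> j] => l rl /=; case: eqP => // /eqP li.
apply: uf; rewrite ltn_neqAle rl andbT; apply: contra li => /eqP rl'.
by apply/eqP/val_inj.
Qed.

Lemma row_matrix_perm (v : 'I_m -> 'rV[R]_m) (t : 'S_m) :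
  \matrix_(i < m) v (t i) = row_perm t (\matrix_(i < m) v i).
Proof. by apply/matrixP => i j; rewrite !mxE. Qed.

(** The difference of the two sides is multilinear in the rows. On a tuple of basis vectors it
    vanishes: either the tuple is a permutation of the basis, or it has a repetition and both terms
    are 0. *)
Lemma antisymmetric_det (F : ('I_m -> 'rV[R]_m) -> R) :
  is_multilinear F -> antisymmetric_form F ->
  forall A : 'M[R]_m,
    F (fun i => row i A) = \det A * F (fun i => delta_mx 0 i).
Proof.
move=> mF aF A; pose e i : 'rV[R]_m := delta_mx 0 i.
pose D (v : 'I_m -> 'rV[R]_m) := \det (\matrix_(i < m) v i).
have aD : antisymmetric_form D.
  by move=> v t; rewrite /D row_matrix_perm row_permE det_mulmx det_perm.
have mD : is_multilinear D.
  move=> v i a x y; rewrite /D -[X in _ = _ + X]mul1r.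
  apply: (determinant_multilinear (i0 := i)).
  - by rewrite !rowK /= eqxx scale1r.
  - by apply/matrixP => l j; rewrite !mxE /= eq_sym (negPf (neq_lift _ _)).
  - by apply/matrixP => l j; rewrite !mxE /= eq_sym (negPf (neq_lift _ _)).
suff : F (fun i => row i A) - D (fun i => row i A) * F e = 0.
  move/eqP; rewrite subr_eq0 => /eqP ->; congr (\det _ * _).
  by apply/row_matrixP => i; rewrite rowK.
apply: (@multilinear_eq0 (fun v => F v - D v * F e)).
  by move=> v i a x y; rewrite mF mD; ring.
move=> f; have [finj|] := boolP (injectiveb f).
  have E (G : ('I_m -> 'rV[R]_m) -> R) : antisymmetric_form G ->
      G (fun i => e (f i)) = (-1) ^+ (perm (injectiveP f finj)) * G e.
    by move=> /(_ e (perm (injectiveP f finj))) <-; congr G; apply/funext => i;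
      rewrite permE.
  rewrite (E F)// (E D)// [D e](_ : _ = 1) ?mulr1 ?subrr//.
  rewrite /D -[RHS](det1 R m); congr (\det _).
  by apply/matrixP => i j; rewrite !mxE eqxx eq_sym.
move=> /injectivePn[i [j ij fij]].
rewrite (antisymmetric_alternating aF ij); last by rewrite fij.
by rewrite (antisymmetric_alternating aD ij) ?mul0r ?subrr// fij.
Qed.

End Antisymmetric.

Section Wedge.
Context {R : realType}.

Lemma wedge_antisymmetric m k l (w : ('I_k -> 'rV[R]_m) -> R)
    (w' : ('I_l -> 'rV[R]_m) -> R) : antisymmetric_form (wedge w w').
Proof.
move=> v t; rewrite /wedge mulrCA; congr (_ * _).
rewrite (reindex_inj (mulIg (t^-1)%g)) /= mulr_sumr; apply: eq_bigr => s _.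
rewrite odd_permM odd_permV signr_addb -!mulrA [in RHS]mulrCA; congr (_ * (_ * _)).
by congr (_ * _); [congr w|congr w']; apply/funext => i; rewrite permM permKV.
Qed.

(** In the term of s, the argument i enters exactly one of w and w', namely the one selected by the
    preimage of i under s. *)
Lemma wedge_multilinear m k l (w : ('I_k -> 'rV[R]_m) -> R)
    (w' : ('I_l -> 'rV[R]_m) -> R) : is_multilinear w -> is_multilinear w' ->
  is_multilinear (wedge w w').
Proof.
move=> mw mw' v i a x y; rewrite /wedge mulrCA -mulrDr; congr (_ * _).
rewrite mulr_sumr -big_split; apply: eq_bigr => s _ /=.
have updE p (g : 'I_p -> 'I_(k + l)) z (i0 : 'I_p) : injective g -> i = g i0 ->
    (fun i' => [eta v with i |-> z] (g i')) = [eta (fun i' => v (g i')) with i0 |-> z].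
  by move=> ginj ->; apply/funext => i' /=; rewrite (inj_eq ginj).
have updN p (g : 'I_p -> 'I_(k + l)) z : (forall i', g i' != i) ->
    (fun i' => [eta v with i |-> z] (g i')) = (fun i' => v (g i')).
  by move=> gi; apply/funext => i' /=; rewrite (negPf (gi i')).
have lsinj : injective (fun j => s (lshift l j)) by move=> ? ? /perm_inj/lshift_inj.
have rsinj : injective (fun j => s (rshift k j)) by move=> ? ? /perm_inj/rshift_inj.
have [j ij|j ij] := split_ordP (s^-1 i)%g.
  have is_ : i = s (lshift l j) by rewrite -ij permKV.
  have sN j' : s (rshift k j') != i.
    by rewrite is_ (inj_eq perm_inj) eq_rlshift.
  have EL z := updE _ _ z _ lsinj is_; have EN z := updN _ _ z sN.
  rewrite (EL (a *: x + y)) (EL x) (EL y) (EN (a *: x + y)) (EN x) (EN y) mw.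
  by rewrite mulrDr mulrDl mulrCA -!mulrA.
have is_ : i = s (rshift k j) by rewrite -ij permKV.
have sN j' : s (lshift l j') != i.
  by rewrite is_ (inj_eq perm_inj) eq_lrshift.
have EL z := updE _ _ z _ rsinj is_; have EN z := updN _ _ z sN.
rewrite (EL (a *: x + y)) (EL x) (EL y) (EN (a *: x + y)) (EN x) (EN y) mw'.
by rewrite mulrDr mulrCA.
Qed.

Lemma wedge_pow_antisymmetric m k (w : ('I_k -> 'rV[R]_m) -> R) n :
  antisymmetric_form (wedge_pow w n).
Proof.
case: n => [|n]; last exact: wedge_antisymmetric.
move=> v t /=; rewrite (_ : t = 1%g) ?odd_perm1 ?mulr1//.
by apply/permP => -[].
Qed.

Lemma wedge_pow_multilinear m k (w : ('I_k -> 'rV[R]_m) -> R) n :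
  is_multilinear w -> is_multilinear (wedge_pow w n).
Proof.
move=> mw; elim: n => [|n IH]; last exact: wedge_multilinear.
by move=> v [].
Qed.

Lemma wedge_pow_pullback m k (w w' : ('I_k -> 'rV[R]_m) -> R) (J : 'M[R]_m) n :
  (forall v, w' (fun i => v i *m J) = w v) ->
  forall v, wedge_pow w' n (fun i => v i *m J) = wedge_pow w n v.
Proof.
move=> ww'; elim: n => [//|n IH] v /=; rewrite /wedge; congr (_ * _).
apply: eq_bigr => s _; rewrite -IH -ww'; congr (_ * _ * _).
Qed.

Lemma wedge_powZ m k (w : ('I_k -> 'rV[R]_m) -> R) (a : R) n v :
  wedge_pow (fun u => a * w u) n v = a ^+ n * wedge_pow w n v.
Proof.
elim: n v => [|n IH] v /=; first by rewrite mul1r.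
rewrite /wedge [RHS]mulrCA; congr (_ * _); rewrite mulr_sumr.
apply: eq_bigr => s _; rewrite IH exprS.
by move: (_ ^+ s) (w _) (wedge_pow _ _ _) => x y z; ring.
Qed.

(** The n-th power has top degree, so pulling it back multiplies its only coefficient by the
    determinant. *)
Lemma wedge_pow_det k n (w w' : ('I_k -> 'rV[R]_(n * k)) -> R) (J : 'M[R]_(n * k)) :
  is_multilinear w' -> (forall v, w' (fun i => v i *m J) = w v) ->
  wedge_pow w n (fun i => delta_mx 0 i) =
  \det J * wedge_pow w' n (fun i => delta_mx 0 i).
Proof.
move=> mw' ww'; rewrite -(wedge_pow_pullback ww').
rewrite -antisymmetric_det; last exact: wedge_pow_antisymmetric.
  by congr (wedge_pow _ _ _); apply/funext => i; rewrite rowE.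
exact: wedge_pow_multilinear.
Qed.

End Wedge.

(** * Differentials relative to a subset and composition of morphisms *)

Lemma open_setI_preimage (T U : topologicalType) (f : T -> U) W W' :
  open W -> open W' -> (forall x, W x -> {for x, continuous f}) ->
  open (W `&` f @^-1` W').
Proof.
move=> oW oW' cf; rewrite openE => x [Wx W'x]; apply: filterI.
  exact: open_nbhs_nbhs.
by apply: (cf x Wx); exact: open_nbhs_nbhs.
Qed.

Section CnCalculus.
Context {R : realType} {p : nat}.
Implicit Types (V : normedModType R) (W : set 'rV[R]_p).

Lemma Cn_continuous V n W (f : 'rV[R]_p -> V) x : Cn n W f -> W x ->
  {for x, continuous f}.
Proof.
case: n => [|n] /=; first by move=> cf Wx; exact: cf.
move=> [df [fdf _]] Wx; have := fdf x Wx => ?.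
exact: differentiable_continuous.
Qed.

Lemma Cn_subset V n W W' (f : 'rV[R]_p -> V) : W' `<=` W ->
  Cn n W f -> Cn n W' f.
Proof.
move=> W'W; elim: n f => [|n IH] f /=; first by move=> cf x /W'W; exact: cf.
move=> [df [fdf cdf]]; exists df; split=> [x /W'W|v]; first exact: fdf.
exact: IH.
Qed.

Lemma CnW V n W (f : 'rV[R]_p -> V) : Cn n.+1 W f -> Cn n W f.
Proof.
elim: n f => [|n IH] f; first by move=> cf x; exact: Cn_continuous cf.
by move=> [df [fdf cdf]]; exists df; split=> // v; exact: IH.
Qed.

Lemma Cn_lin V V' n W (L : {linear V -> V'}) (f : 'rV[R]_p -> V) :
  continuous L -> Cn n W f -> Cn n W (L \o f).
Proof.
move=> cL; elim: n f => [|n IH] f /=.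
  by move=> cf x Wx; apply: continuous_comp; [exact: cf|exact: cL].
move=> [df [fdf cdf]]; exists (fun x v => L (df x v)); split=> [x Wx|v].
  have ? := fdf x Wx.
  have dL : is_diff (f x) L L.
    apply: is_diff_eq; first by apply: differentiableP; exact: linear_differentiable.
    exact: diff_lin.
  exact: is_diff_comp.
exact: (IH _ (cdf v)).
Qed.

Lemma CnD V n W (f g : 'rV[R]_p -> V) :
  Cn n W f -> Cn n W g -> Cn n W (fun x => f x + g x).
Proof.
elim: n f g => [|n IH] f g /=.
  by move=> cf cg x Wx; apply: continuousD; [exact: cf|exact: cg].
move=> [df [fdf cdf]] [dg [gdg cdg]].
exists (fun x v => df x v + dg x v); split=> [x Wx|v].
  by have ? := fdf x Wx; have ? := gdg x Wx; exact: is_diffD.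
exact: IH.
Qed.

Lemma Cn_cst V n W (a : V) : Cn n W (fun=> a).
Proof.
elim: n a => [|n IH] a /=; first by move=> x _; exact: cst_continuous.
by exists (fun _ _ => 0); split=> [x _|v]; [exact: is_diff_cst|exact: IH].
Qed.

Lemma Cn_sum V n W (I : Type) (r : seq I) (f : I -> 'rV[R]_p -> V) :
  (forall i, Cn n W (f i)) -> Cn n W (fun x => \sum_(i <- r) f i x).
Proof.
move=> cf; elim: r => [|i r IH].
  by under eq_fun do rewrite big_nil; exact: Cn_cst.
by under eq_fun do rewrite big_cons; exact: CnD.
Qed.

Lemma CnM n W (f g : 'rV[R]_p -> R^o) :
  Cn n W f -> Cn n W g -> Cn n W (fun x => f x * g x : R^o).
Proof.
elim: n f g => [|n IH] f g.
  by move=> cf cg x Wx; apply: (@continuousM R); [exact: cf|exact: cg].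
move=> cf cg; have [df [fdf cdf]] := cf; have [dg [gdg cdg]] := cg.
exists (fun x v => f x * dg x v + g x * df x v); split=> [x Wx|v].
  by have ? := fdf x Wx; have ? := gdg x Wx; exact: is_diffM.
by apply: CnD; apply: IH; [exact: CnW cf|exact: cdg|exact: CnW cg|exact: cdf].
Qed.

Lemma Cn_coord n W q (f : 'rV[R]_p -> 'rV[R]_q) (j : 'I_q) :
  Cn n W f -> Cn n W (fun x => f x 0 j : R^o).
Proof.
pose L : 'rV[R]_q -> R^o := fun x => x 0 j.
have lL : linear L by move=> a x y; rewrite /L !mxE.
pose LM := GRing.isLinear.Build _ _ _ _ _ lL.
pose L' : {linear 'rV[R]_q -> R^o} := HB.pack L LM.
by apply: (@Cn_lin _ _ n W L'); exact: coord_continuous.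
Qed.

Lemma Cn_row n W q (f : 'rV[R]_p -> 'rV[R]_q) :
  (forall j, Cn n W (fun x => f x 0 j : R^o)) -> Cn n W f.
Proof.
move=> cf.
have -> : f = fun x => \sum_(j < q) f x 0 j *: delta_mx 0 j.
  by apply/funext => x; exact: row_sum_delta.
apply: Cn_sum => j.
pose L (t : R^o) : 'rV[R]_q := t *: delta_mx 0 j.
have lL : linear L by move=> a x y; rewrite /L scalerDl scalerA.
pose LM := GRing.isLinear.Build _ _ _ _ _ lL.
pose L' : {linear R^o -> 'rV[R]_q} := HB.pack L LM.
apply: (@Cn_lin _ _ n W L' _ _ (cf j)).
by move=> t; exact: scalel_continuous.
Qed.

End CnCalculus.

Section CnComposition.
Context {R : realType} {p q : nat}.

Lemma is_diff_linear (V V' : normedModType R) (f df : V -> V') x :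
  is_diff x f df -> linear df.
Proof. by move=> H; have <- := @diff_val _ _ _ _ _ _ _ H; exact: linearP. Qed.

(** [Cn] speaks of derivatives in fixed directions, whereas the chain rule differentiates g in the
    direction df x v, which moves with x. This direction is therefore expanded in the standard
    basis. *)
Lemma Cn_comp_scalar n (W : set 'rV[R]_p) (W' : set 'rV[R]_q)
    (f : 'rV[R]_p -> 'rV[R]_q) (g : 'rV[R]_q -> R^o) :
  (forall x, W x -> W' (f x)) -> Cn n W f -> Cn n W' g -> Cn n W (g \o f).
Proof.
move=> WW'; elim: n g => [|n IH] g cf cg.
  move=> x Wx; apply: continuous_comp; first exact: cf.
  exact: (cg _ (WW' _ Wx)).
have [df [fdf cdf]] := cf; have [dg [gdg cdg]] := cg.
exists (fun x v => \sum_(j < q) df x v 0 j * dg (f x) (delta_mx 0 j)).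
split=> [x Wx|v]; last first.
  apply: Cn_sum => j; apply: CnM; first exact: Cn_coord (cdf v).
  exact: (IH _ (CnW cf) (cdg _)).
have dfx := fdf x Wx; have dgx := gdg _ (WW' _ Wx).
have H := @is_diff_comp _ _ _ _ _ _ _ _ _ dfx dgx; apply: (is_diff_eq H).
apply/funext => v /=.
have lg := is_diff_linear dgx.
pose LM := GRing.isLinear.Build _ _ _ _ _ lg.
pose G : {linear 'rV[R]_q -> R^o} := HB.pack (dg (f x)) LM.
have -> : dg (f x) (df x v) = G (df x v) by [].
rewrite [in LHS](row_sum_delta (df x v)) linear_sum.
by apply: eq_bigr => j _; rewrite linearZ.
Qed.

Lemma Cn_comp r n (W : set 'rV[R]_p) (W' : set 'rV[R]_q)
    (f : 'rV[R]_p -> 'rV[R]_q) (g : 'rV[R]_q -> 'rV[R]_r) :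
  (forall x, W x -> W' (f x)) -> Cn n W f -> Cn n W' g -> Cn n W (g \o f).
Proof.
move=> WW' cf cg; apply: Cn_row => j.
exact: (Cn_comp_scalar WW' cf (Cn_coord j cg)).
Qed.

Lemma smooth_on_comp r (D : set 'rV[R]_p) (D' : set 'rV[R]_q)
    (f : 'rV[R]_p -> 'rV[R]_q) (g : 'rV[R]_q -> 'rV[R]_r) :
  (forall x, D x -> D' (f x)) -> smooth_on D f -> smooth_on D' g ->
  smooth_on D (g \o f).
Proof.
move=> DD' sf sg x Dx.
have [W [f' [oW Wx cf ff']]] := sf x Dx.
have [W' [g' [oW' W'x cg gg']]] := sg _ (DD' x Dx).
have cf' y : W y -> {for y, continuous f'} by exact: (Cn_continuous (cf 0%N)).
exists (W `&` f' @^-1` W'), (g' \o f'); split.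
- exact: open_setI_preimage.
- by split=> //=; rewrite -ff'.
- by move=> n; apply: (@Cn_comp _ n _ W') => [y []//||];
    [exact: Cn_subset (cf n)|exact: cg].
- by move=> y [Wy W'y] Dy /=; rewrite (ff' y Wy Dy) -gg'// -?ff'//; exact: DD'.
Qed.

End CnComposition.

Section DifferentialWithin.
Context {R : realType}.

Lemma has_diff_within_near p (V : normedModType R) (D D' : set 'rV[R]_p)
    (f g : 'rV[R]_p -> V) x L :
  (\forall y \near x, D y -> D' y /\ f y = g y) -> f x = g x ->
  has_diff_within D' g x L -> has_diff_within D f x L.
Proof.
move=> DD' fg H e e0; near=> y => Dy.
have [D'y ->] : D' y /\ f y = g y by move: Dy; near: y.
by rewrite fg; move: D'y; near: y; exact: H.
Unshelve. all: by end_near. Qed.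

Lemma jac_withinP p q (D : set 'rV[R]_p) (f : 'rV[R]_p -> 'rV[R]_q) x A :
  has_diff_within D f x (mulmxr A) ->
  has_diff_within D f x (mulmxr (jac_within D f x)).
Proof.
move=> fA; apply: (@xgetPex _ 0 [set A | has_diff_within D f x (mulmxr A)]).
by exists A.
Qed.

Lemma is_diff_has_diff_within p q (D : set 'rV[R]_p)
    (f df : 'rV[R]_p -> 'rV[R]_q) x :
  is_diff x f df -> exists A : 'M[R]_(p, q), has_diff_within D f x (mulmxr A).
Proof.
move=> H; have lf := is_diff_linear H.
pose LM := GRing.isLinear.Build _ _ _ _ _ lf.
pose L : {linear 'rV[R]_p -> 'rV[R]_q} := HB.pack df LM.
exists (lin1_mx L) => e e0.
have /diff_locally/eqaddoP/(_ e e0) := @ex_diff _ _ _ _ _ _ _ H.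
rewrite (@diff_val _ _ _ _ _ _ _ H) => fo.
apply/nbhs0P; apply: filterS fo => z fz _.
have Lz : mulmxr (lin1_mx L) z = df z := mul_rV_lin1 L z.
rewrite [x + z]addrC addrK Lz.
by move: fz; rewrite /= !fctE /= /shift opprD addrA.
Qed.

Lemma smooth_on_has_diff_within p q (D : set 'rV[R]_p)
    (f : 'rV[R]_p -> 'rV[R]_q) x : smooth_on D f -> D x ->
  exists A : 'M[R]_(p, q), has_diff_within D f x (mulmxr A).
Proof.
move=> sf Dx; have [W [g [oW Wx cg fg]]] := sf x Dx.
have [dg [gdg _]] := cg 1%N.
have [A gA] := is_diff_has_diff_within D (gdg x Wx).
exists A; apply: has_diff_within_near gA; last exact: fg.
have : nbhs x W by exact: open_nbhs_nbhs.
by apply: filterS => y Wy Dy; split=> //; exact: fg.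
Qed.

Lemma smooth_on_continuous p (V : normedModType R) (D : set 'rV[R]_p)
    (f : 'rV[R]_p -> V) : smooth_on D f -> {within D, continuous f}.
Proof.
move=> sf; apply/subspace_continuousP => x Dx.
have [W [g [oW Wx cg fg]]] := sf x Dx.
have gx := Cn_continuous (cg 0%N) Wx.
have fx : from_subspace D f x = g x := fg x Wx Dx.
rewrite fx => U /gx gU; rewrite /nbhs /= /within /=.
have nW : nbhs x W by exact: open_nbhs_nbhs.
near=> y => Dy; have /= -> : from_subspace D f y = g y; last by near: y.
by apply: fg => //; near: y.
Unshelve. all: by end_near.
Qed.

Lemma has_diff_within_unique p q (V : set 'rV[R]_p) (f : 'rV[R]_p -> 'rV[R]_q)
    x (A B : 'M[R]_(p, q)) :
  open V -> V x -> half_space p x ->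
  has_diff_within (V `&` half_space p) f x (mulmxr A) ->
  has_diff_within (V `&` half_space p) f x (mulmxr B) -> A = B.
Proof.
move=> oV Vx Hx fA fB; apply/row_matrixP => i.
apply/eqP; rewrite -subr_eq0 -normr_le0; apply/ler_addgt0Pr => e e0; rewrite add0r.
have e2 : 0 < e / 2 by rewrite divr_gt0.
have /nbhs_ballP[d /= d0 dH] : nbhs x (fun y => V y /\
    ((V `&` half_space p) y -> `|f y - f x - mulmxr A (y - x)| <= e / 2 * `|y - x|) /\
    ((V `&` half_space p) y -> `|f y - f x - mulmxr B (y - x)| <= e / 2 * `|y - x|)).
  by apply: filterI; [exact: open_nbhs_nbhs|apply: filterI; [exact: fA|exact: fB]].
(* x + t e_i lies in the half-space for t > 0, so the increments in this direction
   determine the i-th row. *)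
pose t := d / 2; have t0 : 0 < t by rewrite divr_gt0.
pose v : 'rV[R]_p := delta_mx 0 i.
have vn : `|v| <= 1.
  by apply/mx_norm_leP => // k l; rewrite mxE; case: (_ && _);
    rewrite /= ?normr1 ?normr0.
have yx : x + t *: v - x = t *: v by rewrite addrAC subrr add0r.
have tv : `|t *: v| <= t by rewrite normrZ gtr0_norm// ler_piMr// ltW.
have [|Vy [HA HB]] := dH (x + t *: v).
  apply/mx_ballE; rewrite distrC yx; apply: le_lt_trans tv _.
  by rewrite ltr_pdivrMr// ltr_pMr// ltr1n.
have Hy : (V `&` half_space p) (x + t *: v).
  split=> // j j0; rewrite !mxE addr_ge0//; first exact: Hx.
  by rewrite mulr_ge0 ?ler0n// ltW.
move: {HA HB}(HA Hy) (HB Hy); rewrite yx /= => HA HB.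
have E : (t *: v) *m (A - B) = t *: (row i A - row i B).
  by rewrite -scalemxAl mulmxBr -!rowE.
have : `|t *: (row i A - row i B)| <= e * t.
  rewrite -E mulmxBr.
  have -> : (t *: v) *m A - (t *: v) *m B = (f (x + t *: v) - f x - (t *: v) *m B)
      - (f (x + t *: v) - f x - (t *: v) *m A).
    by rewrite opprB [RHS]addrC subrKA.
  apply: le_trans (ler_normB _ _) _.
  have := ler_wpM2l (ltW e2) tv; lra.
by rewrite normrZ gtr0_norm// mulrC ler_pM2r.
Qed.

Lemma has_diff_within_comp p q r (D : set 'rV[R]_p) (D' : set 'rV[R]_q)
    (f : 'rV[R]_p -> 'rV[R]_q) (g : 'rV[R]_q -> 'rV[R]_r) x
    (A : 'M[R]_(p, q)) (B : 'M[R]_(q, r)) :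
  (forall y, D y -> D' (f y)) ->
  has_diff_within D f x (mulmxr A) -> has_diff_within D' g (f x) (mulmxr B) ->
  has_diff_within D (g \o f) x (mulmxr (A *m B)).
Proof.
move=> DD' fA gB e e0.
have KA : 0 < p%:R * `|A| + 1 by rewrite ltr_wpDl// mulr_ge0.
have KB : 0 < q%:R * `|B| + 1 by rewrite ltr_wpDl// mulr_ge0.
set e1 := e / 2 / (q%:R * `|B| + 1); have e10 : 0 < e1 by rewrite !divr_gt0.
set e2 := e / 2 / (p%:R * `|A| + 1); have e20 : 0 < e2 by rewrite !divr_gt0.
have /nbhs_ballP[d /= d0 dH] := gB _ e20.
have fx1 := fA 1 ltr01.
have fx2 := fA e1 e10.
near=> y => Dy.
have f1 : `|f y - f x - (y - x) *m A| <= `|y - x|.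
  by rewrite -[leRHS]mul1r; move: Dy; near: y.
have f2 : `|f y - f x - (y - x) *m A| <= e1 * `|y - x|.
  by move: Dy; near: y.
have fyx : `|f y - f x| <= (p%:R * `|A| + 1) * `|y - x|.
  rewrite -(subrK ((y - x) *m A) (f y - f x)).
  apply: le_trans (ler_normD _ _) _; rewrite mulrDl mul1r addrC.
  by apply: lerD => //; exact: mx_norm_mulmx.
have yd : (p%:R * `|A| + 1) * `|y - x| < d.
  rewrite mulrC -ltr_pdivlMr// distrC; apply/mx_ballE.
  by near: y; apply: nbhsx_ballx; rewrite divr_gt0.
have g1 : `|g (f y) - g (f x) - (f y - f x) *m B| <= e2 * `|f y - f x|.
  apply: (dH (f y)); last exact: DD'.
  by apply/mx_ballE; rewrite distrC; exact: le_lt_trans yd.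
rewrite /= mulmxA.
rewrite -(subrK ((f y - f x) *m B) (g (f y) - g (f x))) -addrA -mulmxBl.
apply: le_trans (ler_normD _ _) _.
have := mx_norm_mulmx (f y - f x - (y - x) *m A) B.
have : e2 * `|f y - f x| <= e / 2 * `|y - x|.
  apply: le_trans (ler_wpM2l (ltW e20) fyx) _.
  by rewrite mulrA /e2 divfK ?gt_eqF.
have : (q%:R * `|B|) * `|f y - f x - (y - x) *m A| <= e / 2 * `|y - x|.
  apply: (@le_trans _ _ ((q%:R * `|B| + 1) * (e1 * `|y - x|))).
    by apply: ler_pM => //; rewrite ?mulr_ge0// lerDl.
  by rewrite mulrA /e1 [(_ + 1) * _]mulrC divfK ?gt_eqF.
lra.
Unshelve. all: by end_near. Qed.

End DifferentialWithin.

(** * Embeddings read in charts *)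

Section LocalRepresentatives.
Context {R : realType} {m : nat} {M N : manifold R m} (phi : M -> N).

Lemma cimg_cdom (c : chart R M m) x : is_chart c -> cimg c x -> cdom c (cinv c x).
Proof. by move=> [_ _ cK _ _] [p cp <-]; rewrite cK. Qed.

Lemma cimgK (c : chart R M m) x : is_chart c -> cimg c x -> cmap c (cinv c x) = x.
Proof. by move=> [_ _ cK _ _] [p cp <-]; rewrite cK. Qed.

Lemma loc_domP c c' x : is_chart c ->
  loc_dom phi c c' x <-> cimg c x /\ cdom c' (phi (cinv c x)).
Proof.
move=> Cc; have [_ _ cK _ _] := Cc; split.
  by move=> [p [cp /= cp'] <-]; split; [exists p|rewrite cK].
move=> [cx c'x]; exists (cinv c x); last exact: cimgK.
by split => //; exact: cimg_cdom.
Qed.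

Lemma loc_dom_open c c' : is_chart c -> is_chart c' -> continuous phi ->
  exists2 V : set 'rV[R]_m, open V & loc_dom phi c c' = V `&` half_space m.
Proof.
move=> Cc [oc' _ _ _ _] cphi; have [_ [W oW WE] _ _ ci] := Cc.
have oU : open (phi @^-1` cdom c') by apply: open_comp => // x _; exact: cphi.
have /continuousP/(_ _ oU)/open_subspaceP[V oV VE] := ci.
exists (V `&` W); first exact: openI.
apply/seteqP; split=> x.
  move=> /(loc_domP _ _ Cc)[cx c'x].
  have [] : (W `&` half_space m) x by rewrite -WE.
  have [] : (V `&` cimg c) x by rewrite VE; split.
  by [].
move=> [[Vx Wx] Hx]; have cx : cimg c x by rewrite WE; split.
apply/(loc_domP _ _ Cc); split=> //.
have : (V `&` cimg c) x by split.
by rewrite VE => -[].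
Qed.

Lemma loc_map_inj c c' x y : is_chart c -> is_chart c' -> injective phi ->
  loc_dom phi c c' x -> loc_dom phi c c' y ->
  loc_map phi c c' x = loc_map phi c c' y -> x = y.
Proof.
move=> Cc [_ _ c'K _ _] iphi /(loc_domP _ _ Cc)[cx c'x] /(loc_domP _ _ Cc)[cy c'y].
move=> /(congr1 (cinv c')); rewrite /loc_map /= !c'K// => /iphi xy.
by rewrite -(cimgK Cc cx) -(cimgK Cc cy) xy.
Qed.

Lemma cinv_loc_map c c' x : is_chart c -> is_chart c' ->
  loc_dom phi c c' x -> cinv c' (loc_map phi c c' x) = phi (cinv c x).
Proof.
by move=> Cc [_ _ c'K _ _] /(loc_domP _ _ Cc)[cx c'x]; rewrite /loc_map /= c'K.
Qed.

Lemma loc_jacP c c' x : is_smooth phi -> atlas c -> atlas c' ->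
  loc_dom phi c c' x ->
  has_diff_within (loc_dom phi c c') (loc_map phi c c') x
    (mulmxr (loc_jac phi c c' x)).
Proof.
move=> [_ sphi] ac ac' Dx.
have [A HA] := smooth_on_has_diff_within (sphi c c' ac ac') Dx.
exact: jac_withinP HA.
Qed.

Lemma loc_jac_unit c c' x : is_immersion phi -> atlas c -> atlas c' ->
  loc_dom phi c c' x -> loc_jac phi c c' x \in unitmx.
Proof.
move=> iphi ac ac' Dx; rewrite -row_free_unit; apply: inj_row_free => v vJ.
by apply: (iphi c c' x ac ac' Dx); rewrite vJ mul0mx.
Qed.

End LocalRepresentatives.

Section Composition.
Context {R : realType} {m k : nat}.

Section Charts.
Context {M N P : manifold R m} (phi : M -> N) (psi : N -> P).
Hypotheses (sphi : is_smooth phi) (spsi : is_smooth psi).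
Variables (c : chart R M m) (c' : chart R N m) (c2 : chart R P m).
Hypotheses (ac : atlas c) (ac' : atlas c') (ac2 : atlas c2).

Local Notation D := (loc_dom (psi \o phi) c c2).
Local Notation D1 := (loc_dom phi c c').
Local Notation f1 := (loc_map phi c c').
Local Notation f2 := (loc_map psi c' c2).

Let Cc : is_chart c := mfd_chart ac.
Let Cc' : is_chart c' := mfd_chart ac'.
Let Cc2 : is_chart c2 := mfd_chart ac2.

Lemma loc_dom_comp x : D x -> D1 x ->
  loc_dom psi c' c2 (f1 x) /\ loc_map (psi \o phi) c c2 x = f2 (f1 x).
Proof.
move=> Dx D1x; have E := cinv_loc_map Cc Cc' D1x.
have /(loc_domP _ _ _ Cc)[cx c2x] := Dx; have /(loc_domP _ _ _ Cc)[_ c'x] := D1x.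
split; last by rewrite {2}/loc_map /= E.
by apply/(loc_domP _ _ _ Cc'); split; [exists (phi (cinv c x))|rewrite E].
Qed.

(** The intermediate chart c' need not cover all of D, but it covers the part of D near x, which
    suffices for differentials. *)
Lemma near_loc_dom_comp x : D1 x -> \forall y \near x, D y -> D1 y.
Proof.
have [V oV VE] := loc_dom_open Cc Cc' sphi.1.
have [W oW WE] := @loc_dom_open _ _ _ _ (psi \o phi) c c2 Cc Cc2
  (fun x => continuous_comp (sphi.1 x) (spsi.1 _)).
rewrite VE WE => -[Vx Hx].
have : nbhs x V by exact: open_nbhs_nbhs.
by apply: filterS => y Vy [_ Hy].
Qed.

Lemma has_diff_within_loc_comp x : D x -> D1 x ->
  has_diff_within D (loc_map (psi \o phi) c c2) x
    (mulmxr (loc_jac phi c c' x *m loc_jac psi c' c2 (f1 x))).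
Proof.
move=> Dx D1x; have [D2x fx] := loc_dom_comp Dx D1x.
have H1 := loc_jacP sphi ac ac' D1x; have H2 := loc_jacP spsi ac' ac2 D2x.
apply: (@has_diff_within_near _ _ _ _ (D `&` D1) _ (f2 \o f1)) => //.
  apply: filterS (near_loc_dom_comp D1x) => y D1y Dy.
  by have [] := loc_dom_comp Dy (D1y Dy); do 2?split => //; exact: D1y.
apply: (has_diff_within_comp _ _ H2).
  by move=> y [Dy D1y]; have [] := loc_dom_comp Dy D1y.
apply: has_diff_within_near H1 => //.
by near=> y => -[].
Unshelve. all: by end_near.
Qed.

(** The product is a differential relative to D; by [has_diff_within_unique] it is the one chosen by
    [jac_within]. *)
Lemma loc_jac_comp x : D x -> D1 x ->
  loc_jac (psi \o phi) c c2 x = loc_jac phi c c' x *m loc_jac psi c' c2 (f1 x).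
Proof.
move=> Dx D1x; have H := has_diff_within_loc_comp Dx D1x.
have HJ := jac_withinP H.
have [W oW WE] := @loc_dom_open _ _ _ _ (psi \o phi) c c2 Cc Cc2
  (fun x => continuous_comp (sphi.1 x) (spsi.1 _)).
move: H HJ Dx; rewrite /loc_jac /jac_within WE => H HJ [Wx Hx].
exact: has_diff_within_unique oW Wx Hx HJ H.
Qed.

End Charts.

Lemma is_smooth_comp (M N P : manifold R m) (phi : M -> N) (psi : N -> P) :
  is_smooth phi -> is_smooth psi -> is_smooth (psi \o phi).
Proof.
move=> sphi spsi; split.
  by move=> x; apply: continuous_comp; [exact: sphi.1|exact: spsi.1].
move=> c c2 ac ac2 x Dx; have Cc := mfd_chart ac.
have /(loc_domP _ _ _ Cc)[cx c2x] := Dx.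
have [c' ac' c'x] := mfd_cover (phi (cinv c x)).
have D1x : loc_dom phi c c' x by apply/(loc_domP _ _ _ Cc).
have [V oV VE] := loc_dom_open Cc (mfd_chart ac') sphi.1.
have s12 : smooth_on (loc_dom (psi \o phi) c c2 `&` loc_dom phi c c')
    (loc_map psi c' c2 \o loc_map phi c c').
  apply: (@smooth_on_comp _ _ _ _ _ (loc_dom psi c' c2)).
  - by move=> y [Dy D1y]; have [] := loc_dom_comp ac ac' Dy D1y.
  - move=> y [Dy D1y]; have [W [g [oW Wy cg fg]]] := sphi.2 _ _ ac ac' _ D1y.
    by exists W, g; split=> // z Wz [_ D1z]; exact: fg.
  - exact: spsi.2.
have [W [g [oW Wx cg fg]]] := s12 x (conj Dx D1x).
exists (W `&` V), g; split.
- exact: openI.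
- by split=> //; move: D1x; rewrite VE => -[].
- by move=> n; apply: Cn_subset (cg n) => y [].
- move=> y [Wy Vy] Dy.
  have D1y : loc_dom phi c c' y.
    rewrite VE; split=> //.
    have /(loc_domP _ _ _ Cc)[[p cp <-] _] := Dy.
    have [_ [W' _ W'E] _ _ _] := Cc.
    have : (W' `&` half_space m) (cmap c p) by rewrite -W'E; exists p.
    by case.
  by have [_ ->] := loc_dom_comp ac ac' Dy D1y; exact: fg.
Qed.

Lemma is_morphism_comp (X Y Z : mfd_form R m k) (phi : X -> Y) (psi : Y -> Z) :
  is_morphism phi -> is_morphism psi -> is_morphism (psi \o phi).
Proof.
move=> [[iphi sphi mphi ophi] wphi] [[ipsi spsi mpsi opsi] wpsi].
have J c c2 x : atlas c -> atlas c2 -> loc_dom (psi \o phi) c c2 x ->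
    exists c' : chart R Y m, [/\ atlas c', loc_dom phi c c' x,
      loc_dom psi c' c2 (loc_map phi c c' x),
      loc_map (psi \o phi) c c2 x = loc_map psi c' c2 (loc_map phi c c' x)
    & loc_jac (psi \o phi) c c2 x =
      loc_jac phi c c' x *m loc_jac psi c' c2 (loc_map phi c c' x)].
  move=> ac ac2 Dx; have Cc := mfd_chart ac.
  have /(loc_domP _ _ _ Cc)[cx c2x] := Dx.
  have [c' ac' c'x] := mfd_cover (phi (cinv c x)); exists c'.
  have D1x : loc_dom phi c c' x by apply/(loc_domP _ _ _ Cc).
  have [D2x E] := loc_dom_comp ac ac' Dx D1x.
  by split=> //; exact: loc_jac_comp.
split; first split.
- exact: inj_comp.
- exact: is_smooth_comp.
- move=> c c2 x ac ac2 Dx u v; have [c' [ac' D1x D2x _ ->]] := J c c2 x ac ac2 Dx.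
  by rewrite !mulmxA => /(mpsi _ _ _ ac' ac2 D2x)/(mphi _ _ _ ac ac' D1x).
- move=> U /ophi[V oV ->]; have [V' oV' ->] := opsi V oV.
  by exists V'.
move=> c c2 x v ac ac2 Dx; have [c' [ac' D1x D2x -> ->]] := J c c2 x ac ac2 Dx.
rewrite -(wphi c c' x v ac ac' D1x) -(wpsi c' c2 _ _ ac' ac2 D2x).
by congr (mf_form Z c2 _ _); apply/funext => i; rewrite mulmxA.
Qed.

Lemma is_morphism_scale (X Y : mfd_form R m k) (r a : R) (phi : X -> Y) :
  @is_morphism _ _ _ (scale r X) Y phi ->
  @is_morphism _ _ _ (scale (a * r) X) (scale a Y) phi.
Proof.
move=> [ephi wphi]; split=> // c c' x v ac ac' Dx /=.
by rewrite (wphi c c' x v ac ac' Dx) /= mulrA.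
Qed.

End Composition.

(** * Monotonicity of the volume *)

(** For each set of a countable base that lies in some chart domain, one such chart is chosen; c0
    fills the remaining indices. *)
Lemma countable_atlas (R : realType) (m : nat) (Y : manifold R m)
    (c0 : chart R Y m) : atlas c0 ->
  exists c : nat -> chart R Y m,
    (forall j, atlas (c j)) /\ forall p, exists j, cdom (c j) p.
Proof.
move=> ac0; have [B /countable_injP[f finj] [_ Bb]] := mfd_second_countable Y.
pose P j : set (chart R Y m) :=
  [set c | atlas c /\ exists U, [/\ B U, f U = j & U `<=` cdom c]].
have /choice[cc ccP] j : exists c, atlas c /\ ((exists c', P j c') -> P j c).
  have [[c' Pc']|nP] := pselect (exists c', P j c'); last by exists c0.
  by exists c'; split=> //; exact: Pc'.1.
exists cc; split=> [j|p]; first exact: (ccP j).1.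
have [c ac cp] := mfd_cover p.
have [oc _ _ _ _] := mfd_chart ac.
have [|U [BU Up] Uc] := Bb p (cdom c); first exact: open_nbhs_nbhs.
have [|_ [U' [BU' UU' U'c]]] := (ccP (f U)).2.
  by exists c; split=> //; exists U.
by exists (f U); apply: U'c; rewrite (finj U' U) ?inE.
Qed.

Section Density.
Context {R : realType} {k n : nat}.
Local Notation m := (n * k)%N.
Implicit Types X Y : mfd_form R m k.

Lemma measurable_wedge_pow p (D : set (borel R p)) j
    (w : 'rV[R]_p -> ('I_j -> 'rV[R]_p) -> R) : measurable D ->
  (forall u, measurable_fun D (fun x : borel R p => w x u)) ->
  forall l v, measurable_fun D (fun x : borel R p => wedge_pow (w x) l v).
Proof.
move=> mD mw; elim=> [|l IH] v /=; first exact: measurable_cst.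
rewrite /wedge; apply: measurable_funM; first exact: measurable_cst.
apply: measurable_sum => s; apply: measurable_funM; last exact: IH.
by apply: measurable_funM; [exact: measurable_cst|exact: mw].
Qed.

Lemma measurable_cimg (M : manifold R m) (c : chart R M m) : atlas c ->
  measurable (cimg c : set (borel R m)).
Proof.
move=> /mfd_chart[_ [W oW ->] _ _ _]; apply: measurableI.
  exact: open_borel.
by apply: closed_borel; exact: closed_half_space.
Qed.

Lemma measurable_vol_density X (c : chart R X m) : atlas c ->
  measurable_fun (cimg c : set (borel R m)) (vol_density c : borel R m -> R).
Proof.
move=> ac; have mc := measurable_cimg ac.
apply: measurableT_comp; first exact: normr_measurable.
apply: measurable_wedge_pow => // u.
apply: within_measurable_fun => //; apply: smooth_on_continuous.
exact: form_smooth.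
Qed.

Local Open Scope ereal_scope.

Lemma vol_density_ge0 X (c : chart R X m) x : (0 <= vol_density c x)%R.
Proof. exact: normr_ge0. Qed.

Lemma measurable_vol_densityE X (c : chart R X m) (B : set (borel R m)) :
  atlas c -> B `<=` cimg c ->
  measurable_fun B (fun x : borel R m => (vol_density c x)%:E).
Proof.
move=> ac Bc; apply/measurable_EFinP.
exact: measurable_funS (measurable_cimg ac) Bc (measurable_vol_density ac).
Qed.

Lemma integral_rV_vol_density X (c : chart R X m) (B : set (borel R m)) :
  atlas c -> measurable B -> B `<=` cimg c ->
  integral_rV (fun x => (\1_B x * vol_density c x)%:E) =
  \int[lebesgue_rV m]_(x in B) (vol_density c x)%:E.
Proof.
move=> ac mB Bc.
have E : (fun x => (\1_B x * vol_density c x)%:E) = (EFin \o vol_density c) \_ B.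
  apply/funext => x; rewrite patchE indicE /=.
  by case: (x \in B) => /=; rewrite ?mul1r ?mul0r.
rewrite integral_mkcond E integral_rVE//.
  exact: ((measurable_restrictT _ mB).1 (measurable_vol_densityE ac Bc)).
by move=> x; apply: erestrict_ge0 => y _; rewrite /= lee_fin; exact: vol_density_ge0.
Qed.

(** Arbitrary finite index types are allowed because pairs of indices occur in [vol_morphism_le]. *)
Lemma vol_ge_sum X (I : finType) (c : I -> chart R X m)
    (B : I -> set (borel R m)) :
  (forall i, atlas (c i)) -> (forall i, measurable (B i) /\ B i `<=` cimg (c i)) ->
  trivIset [set: I] (fun i => cinv (c i) @` B i) ->
  (n`!%:R^-1)%:E *
    (\sum_i \int[lebesgue_rV m]_(x in B i) (vol_density (c i) x)%:E) <= vol X.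
Proof.
move=> ac mB tB; rewrite /vol lee_wpmul2l ?lee_fin ?invr_ge0//.
apply: ereal_sup_ubound; exists #|I|, (c \o enum_val), (B \o enum_val); split=> /=.
- by move=> i.
- by move=> i; exact: mB.
- by move=> i j _ _ H; apply: enum_val_inj; exact: tB H.
rewrite (reindex (enum_val : 'I_#|I| -> I)); last exact: onW_bij (@enum_val_bij I).
apply: eq_bigr => i _.
by have [mBi Bi] := mB (enum_val i); rewrite integral_rV_vol_density.
Qed.

Lemma vol_ge0 X : 0 <= vol X.
Proof.
have := @vol_ge_sum X void (of_void _) (of_void _).
by rewrite big_pred0 ?mule0 => [|[]]; apply=> -[].
Qed.

Section Monotone.
Variables (X Y : mfd_form R m k) (r : R) (phi : X -> Y).
Hypothesis r0 : (0 < r)%R.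
Hypothesis phiM : @is_morphism _ _ _ (scale r X) Y phi.

Lemma vol_density_loc_map (c : chart R X m) (c' : chart R Y m) x :
  atlas c -> atlas c' -> loc_dom phi c c' x ->
  (r ^+ n * vol_density c x =
   `|\det (loc_jac phi c c' x)| * vol_density c' (loc_map phi c c' x))%R.
Proof.
move=> ac ac' Dx; have [_ wphi] := phiM.
rewrite /vol_density -(gtr0_norm (exprn_gt0 n r0)) -!normrM -wedge_powZ.
congr (`|_|)%R; apply: wedge_pow_det; first exact: form_multilinear.
by move=> v; exact: wphi.
Qed.

Lemma integral_loc_map_le (c : chart R X m) (c' : chart R Y m)
    (B : set (borel R m)) :
  atlas c -> atlas c' -> measurable B -> B `<=` loc_dom phi c c' ->
  [/\ measurable (loc_map phi c c' @` B : set (borel R m)),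
    loc_map phi c c' @` B `<=` cimg c' &
  (r ^+ n)%:E * \int[lebesgue_rV m]_(x in B) (vol_density c x)%:E <=
  \int[lebesgue_rV m]_(y in loc_map phi c c' @` B) (vol_density c' y)%:E].
Proof.
move=> ac ac' mB BD; have [[iphi sphi mphi _] _] := phiM.
have Cc := mfd_chart ac; have Cc' := mfd_chart ac'.
have [V oV DE] := loc_dom_open Cc Cc' sphi.1.
have sD : sigma_compact (loc_dom phi c c').
  by rewrite DE; exact: sigma_compact_half_space.
have cf := smooth_on_continuous (sphi.2 _ _ ac ac').
have finj x y := @loc_map_inj _ _ _ _ phi c c' x y Cc Cc' iphi.
have Dc : loc_dom phi c c' `<=` cimg c by move=> x /(loc_domP _ _ _ Cc)[].
have fc' : loc_map phi c c' @` loc_dom phi c c' `<=` cimg c'.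
  move=> _ [x /(loc_domP _ _ _ Cc)[_ c'x] <-].
  by exists (phi (cinv c x)).
have mD := sigma_compact_borel sD.
have rn0 : (0 <= r ^+ n)%R by rewrite exprn_ge0// ltW.
have mh : measurable_fun (loc_dom phi c c' : set (borel R m)) (vol_density c).
  exact: measurable_funS (measurable_cimg ac) Dc (measurable_vol_density ac).
split.
- exact: (injective_image_borel sD cf finj mB BD).
- by apply: subset_trans fc'; exact: image_subset.
rewrite -ge0_integralZl_EFin//; last 2 first.
- by move=> x _; rewrite lee_fin vol_density_ge0.
- exact: (measurable_vol_densityE ac (subset_trans BD Dc)).
have K := @change_of_variables_le R m _ _ (fun x => r ^+ n * vol_density c x)%R
  (vol_density c') B sD cf finj.
apply: K.
- by apply: measurable_funM; [exact: measurable_cst|exact: mh].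
- exact: measurable_funS (measurable_cimg ac') fc' (measurable_vol_density ac').
- by move=> x; rewrite mulr_ge0// vol_density_ge0.
- exact: vol_density_ge0.
- move=> x Dx; exists (loc_jac phi c c' x); split.
  + exact: loc_jac_unit.
  + exact: loc_jacP.
  + by rewrite (vol_density_loc_map ac ac' Dx).
- exact: mB.
- exact: BD.
Qed.

Theorem vol_morphism_le : (r ^+ n)%:E * vol X <= vol Y.
Proof.
have [[iphi sphi _ _] _] := phiM.
have rn0 : (0 < r ^+ n)%R by rewrite exprn_gt0.
have nf : (0 < n`!%:R :> R)%R by rewrite ltr0n fact_gt0.
rewrite {1}/vol muleCA lee_pdivrMl// -lee_pdivlMl//.
apply: ge_ereal_sup => _ [N [c [B [ac mB tB ->]]]].
rewrite lee_pdivlMl//.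
(* Without a chart Y is empty, and then so are all B i. *)
have [[c0 ac0]|noc] := pselect (exists c0 : chart R Y m, atlas c0); last first.
  rewrite big1 ?mule0; first by rewrite mule_ge0// vol_ge0.
  move=> i _; have [mBi Bi] := mB i.
  rewrite integral_rV_vol_density// (_ : B i = set0) ?integral_set0//.
  apply/seteqP; split=> // x _; apply: noc.
  by have [c0 ac0 _] := mfd_cover (phi (cinv (c i) x)); exists c0.
have [cc [acc ccY]] := countable_atlas ac0.
(* Each B i is cut further, into countably many disjoint parts that phi sends into a single chart of
   Y. *)
pose E i := seqDU (fun j => B i `&` loc_dom phi (c i) (cc j)).
have ED i j : E i j `<=` loc_dom phi (c i) (cc j) by move=> x [[]].
have EB i j : E i j `<=` B i by move=> x [[]].
have mLD i j : measurable (loc_dom phi (c i) (cc j) : set (borel R m)).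
  have [V oV ->] := loc_dom_open (mfd_chart (ac i)) (mfd_chart (acc j)) sphi.1.
  apply: measurableI; first exact: open_borel.
  by apply: closed_borel; exact: closed_half_space.
have mE i j : measurable (E i j : set (borel R m)).
  apply: measurableD; first by apply: measurableI => //; exact: (mB i).1.
  apply: bigsetU_measurable => l _.
  by apply: measurableI => //; exact: (mB i).1.
have BE i : B i = \bigcup_j E i j.
  rewrite -seqDU_bigcup_eq -setI_bigcupr; apply/esym/setIidPl => x Bx.
  have Cc := mfd_chart (ac i); have cx := (mB i).2 _ Bx.
  have [j jx] := ccY (phi (cinv (c i) x)); exists j => //.
  by apply/(loc_domP _ _ _ Cc).
pose F i j := loc_map phi (c i) (cc j) @` E i j.
have H i j := integral_loc_map_le (ac i) (acc j) (mE i j) (@ED i j).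
pose I i j := \int[lebesgue_rV m]_(y in F i j) (vol_density (cc j) y)%:E.
have I0 i j : 0 <= I i j by apply: integral_ge0 => x _; rewrite lee_fin vol_density_ge0.
have FE i j : cinv (cc j) @` F i j = (phi \o cinv (c i)) @` E i j.
  rewrite image_comp; apply: eq_imagel => x /ED Dx.
  exact: cinv_loc_map (mfd_chart (ac i)) (mfd_chart (acc j)) Dx.
apply: (@le_trans _ _ (\sum_(j <oo) \sum_(i < N) I i j)).
  rewrite nneseries_sum// ge0_sume_distrr; last first.
    move=> i _; have [mBi Bi] := mB i; rewrite integral_rV_vol_density//.
    by apply: integral_ge0 => x _; rewrite lee_fin vol_density_ge0.
  apply: lee_sum => i _; have [mBi Bi] := mB i.
  rewrite integral_rV_vol_density// [in X in X <= _](BE i) ge0_integral_bigcup//.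
  - rewrite -nneseriesZl; last by move=> j _; apply: integral_ge0 => x _;
      rewrite lee_fin vol_density_ge0.
    apply: lee_nneseries => [j _ _|j _]; last by have [_ _] := H i j.
    apply: mule_ge0; first by rewrite lee_fin ltW.
    by apply: integral_ge0 => x _; rewrite lee_fin vol_density_ge0.
  - by rewrite -BE; exact: (measurable_vol_densityE (ac i) Bi).
  - by move=> x _; rewrite lee_fin vol_density_ge0.
  - exact: trivIset_seqDU.
(* The volume of Y only bounds finite families, so the series over the charts is estimated through
   its partial sums. *)
apply: lime_le.
  by apply: is_cvg_nneseries => j _ _; exact: sume_ge0.
apply: nearW => J; rewrite -lee_pdivrMl//.
rewrite big_mkord pair_bigA /=.
apply: (@vol_ge_sum Y ('I_J * 'I_N)%type (fun ji => cc ji.1) (fun ji => F ji.2 ji.1)).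
- by move=> [j i] /=.
- by move=> [j i] /=; have [] := H i j.
move=> [j i] [j' i'] _ _ /=; rewrite !FE => -[_ [[x Ex <-] [y Ey /= /iphi yx]]].
have ii : i = i'.
  apply: tB => //; exists (cinv (c i) x); split.
    by exists x => //; exact: EB Ex.
  by exists y => //; exact: EB Ey.
move: Ey yx; rewrite -ii => Ey yx; congr pair.
apply: val_inj; apply: (@trivIset_seqDU _
  (fun j => B i `&` loc_dom phi (c i) (cc j))) => //.
exists x; split => //.
have Cc := mfd_chart (ac i).
rewrite -(cimgK Cc ((mB i).2 _ (EB _ _ _ Ex))) -yx cimgK//.
exact: (mB i).2 _ (EB _ _ _ Ey).
Qed.

End Monotone.
End Density.

(** * Extremal capacities *)

Section Capacities.
Context {R : realType} {m k : nat} {C : small_weak_form_category R m k}.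
Implicit Types u : ob C -> \bar R.
Local Open Scope ereal_scope.

Lemma Cap_scale u (t : R) : (0 < t)%R -> Cap C u ->
  Cap C (fun X => t%:E * u X).
Proof.
move=> t0 [u0 mu hu]; split=> [X|X Y h|X aX a a0 E].
- by rewrite mule_ge0// lee_fin ltW.
- by rewrite lee_pmul2l// mu.
- by rewrite (hu _ _ _ a0 E) muleCA.
Qed.

(** The empty family gives the capacity +oo; for the supremum it would give -oo, which is why
    [Cap_sup] asks for a nonempty one. *)
Lemma Cap_inf (P : set (ob C -> \bar R)) : P `<=` Cap C ->
  Cap C (fun X => ereal_inf [set u X | u in P]).
Proof.
move=> PC; split=> [X|X Y h|X aX a a0 E].
- by apply: le_ereal_inf_tmp => _ [u /PC[u0 _ _] <-].
- apply: le_ereal_inf_tmp => _ [u Pu <-]; have [_ mu _] := PC _ Pu.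
  by apply: le_trans (mu _ _ h); apply: ereal_inf_lbound; exists u.
- rewrite -ereal_inf_pZl// image_comp; congr ereal_inf;
    apply: eq_imagel => u /PC[_ _ hu].
  exact: hu E.
Qed.

Lemma Cap_sup (P : set (ob C -> \bar R)) : P `<=` Cap C -> P !=set0 ->
  Cap C (fun X => ereal_sup [set u X | u in P]).
Proof.
move=> PC [u1 Pu1]; split=> [X|X Y h|X aX a a0 E].
- have [u10 _ _] := PC _ Pu1; apply: le_trans (u10 X) _.
  by apply: ereal_sup_ubound; exists u1.
- apply: ge_ereal_sup => _ [u Pu <-]; have [_ mu _] := PC _ Pu.
  by apply: le_trans (mu _ _ h) _; apply: ereal_sup_ubound; exists u.
- rewrite -ereal_sup_pZl// image_comp; congr ereal_sup;
    apply: eq_imagel => u /PC[_ _ hu].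
  exact: hu E.
Qed.

Lemma Cap0 : Cap C (fun=> 0).
Proof. by split=> // X aX a _ _; rewrite mule0. Qed.

Lemma domain_capacity_ge0 (X Y : mfd_form R m k) : 0 <= domain_capacity X Y.
Proof. by apply: ereal_sup_ubound; exists 0%R => //; left. Qed.

Lemma domain_capacity_scale (X Y : mfd_form R m k) (a : R) : (0 < a)%R ->
  domain_capacity X (scale a Y) = a%:E * domain_capacity X Y.
Proof.
move=> a0; rewrite /domain_capacity -ereal_sup_pZl//; congr ereal_sup.
apply/seteqP; split=> [_ [r rP <-]|_ [_ [r rP <-] <-]]; last first.
  exists (a * r)%R => //; case: rP => [->|[r0 [phi phiM]]].
    by left; rewrite mulr0.
  by right; split; [rewrite mulr_gt0|exists phi; exact: is_morphism_scale].
exists (r / a)%:E; last by rewrite -EFinM mulrCA divff ?mulr1// gt_eqF.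
exists (r / a)%R => //; case: rP => [->|[r0 [phi [ephi wphi]]]].
  by left; rewrite mul0r.
right; split; [by rewrite divr_gt0|exists phi; split=> // c c' x v ac ac' Dx].
have /= := wphi c c' x v ac ac' Dx => E.
by apply: (mulfI (lt0r_neq0 a0)); rewrite E mulrA mulrCA divff ?mulr1 ?gt_eqF.
Qed.

Lemma domain_capacity_le (X Y Z : mfd_form R m k) (phi : Y -> Z) : is_morphism phi ->
  domain_capacity X Y <= domain_capacity X Z.
Proof.
move=> phiM; apply: le_ereal_sup => _ [r rP <-]; exists r => //.
case: rP => [->|[r0 [psi psiM]]]; [by left|right; split=> //].
by exists (phi \o psi); exact: is_morphism_comp psiM phiM.
Qed.

Lemma Cap_domain_capacity (X : mfd_form R m k) : Cap C
  (fun Y => domain_capacity X (C Y)).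
Proof.
split=> [Y|Y Z [phi /hom_morphism phiM]|Y aY a a0 ->].
- exact: domain_capacity_ge0.
- exact: domain_capacity_le phiM.
- exact: domain_capacity_scale.
Qed.

End Capacities.

Lemma domain_capacity_lt1 (R : realType) (n k : nat)
    (X Y : mfd_form R (n * k) k) : (0 < n)%N ->
  (vol X < +oo)%E -> (vol Y < vol X)%E -> (domain_capacity X Y < 1)%E.
Proof.
move=> n0 Xoo YX; have /fineK vX : vol X \is a fin_num.
  by rewrite ge0_fin_numE ?vol_ge0.
have /fineK vY : vol Y \is a fin_num.
  by rewrite ge0_fin_numE ?vol_ge0// (lt_trans YX).
have w0 : 0 <= fine (vol Y) by rewrite fine_ge0 ?vol_ge0.
have vol_le r (phi : scale r X -> Y) : 0 < r -> is_morphism phi ->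
    r ^+ n * fine (vol X) <= fine (vol Y).
  by move=> r0 /(vol_morphism_le r0); rewrite -vX -vY -EFinM lee_fin.
move: YX; rewrite -vX -vY lte_fin => wv.
set v := fine (vol X) in wv vol_le *; set w := fine (vol Y) in wv w0 vol_le *.
have v0 : 0 < v by exact: le_lt_trans wv.
have nR : 1 <= n%:R :> R by rewrite ler1n.
(* A uniform bound below 1 is needed, as a supremum is taken. By Bernoulli (1 - t)^n >= 1 - n t = w
   / v, so every admissible r is at most 1 - t, without taking an n-th root. *)
pose t := (v - w) / (n%:R * v).
have t0 : 0 < t by rewrite divr_gt0 ?subr_gt0 ?mulr_gt0 ?ltr0n.
have t1 : t <= 1 by rewrite ler_pdivrMr ?mulr_gt0 ?ltr0n//; nra.
apply: (@le_lt_trans _ _ (1 - t)%:E); last by rewrite lte_fin gtrBl.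
apply: ge_ereal_sup => _ [r rP <-]; rewrite lee_fin.
case: rP => [->|[r0 [phi phiM]]]; first by rewrite subr_ge0.
rewrite -(ler_pXn2r n0) ?nnegrE ?subr_ge0 ?(ltW r0)//.
apply: le_trans (bernoulli n _); last by rewrite ltW.
have -> : 1 - n%:R * t = w / v.
  by rewrite /t; field; rewrite (gt_eqF v0) pnatr_eq0 -lt0n n0.
by rewrite ler_pdivlMr//; exact: vol_le phiM.
Qed.

(** * The gap between the extremal capacities *)

Section Kink.
Context {R : realType} {m k : nat} {C : small_weak_form_category R m k}.
Implicit Types (u : ob C -> \bar R) (X Y : ob C).
Local Open Scope ereal_scope.

(** This is d_X, and [cap_max X] is e_X; both are evaluated at Y. *)
Definition cap_min X Y : \bar R :=
  ereal_inf [set u Y | u in [set u | Cap C u /\ 1 <= u X]].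

Definition cap_max X Y : \bar R :=
  ereal_sup [set u Y | u in [set u | Cap C u /\ u X <= 1]].

Lemma Cap_min X : Cap C (cap_min X).
Proof. by apply: Cap_inf => u []. Qed.

Lemma Cap_max X : Cap C (cap_max X).
Proof.
apply: Cap_sup => [u []//|]; exists (fun=> 0); split; first exact: Cap0.
by rewrite lee01.
Qed.

Lemma cap_min_le u X Y : Cap C u -> 1 <= u X -> cap_min X Y <= u Y.
Proof. by move=> Cu uX; apply: ereal_inf_lbound; exists u. Qed.

Lemma cap_max_ge u X Y : Cap C u -> u X <= 1 -> u Y <= cap_max X Y.
Proof. by move=> Cu uX; apply: ereal_sup_ubound; exists u. Qed.

Lemma cap_min_self u X : Cap C u -> u X = 1 -> cap_min X X = 1.
Proof.
move=> Cu uX; apply/eqP; rewrite eq_le -{1}uX cap_min_le ?uX//=.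
by apply: le_ereal_inf_tmp => _ [v [_ vX] <-].
Qed.

Lemma cap_max_self u X : Cap C u -> u X = 1 -> cap_max X X = 1.
Proof.
move=> Cu uX; apply/eqP; rewrite eq_le -{2}uX cap_max_ge ?uX// andbT.
by apply: ge_ereal_sup => _ [v [_ vX] <-].
Qed.

Definition cap_gap X Y : R := (contract (cap_max X Y) - contract (cap_min X Y))%R.

Lemma contract1 : contract (1 : \bar R) = (2^-1)%R.
Proof. by rewrite /= normr1 mul1r. Qed.

(** Since [contract] x = x / (1 + x), both sides contain the factor |r - 1| for finite r, and the
    rest is x (1 + r) <= (1 + x r)(1 + x). *)
Lemma contract_dist_ratio (x r : \bar R) : (x \is a fin_num) -> 0 < x -> 0 <= r ->
  (`|contract (x * r) - contract x| <= 2 * `|contract r - contract 1|)%R.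
Proof.
case: x => [x| |]// _; rewrite lte_fin => x0; case: r => [r| |]// r0; last first.
  rewrite gt0_muley ?lte_fin// contract1 /= (gtr0_norm x0).
  have -> : (1 - x / (1 + x) = (1 + x)^-1)%R.
    by field; rewrite gt_eqF ?addr_gt0.
  rewrite (_ : 1 - 2^-1 = 2^-1)%R; last by field.
  rewrite !gtr0_norm ?invr_gt0 ?addr_gt0// divff//.
  by rewrite invf_le1 ?addr_gt0// lerDl ltW.
rewrite lee_fin in r0; rewrite contract1 /= (gtr0_norm x0) (ger0_norm r0).
rewrite (ger0_norm (mulr_ge0 (ltW x0) r0)).
have p1 : (0 < 1 + x * r)%R by rewrite ltr_wpDr// mulr_ge0// ltW.
have p2 : (0 < 1 + r)%R by rewrite ltr_wpDr.
have p3 : (0 < 1 + x)%R by rewrite addr_gt0.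
have -> : (x * r / (1 + x * r) - x / (1 + x) =
    (r - 1) * (x / ((1 + x * r) * (1 + x))))%R.
  by field; rewrite !gt_eqF.
have -> : (r / (1 + r) - 2^-1 = (r - 1) * (2 * (1 + r))^-1)%R.
  by field; rewrite !gt_eqF.
rewrite (normrM (r - 1)%R (_ / _)%R) (normrM (r - 1)%R (_^-1)%R) mulrCA ler_wpM2l//.
rewrite !gtr0_norm ?divr_gt0 ?invr_gt0 ?mulr_gt0//.
rewrite (_ : 2 * (2 * (1 + r))^-1 = (1 + r)^-1)%R; last first.
  by field; rewrite !gt_eqF.
rewrite ler_pdivrMr ?mulr_gt0// mulrC ler_pdivlMr//.
by nra.
Qed.

(* Unless u X is 0 or oo, rescaling u to the value 1 at X puts its value at Y between
   cap_min X Y and cap_max X Y. *)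
Lemma Cap_dist_le_gap u X Y : Cap C u ->
  cap_min X Y <= 1 <= cap_max X Y ->
  (`|contract (u Y) - contract (u X)| <= 2 * cap_gap X Y)%R.
Proof.
move=> Cu /andP[d1 e1]; have [u0 _ _] := Cu.
have [d0 _ _] := Cap_min X; have {}d0 := d0 Y.
have c0e (z : \bar R) : 0 <= z -> (0 <= contract z <= 1)%R.
  by move=> z0; rewrite -contract0 (le_contract _ _) z0
    (le_trans (ler_norm _))// contract_le1.
have cd : (contract (cap_min X Y) <= 2^-1)%R by rewrite -contract1 (le_contract _ _).
have ce : (2^-1 <= contract (cap_max X Y))%R by rewrite -contract1 (le_contract _ _).
have /andP[u00 u01] := c0e _ (u0 Y); have /andP[uX0 uX1] := c0e _ (u0 X).
rewrite /cap_gap.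
have uty t : (0 < t)%R -> Cap C (fun X => t%:E * u X) by move=> t0; exact: Cap_scale.
(* If u X = 0 < u Y, all positive multiples of u compete in [cap_max], which is thus +oo; the gap is
   then at least 1/2, while contracted values differ by at most 1. If u X = +oo, [cap_min] is 0 for
   the dual reason. *)
have [ux0|ux0] := eqVneq (u X) 0.
  rewrite ux0 contract0 subr0; have [->|uy0] := eqVneq (u Y) 0.
    by rewrite contract0 normr0; lra.
  have -> : cap_max X Y = +oo.
    apply/eqyP => A A0; case E : (u Y) (u0 Y) uy0 => [y| |] // y0 yn0; last first.
      apply: (@le_trans _ _ +oo); first exact: leey.
      by rewrite -E; apply: cap_max_ge => //; rewrite ux0 lee01.
    have yp : (0 < y)%R by rewrite -lte_fin lt_def yn0.
    have Ay : (0 < A / y)%R by rewrite divr_gt0.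
    have := cap_max_ge (X := X) Y (uty _ Ay); rewrite /= ux0 mule0 lee01 E => /(_ isT).
    by rewrite -EFinM divfK// gt_eqF.
  by rewrite ger0_norm//=; lra.
have [uxoo|uxoo] := eqVneq (u X) +oo.
  rewrite uxoo; have [->|uyoo] := eqVneq (u Y) +oo.
    by rewrite subrr normr0; lra.
  have -> : cap_min X Y = 0.
    apply/eqP; rewrite eq_le d0 andbT; apply/lee_addgt0Pr => e e0; rewrite add0e.
    case E : (u Y) (u0 Y) uyoo => [y| |] // y0 _; rewrite lee_fin in y0.
    have yp : (0 < y + 1)%R by rewrite ltr_wpDl.
    have ey : (0 < e / (y + 1))%R by rewrite divr_gt0.
    have := cap_min_le (X := X) Y (uty _ ey); rewrite /= uxoo gt0_muley ?lte_fin//.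
    rewrite E => /(_ (leey _)) /le_trans; apply.
    rewrite -EFinM lee_fin mulrAC ler_pdivrMr// ler_pM2l// lerDl//.
  rewrite contract0 /= ler0_norm; lra.
have uxf : u X \is a fin_num by rewrite ge0_fin_numE// lt_neqAle uxoo leey.
have uxp : 0 < u X by rewrite lt_def ux0 u0.
move: uxf uxp; case E : (u X) => [x| |] // xf xp; have {}xp : (0 < x)%R by [].
have xV : (0 < x^-1)%R by rewrite invr_gt0.
pose r := x^-1%:E * u Y.
have r0 : 0 <= r by rewrite mule_ge0// lee_fin ltW.
have -> : u Y = x%:E * r by rewrite /r muleA -EFinM divff ?mul1e// gt_eqF.
have ux1 : x^-1%:E * u X = 1 by rewrite E -EFinM mulVf// gt_eqF.
have := cap_max_ge (X := X) Y (uty _ xV); rewrite /= ux1 lexx => /(_ isT) re.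
have := cap_min_le (X := X) Y (uty _ xV); rewrite /= ux1 lexx => /(_ isT) dr.
have {}re : (contract r <= contract (cap_max X Y))%R by rewrite (le_contract _ _).
have {}dr : (contract (cap_min X Y) <= contract r)%R by rewrite (le_contract _ _).
apply: le_trans (contract_dist_ratio xf xp r0) _.
rewrite ler_pM2l// contract1 ler_norml; apply/andP; split; lra.
Qed.

End Kink.

(** * Countability *)

(** The differential of f at the values of the generators at s, with coefficients replaced by
    rationals; each of the two errors takes half of e z. K consists of indices and rationals, so it
    ranges over a countable set. The bound z, later twice the gap, is kept apart from d because it
    is not assumed to be small. *)
Lemma fin_diff_linear (R : realType) (S : Type) (G F : set (S -> \bar R))
    (gg : nat -> S -> \bar R) (u : S -> \bar R) (s : S) (e : R) :
  fin_diff_generates G F -> (forall g x, G g -> 0 <= g x)%E ->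
  (forall g, G g -> exists i, gg i = g) -> F u -> 0 < e ->
  exists (K : seq (nat * rat)) (d : R), [/\ 0 < d,
    forall t, t \in K -> G (gg t.1) &
    forall b z, 0 <= z ->
      (forall t, t \in K ->
        `|contract (gg t.1 b) - contract (gg t.1 s)| < d /\
        `|contract (gg t.1 b) - contract (gg t.1 s)| <= z) ->
      `|contract (u b) - contract (u s) -
        \sum_(t <- K) ratr t.2 * (contract (gg t.1 b) - contract (gg t.1 s))| <=
      e * z].
Proof.
move=> GF G0 Gg Fu e0; have [N [g [f [_ Gi _ df uE]]]] := GF _ Fu.
have /choice[i iE] j : exists i, gg i = g j by exact: Gg.
pose y b : 'rV[R]_N := \row_j contract (g j b).
have cy b : cube N (y b).
  move=> j; rewrite mxE -[X in X <= _]contract0 le_contract G0//=.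
  by rewrite (le_trans (ler_norm _))// contract_le1.
have [L /(_ (e / 2))] := df _ (cy s).
rewrite divr_gt0// => /(_ isT)/nbhs_ballP[d /= d0 H].
have fy b : contract (f (fun j => expand (y b 0 j))) = contract (u b).
  by rewrite uE; congr (contract (f _)); apply/funext => j; rewrite mxE contractK.
pose c := e / 2 / N.+1%:R.
have c0 : 0 < c by rewrite !divr_gt0.
have /choice[l lE] j : exists q : rat, `|ratr q - L (delta_mx 0 j)| <= c.
  have [|q] := @rat_in_itvoo R (L (delta_mx 0 j)) (L (delta_mx 0 j) + c).
    by rewrite ltrDl.
  rewrite in_itv /= => /andP[q1 q2]; exists q.
  by rewrite ger0_norm ?subr_ge0 ?ltW// ltrBlDl.
exists [seq (i j, l j) | j <- enum 'I_N], d; split=> // [t /mapP[j _ ->]/=|b z z0 bz].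
  by rewrite iE.
have ybs j : (y b - y s) 0 j = contract (gg (i j) b) - contract (gg (i j) s).
  by rewrite !mxE iE.
have {}bz j : `|(y b - y s) 0 j| < d /\ `|(y b - y s) 0 j| <= z.
  by rewrite ybs; apply: (bz (i j, l j)); rewrite map_f ?mem_enum.
rewrite big_map big_enum /=.
under eq_bigr do rewrite -ybs.
set D := y b - y s in bz ybs *.
have LD : L D = \sum_j L (delta_mx 0 j) * D 0 j.
  rewrite [in LHS](row_sum_delta D) linear_sum; apply: eq_bigr => j _.
  by rewrite linearZ /= mulrC.
have Dz : `|D| <= z by apply/mx_norm_leP => // a j; rewrite ord1; exact: (bz j).2.
have Db : ball (y s) d (y b).
  by apply/mx_ballE; rewrite distrC; apply/mx_norm_ltP => // a j; rewrite ord1;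
    exact: (bz j).1.
have := H _ Db (cy b); rewrite !fy -/D => H1.
have H2 : `|\sum_j ratr (l j) * D 0 j - L D| <= N%:R * (c * z).
  rewrite LD -sumrB (le_trans (ler_norm_sum _ _ _))//.
  rewrite (le_trans (ler_sum _ (_ : forall j, _ -> _ <= c * z)))//.
    by move=> j _; rewrite -mulrBl normrM ler_pM// (bz j).2.
  by rewrite sumr_const card_ord mulr_natl.
have H3 : N%:R * (c * z) <= e / 2 * z.
  rewrite mulrA ler_wpM2r// /c mulrCA ler_piMr// ?divr_ge0 ?ltW//.
  by rewrite ltr_pdivrMr// mul1r ltr_nat.
have H4 : e / 2 * `|D| <= e / 2 * z by rewrite ler_wpM2l// divr_ge0// ltW.
rewrite -(subrKA (L D)) (le_trans (ler_normD _ _))//.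
rewrite [X in _ + X <= _]distrC (_ : e * z = e / 2 * z + e / 2 * z); last by field.
by rewrite lerD// (le_trans H1, le_trans H2).
Qed.

(* K, d and rational approximations of the y i s determine s: if s and s' had the same
   data, a sum and its opposite would both be positive. *)
Lemma countable_separated (R : realType) (T : Type) (A : set T)
    (y : nat -> T -> R) :
  (forall s, A s -> exists (K : seq (nat * rat)) (d : R), 0 < d /\
    forall b, A b -> b <> s -> (forall t, t \in K -> `|y t.1 b - y t.1 s| < d) ->
      0 < \sum_(t <- K) ratr t.2 * (y t.1 b - y t.1 s)) ->
  countable A.
Proof.
move=> HA.
pose P s (z : seq (nat * rat * rat) * rat) :=
  (forall t, t \in z.1 -> `|y t.1.1 s - ratr t.2| < ratr z.2 / 2) /\
  forall b, A b -> b <> s ->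
    (forall t, t \in z.1 -> `|y t.1.1 b - y t.1.1 s| < ratr z.2) ->
    0 < \sum_(t <- z.1) ratr t.1.2 * (y t.1.1 b - y t.1.1 s).
have /choice[F FP] s : exists z, A s -> P s z.
  have [As|nAs] := pselect (A s); last by exists ([::], 0).
  have [K [d [d0 Kd]]] := HA _ As.
  have [r] := rat_in_itvoo d0; rewrite in_itv /= => /andP[r0 rd].
  have r20 : 0 < ratr r / 2 :> R by rewrite divr_gt0.
  have /choice[q qE] i : exists q : rat, `|y i s - ratr q| < ratr r / 2.
    have [|q] := @rat_in_itvoo R (y i s) (y i s + ratr r / 2); first by rewrite ltrDl.
    rewrite in_itv /= => /andP[q1 q2]; exists q.
    by rewrite distrC ger0_norm ?subr_ge0 ?ltW// ltrBlDl.
  exists ([seq (t, q t.1) | t <- K], r) => _; split=> [_ /mapP[t _ ->]//|b Ab bs H].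
  rewrite big_map; apply: Kd => // t tK; apply: lt_trans rd.
  by apply: (H (t, q t.1)); rewrite map_f.
apply/countable_injP; exists (fun s => pickle (F s)) => s s' /set_mem As /set_mem As'.
move=> /(pcan_inj pickleK) FE; apply: contrapT => ss'.
have [qs Ps] := FP _ As; have [qs' Ps'] := FP _ As'; rewrite -FE in qs' Ps'.
have near t : t \in (F s).1 -> `|y t.1.1 s - y t.1.1 s'| < ratr (F s).2.
  move=> tF; rewrite -(subrKA (ratr t.2)) (splitr (ratr (F s).2)).
  by rewrite (le_lt_trans (ler_normD _ _))// ltrD ?qs// distrC qs'.
have near' t : t \in (F s).1 -> `|y t.1.1 s' - y t.1.1 s| < ratr (F s).2.
  by move=> /near; rewrite distrC.
have := ltrD (Ps' _ As ss' near) (Ps _ As' (fun E => ss' (esym E)) near').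
rewrite addr0 -big_split /= big1 ?ltxx// => t _.
by rewrite -mulrDr addrC subrKA subrr mulr0.
Qed.

Theorem theorem25 (R : realType) (k n : nat) (k_gt0 : (0 < k)%N)
    (n_gt0 : (0 < n)%N) (C : small_weak_form_category R (n * k) k) :
  (exists (A : set R) (M : R -> ob C),
    [/\ is_interval A /\ (exists a b, [/\ A a, A b & a < b]),
        (forall a, A a -> maxipotent (C (M a))),
        {within A, continuous (fun a => vol (C (M a)))} /\
        (forall a b, A a -> A b -> a < b -> (vol (C (M a)) < vol (C (M b)))%E)
      & forall a a', A a -> A a' -> a <= a' ->
          domain_capacity (C (M a)) (C (M a')) = 1%E]) ->
  forall G : set (ob C -> \bar R),
    G `<=` Cap C -> fin_diff_generates G (Cap C) -> ~ countable G.
Proof.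
move=> [A [M [[iA [a [b [Aa Ab ab]]]] _ [_ volM] dcM]]] G GC GF cG.
have IA s : a < s < b -> A s by move=> /andP[sa sb]; apply: (iA a b) => //;
  rewrite !ltW.
(* Working inside ]a, b[ makes the volumes finite: a strictly larger one exists. *)
have volM_fin s : a < s < b -> (vol (C (M s)) < +oo)%E.
  move=> sab; have /andP[_ sb] := sab.
  exact: lt_le_trans (volM _ _ (IA _ sab) Ab sb) (leey _).
have dcM_lt1 s t : a < s < b -> A t -> t < s ->
    (domain_capacity (C (M s)) (C (M t)) < 1)%E.
  move=> sab At ts; apply: domain_capacity_lt1 => //; first exact: volM_fin.
  exact: volM _ _ At (IA _ sab) ts.
pose dc s X := domain_capacity (C (M s)) (C X).
have CapM s : Cap C (dc s) by exact: Cap_domain_capacity.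
have dcMM s : A s -> dc s (M s) = 1%E by move=> As; exact: dcM.
have min_self s : A s -> cap_min (M s) (M s) = 1%E.
  by move=> /dcMM; exact: cap_min_self.
have max_self s : A s -> cap_max (M s) (M s) = 1%E.
  by move=> /dcMM; exact: cap_max_self.
have min_le s t : A s -> (cap_min (M s) (M t) <= dc s (M t))%E.
  by move=> As; apply: cap_min_le => //; rewrite dcMM.
have minle1 s t : a < s < b -> A t -> (cap_min (M s) (M t) <= 1)%E.
  move=> sab At; have As := IA _ sab; apply: le_trans (min_le _ _ As) _.
  have [st|/(dcM_lt1 s t sab At)/ltW//] := leP s t.
  by rewrite /dc dcM.
have max_ge1 s t : A s -> a < t < b -> (1 <= cap_max (M s) (M t))%E.
  move=> As tab; have At := IA _ tab; rewrite -[leLHS](dcMM t)//.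
  apply: cap_max_ge => //; have [ts|/(dcM_lt1 t s tab As)/ltW//] := leP t s.
  by rewrite /dc dcM.
have gap_gt0 s t : a < s < b -> a < t < b -> t <> s -> 0 < cap_gap (M s) (M t).
  move=> sab tab ts; have As := IA _ sab; have At := IA _ tab.
  rewrite subr_gt0 ltNge le_contract -ltNge.
  have [ts'|st|//] := ltgtP t s.
    apply: lt_le_trans (max_ge1 _ _ As tab).
    exact: le_lt_trans (min_le _ _ As) (dcM_lt1 _ _ sab At ts').
  apply: le_lt_trans (minle1 _ _ sab At) _.
  have := dcM_lt1 t s tab As st; have := domain_capacity_ge0 (C (M t)) (C (M s)).
  case E : (domain_capacity _ _) => [r| |]//; rewrite lee_fin lte_fin => r0 r1.
  (* As r < 1, the factor 2 / (1 + r) exceeds 1 but brings the value r at M_s to at most 1; the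
     factor 1 / r would fail for r = 0. *)
  have r2 : 0 < 2 / (1 + r) by rewrite divr_gt0// ltr_wpDr.
  have := @cap_max_ge _ _ _ C _ (M s) (M t) (Cap_scale r2 (CapM t)).
  rewrite {1}/dc E -EFinM lee_fin dcMM// mule1.
  have r1' : 0 < 1 + r by lra.
  rewrite mulrAC ler_pdivrMr// => H.
  apply: lt_le_trans (H _); last by lra.
  by rewrite lte_fin ltr_pdivlMr//; lra.
have [/countable_injP[f finj]] := cG.
(* Indices not attained by f on G get a default value, possibly outside G; this is why
   [fin_diff_linear] also ensures that the listed generators belong to G. *)
have /choice[g gE] i : exists g, (exists2 h, G h & f h = i) -> G g /\ f g = i.
  have [[h Gh fh]|nh] := pselect (exists2 h, G h & f h = i); first by exists h.
  by exists point.
have gG h : G h -> exists i, g i = h.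
  move=> Gh; exists (f h); have [|Gg fg] := gE (f h); first by exists h.
  by apply: finj => //; rewrite inE.
have G0 h X : G h -> (0 <= h X)%E by move=> /GC[].
pose I : set R := [set` `]a, b[ ].
(* Countable sets are null, whereas I has measure b - a > 0. *)
suff /countable_lebesgue_measure0 : countable I.
  rewrite /= lebesgue_measure_itv /= lte_fin ab -EFinB => /eqP.
  by rewrite eqe subr_eq0 gt_eqF.
apply: (@countable_separated R R I (fun i s => contract (g i (M s)))) => s.
rewrite /I /= in_itv /= => sab; have As := IA _ sab.
(* The increments are at most twice the gap, so each of the two linear approximations errs by at
   most a quarter of the gap, and together they leave at least half of it. *)
have e0 : 0 < 8^-1 :> R by [].
have [K1 [d1 [d10 K1G H1]]] :=
  fin_diff_linear (M s) GF G0 gG (Cap_min (M s)) e0.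
have [K2 [d2 [d20 K2G H2]]] :=
  fin_diff_linear (M s) GF G0 gG (Cap_max (M s)) e0.
(* This combination approximates the increment of [cap_max] minus that of [cap_min], which is the
   gap itself since both capacities are 1 at M_s. *)
exists (K2 ++ [seq (t.1, - t.2) | t <- K1]), (Num.min d1 d2).
rewrite lt_min d10 d20; split=> // t; rewrite in_itv /= => tab ts near.
have gap0 := gap_gt0 _ _ sab tab ts.
have gap20 : 0 <= 2 * cap_gap (M s) (M t) by rewrite mulr_ge0// ltW.
have dist h : G h -> `|contract (h (M t)) - contract (h (M s))| <=
    2 * cap_gap (M s) (M t).
  move=> /GC Ch; apply: Cap_dist_le_gap => //.
  by rewrite minle1 ?max_ge1//; exact: IA.
have near1 u : u \in K1 -> `|contract (g u.1 (M t)) - contract (g u.1 (M s))| < d1.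
  move=> uK; have := near (u.1, - u.2); rewrite lt_min => /(_ _)/andP[]//.
  by rewrite mem_cat (map_f (fun t => (t.1, - t.2)) uK) orbT.
have near2 u : u \in K2 -> `|contract (g u.1 (M t)) - contract (g u.1 (M s))| < d2.
  by move=> uK; have := near u; rewrite mem_cat uK lt_min => /(_ isT)/andP[].
have := H1 (M t) _ gap20 (fun u uK => conj (near1 u uK) (dist _ (K1G u uK))).
have := H2 (M t) _ gap20 (fun u uK => conj (near2 u uK) (dist _ (K2G u uK))).
rewrite big_cat big_map /=.
under [X in _ -> _ -> _ < _ + X]eq_bigr do rewrite rmorphN mulNr.
rewrite sumrN min_self// max_self//.
move: gap0; rewrite /cap_gap !ler_norml => gap0 /andP[_ H2'] /andP[H1' _].
lra.
Qed.
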